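(* Let $\alpha=\{\alpha_I\}_{I\in\Delta}\in\ell^\infty$, let $1<p<\infty$, and let $T_\alpha$ be the constant Haar multiplier on $\mathbb{R}$, $$T_\alpha f(x)=\sum_{I\in\Delta}\alpha_I\,\langle f,h_I\rangle\,h_I(x).$$ (1) There is a constant $C_p$, depending only on $p$, such that for every $w\in A_p$ and every $f\in L^p(w)$, $$\|T_\alpha f\|_{L^p(w)}\le C_p\,\|\alpha\|_{\ell^\infty}\,[w]_{A_p}^{\max\left(1,\frac{1}{p-1}\right)}\,\|f\|_{L^p(w)}.$$ (2) Let $A$ and $B$ be Young functions such that $\bar{A}\in B_{p'}$ and $\bar{B}\in B_p$, and let $(u,v)$ be a pair of weights on $\mathbb{R}$ such that $$\sup_Q \|u^{1/p}\|_{A,Q}\,\|v^{-1/p}\|_{B,Q}<\infty,$$ the supremum being over all bounded intervals $Q\subset\mathbb{R}$. Then there is a constant $C$, independent of $f$ and $\alpha$, such that for every $f\in L^p(v)$, $$\|T_\alpha f\|_{L^p(u)}\le C\,\|\alpha\|_{\ell^\infty}\,\|f\|_{L^p(v)}.$$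
   Context: $\Delta$ is the collection of dyadic intervals in $\mathbb{R}$, i.e. the intervals $[m2^k,(m+1)2^k)$, $m,k\in\mathbb{Z}$. For $I\in\Delta$, $I_+$ and $I_-$ are its right and left halves, and the Haar function is $h_I(x)=|I|^{-1/2}\big(\chi_{I_-}(x)-\chi_{I_+}(x)\big)$; $\langle f,g\rangle=\int fg\,dx$. A weight is a non-negative, locally integrable function on $\mathbb{R}$; $\|f\|_{L^p(w)}=\left(\int|f|^pw\,dx\right)^{1/p}$; $p'=p/(p-1)$. A weight $w$ is in $A_p$ if $$[w]_{A_p}=\sup_Q\left(\frac{1}{|Q|}\int_Q w\,dx\right)\left(\frac{1}{|Q|}\int_Q w^{1-p'}\,dx\right)^{p-1}<\infty,$$ the supremum being over all bounded intervals $Q$. A Young function is a function $A:[0,\infty)\to[0,\infty)$ that is continuous, convex and strictly increasing, with $A(0)=0$ and $A(t)/t\to\infty$ as $t\to\infty$. Its associate function is $\bar{A}(t)=\sup_{s>0}\{st-A(s)\}$. The localized Luxemburg norm is $$\|f\|_{A,Q}=\inf\left\{\lambda>0:\frac{1}{|Q|}\int_Q A\left(\frac{|f(x)|}{\lambda}\right)dx\le 1\right\}.$$ A Young function $A$ satisfies the $B_p$ condition, written $A\in B_p$, if for some $c>0$, $\int_c^\infty \frac{A(t)}{t^p}\frac{dt}{t}<\infty$. The norm inequalities are understood in the usual sense: $T_\alpha$ is defined on $L^2$, the inequality holds for $f\in L^2\cap L^p$ (with the relevant weight), and elsewhere on the weighted space $T_\alpha$ denotes the unique continuous extension. *)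

(* Defs.v *)
From HB Require Import structures.
From mathcomp Require Import all_boot all_order all_algebra finmap.
From mathcomp Require Import all_classical all_reals all_analysis.

Set Implicit Arguments.
Unset Strict Implicit.
Unset Printing Implicit Defensive.

Import Order.TTheory GRing.Theory Num.Theory.
Import numFieldNormedType.Exports.

Local Open Scope classical_set_scope.
Local Open Scope ring_scope.

Section Weights.
Variable R : realType.
Implicit Types (f g u v w : R -> R) (Q : set R) (p : R).

Local Notation mu := (@lebesgue_measure R).

Definition conj_exponent p : R := p / (p - 1).

(* The library has [0 `^ r = 0] for [r < 0]; the powers [w ^ (1 - p')] and
   [v ^ (- 1 / p)] of a weight must be infinite where the weight vanishes. *)
Definition epow (x r : R) : \bar R :=
  if (x == 0) && (r < 0) then +oo%E else (x `^ r)%:E.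

(* All four choices of open or closed endpoints are allowed. *)
Definition bounded_interval Q : Prop :=
  exists a b : R, exists c d : bool,
    a < b /\ Q = [set` Interval (BSide c a) (BSide d b)].

Definition average Q (F : R -> \bar R) : \bar R :=
  ((fine (mu Q))^-1%:E * \int[mu]_(x in Q) F x)%E.

Definition weight w : Prop :=
  (forall x, 0 <= w x) /\ locally_integrable setT w.

Definition Lp_norm p w f : \bar R :=
  ((\int[mu]_x (`|f x| `^ p * w x)%:E) `^ p^-1)%E.

Definition in_Lp p w f : Prop :=
  measurable_fun setT f /\ (Lp_norm p w f < +oo)%E.

(* Equality almost everywhere for the measure [w dx]. *)
Definition ae_eq_weight w f g : Prop :=
  {ae mu, forall x, w x != 0 -> f x = g x}.

Definition Ap_const p w : \bar R :=
  ereal_sup [set (average Q (EFin \o w) *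
      (average Q (fun x => epow (w x) (1 - conj_exponent p)%R)) `^ (p - 1)%R)%E
    | Q in bounded_interval].

Definition Ap_weight p w : Prop := weight w /\ (Ap_const p w < +oo)%E.

End Weights.

Section Young.
Variable R : realType.

Local Notation mu := (@lebesgue_measure R).

(* A function on [0, oo) is represented by a function on R whose values at
   negative arguments are irrelevant. *)
Definition young_function (A : R -> R) : Prop :=
  [/\ forall t, 0 <= t -> 0 <= A t,
      {within `[0, +oo[, continuous A},
      @convex_function R R^o `[0, +oo[ A,
      {in `[0, +oo[ &, {homo A : s t / s < t}} &
      A 0 = 0 /\ A t / t @[t --> +oo] --> +oo].

Definition associate (A : R -> R) (t : R) : \bar R :=
  ereal_sup [set (s * t - A s)%:E | s in [set s | 0 < s]].

Definition Bp (p : R) (A : R -> \bar R) : Prop :=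
  exists c : R, 0 < c /\
    (\int[mu]_(t in `[c, +oo[) (A t * (t `^ p)^-1%:E * t^-1%:E) < +oo)%E.

(* [er_map A] extends [A] by [A(+oo) = +oo]: [F] may be infinite. *)
Definition luxemburg (A : R -> R) (Q : set R) (F : R -> \bar R) : \bar R :=
  ereal_inf [set l%:E | l in
    [set l | 0 < l /\
      (average Q (fun x => er_map A (`|F x| * l^-1%:E)) <= 1)%E]].

Definition bump_const (p : R) (A B : R -> R) (u v : R -> R) : \bar R :=
  ereal_sup [set (luxemburg A Q (fun x => epow (u x) p^-1%R) *
                  luxemburg B Q (fun x => epow (v x) (- p^-1)%R))%E
    | Q in @bounded_interval R].

End Young.

Section HaarMultiplier.
Variable R : realType.
Implicit Types (f g u v : R -> R).

Local Notation mu := (@lebesgue_measure R).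

(* [(k, m)] stands for the dyadic interval [m 2^k, (m + 1) 2^k). *)
Definition dyadic : Type := (int * int)%type.

Definition dyadic_length (I : dyadic) : R := 2 ^ I.1.

Definition dyadic_set (I : dyadic) : set R :=
  `[I.2%:~R * dyadic_length I, (I.2 + 1)%:~R * dyadic_length I[.

Definition left_half (I : dyadic) : dyadic := (I.1 - 1, I.2 * 2).
Definition right_half (I : dyadic) : dyadic := (I.1 - 1, I.2 * 2 + 1).

Definition haar (I : dyadic) (x : R) : R :=
  (Num.sqrt (dyadic_length I))^-1 *
  (\1_(dyadic_set (left_half I)) x - \1_(dyadic_set (right_half I)) x).

Definition inner f g : R := \int[mu]_x (f x * g x).

Definition linfty_norm (alpha : dyadic -> R) : \bar R :=
  ereal_sup [set `|alpha I|%:E | I in [set: dyadic]].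

Definition in_L2 f : Prop := f \in Lfun mu 2%:E.

Definition haar_partial_sum (alpha : dyadic -> R) (F : {fset (int * int)}) f
    (x : R) : R :=
  \sum_(I <- F) alpha I * inner f (haar I) * haar I x.

(* The relation [T_alpha f = g] on L^2: the index set of the series has no
   preferred order, so it converges along finite subfamilies (unconditionally). *)
Definition haar_multiplier (alpha : dyadic -> R) f g : Prop :=
  [/\ in_L2 f, in_L2 g & forall e : R, 0 < e ->
    exists F0 : {fset (int * int)}, forall F : {fset (int * int)},
      (F0 `<=` F)%fset ->
      (Lnorm mu 2%:E
         (fun x => (haar_partial_sum alpha F f x - g x)%R%:E) < e%:E)%E].

(* Elements of weighted spaces are represented by functions, so [T] extends
   [T_alpha] only up to equality almost everywhere for [u dx]. *)
Definition haar_extension (alpha : dyadic -> R) (p : R) u v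
    (T : (R -> R) -> (R -> R)) : Prop :=
  [/\ forall f, in_Lp p v f -> in_Lp p u (T f),
      forall f, in_L2 f -> in_Lp p v f ->
        exists2 g, haar_multiplier alpha f g & ae_eq_weight u (T f) g &
      forall f, in_Lp p v f -> forall e : R, 0 < e ->
        exists2 d : R, 0 < d & forall f', in_Lp p v f' ->
          (Lp_norm p v (f' \- f)%R < d%:E)%E ->
          (Lp_norm p u (T f' \- T f)%R < e%:E)%E].

(* On the intersection of L^2 and L^p(v) the inequality concerns the L^2
   operator; on all of L^p(v) it concerns its unique continuous extension,
   whose existence and uniqueness are part of the claim. *)
Definition haar_norm_inequality (alpha : dyadic -> R) (p : R) u v
    (K : \bar R) : Prop :=
  (forall f g, in_L2 f -> in_Lp p v f -> haar_multiplier alpha f g ->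
     (Lp_norm p u g <= K * Lp_norm p v f)%E) /\
  exists T : (R -> R) -> (R -> R),
    [/\ haar_extension alpha p u v T,
        forall T', haar_extension alpha p u v T' ->
          forall f, in_Lp p v f -> ae_eq_weight u (T' f) (T f) &
        forall f, in_Lp p v f ->
          (Lp_norm p u (T f) <= K * Lp_norm p v f)%E].

End HaarMultiplier.

(* Main.v *)
Require Import Defs.
From HB Require Import structures.
From mathcomp Require Import all_boot all_order all_algebra finmap.
From mathcomp Require Import all_classical all_reals all_analysis.
From mathcomp Require Import measurable_realfun.
From mathcomp Require Import ring lra zify.
Import Order.TTheory GRing.Theory Num.Theory.
Import numFieldNormedType.Exports.
Local Open Scope classical_set_scope.
Local Open Scope ring_scope.

(** The multiplier is dominated by positive sparse sums, and the weights enter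
    only through one estimate for these sums.

    Sparse domination.  Let g be the sum of alpha_I <f, h_I> h_I over a finite
    family of intervals.  Testing g against sgn(g) |g|^(p-1) u turns the
    integral of |g|^p u into a finite sum of products of Haar coefficients
    ([pairing_bound]).  A squared Haar coefficient is the increment of
    (int_I f)^2 / |I| when I is split into its halves ([haar_energy]), so sums
    of squares telescope along a tree of dyadic intervals.  Going down from Q
    until one of the two averages exceeds four times its value on Q, the
    arithmetic-geometric mean inequality and telescoping bound the products by
    the product of the two averages on Q times |Q| ([stopping_time]); the
    stopped intervals fill at most half of Q.  Iteration gives a sparse family
    ([sparse_domination]): its intervals Q carry disjoint subsets E with
    |Q| <= 2 |E|.

    The weights.  [sparse_form_bound] asks that each term of a sparse sum be at
    most K x^(1/p) y^(1/p'), where the x add up to at most a multiple of the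
    integral of |f|^p v, and the y to at most a multiple of the integral of
    gam^p' u.  For gam = |g|^(p-1) the latter is the integral of |g|^p u that is
    being estimated; it is finite and is absorbed ([finite_sum_bound]), with
    constants that do not depend on the finite family.  The x and y are powers
    of local averages times masses of the disjoint sets E, and they are summed
    by a Carleson embedding ([maximal_theorem]).  For an A_p weight the averages
    are taken with respect to w and its dual weight; sparsity and the A_p
    condition give the power max(1, 1/(p-1)) ([moen_inequality_max]).  In the
    two-weight case the averages are replaced by gauges of |f| v^(1/p) and
    gam u^(1/p') for the conjugate Young functions; a Hoelder inequality
    ([young_hoelder]) brings in the two Luxemburg norms, and B_p is the
    condition under which the embedding holds for gauges ([gauge_embedding]).

    The operator.  The same telescoping gives Bessel's inequality
    ([haar_bessel]), hence unconditional convergence of the series in L^2.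
    Fatou's lemma carries the uniform bound of the finite sums over to T_alpha
    ([haar_multiplier_bound]).  Truncations are dense, and a Riesz-Fischer
    argument in the weighted spaces produces the continuous extension and shows
    that it is unique ([haar_norm_inequality_of_bound]). *)

Set Implicit Arguments.
Unset Strict Implicit.
Unset Printing Implicit Defensive.

(** * Dyadic intervals *)

Lemma le_of_eq d (T : porderType d) (x y : T) : x = y -> (x <= y)%O.
Proof. by move=> ->. Qed.

Section DyadicIntervals.
Variable R : realType.
Local Notation mu := (@lebesgue_measure R).
Local Notation len := (@dyadic_length R).
Local Notation dset := (@dyadic_set R).

Lemma dyadic_length_gt0 I : 0 < len I.
Proof. by rewrite /dyadic_length exprz_gt0. Qed.

Lemma dyadic_length_ge0 I : 0 <= len I.
Proof. exact/ltW/dyadic_length_gt0. Qed.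

Lemma dyadic_length_neq0 I : len I != 0.
Proof. by rewrite gt_eqF// dyadic_length_gt0. Qed.

Lemma dyadic_length_left I : len (left_half I) = len I / 2.
Proof. by rewrite /dyadic_length /left_half /= expfzDr// exprN1. Qed.

Lemma dyadic_length_right I : len (right_half I) = len I / 2.
Proof. by rewrite /dyadic_length /right_half /= expfzDr// exprN1. Qed.

Lemma mem_dyadic_set I x :
  dset I x <-> I.2%:~R * len I <= x < (I.2 + 1)%:~R * len I.
Proof. by rewrite /dyadic_set /= in_itv. Qed.

Lemma measurable_dyadic_set I : measurable (dset I).
Proof. exact: measurable_itv. Qed.

Lemma lebesgue_dyadic_set I : mu (dset I) = (len I)%:E.
Proof.
rewrite /dyadic_set lebesgue_measure_itv/= lte_fin.
have -> : (I.2 + 1)%:~R * len I = I.2%:~R * len I + len I by rewrite intrD mulrDl mul1r.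
by rewrite ltrDl dyadic_length_gt0 -EFinB addrC addKr.
Qed.

Lemma mem_left_half I x : dset (left_half I) x <->
  I.2%:~R * len I <= x < I.2%:~R * len I + len I / 2.
Proof.
rewrite mem_dyadic_set dyadic_length_left /= intrD !intrM.
have -> : I.2%:~R * 2%:~R * (len I / 2) = I.2%:~R * len I by field.
have -> : (I.2%:~R * 2%:~R + 1%:~R) * (len I / 2) = I.2%:~R * len I + len I / 2 by field.
by [].
Qed.

Lemma mem_right_half I x : dset (right_half I) x <->
  I.2%:~R * len I + len I / 2 <= x < (I.2 + 1)%:~R * len I.
Proof.
rewrite mem_dyadic_set dyadic_length_right /= !intrD !intrM.
have -> : (I.2%:~R * 2%:~R + 1%:~R) * (len I / 2) = I.2%:~R * len I + len I / 2 by field.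
have -> : (I.2%:~R * 2%:~R + 1%:~R + 1%:~R) * (len I / 2) = (I.2%:~R + 1%:~R) * len I by field.
by [].
Qed.

Lemma dyadic_set_halves I : dset I = dset (left_half I) `|` dset (right_half I).
Proof.
have h := dyadic_length_gt0 I.
apply/seteqP; split=> x.
  move=> /mem_dyadic_set /andP[h1 h2].
  have [h3|h3] := ltP x (I.2%:~R * len I + len I / 2).
    by left; apply/mem_left_half; rewrite h1 h3.
  by right; apply/mem_right_half; rewrite h2 h3.
case=> [/mem_left_half|/mem_right_half] /andP[h1 h2]; apply/mem_dyadic_set;
  move: h2; rewrite intrD mulrDl => h2; apply/andP; split; lra.
Qed.

Lemma halves_disjoint I : dset (left_half I) `&` dset (right_half I) = set0.
Proof.
apply/seteqP; split=> x //= [/mem_left_half /andP[h1 h2] /mem_right_half /andP[h3 h4]].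
by have := lt_le_trans h2 h3; rewrite ltxx.
Qed.

Lemma indic_halves I x :
  \1_(dset I) x = \1_(dset (left_half I)) x + \1_(dset (right_half I)) x :> R.
Proof. rewrite !indicE {1}dyadic_set_halves in_setU.
have := halves_disjoint I; move/seteqP => [/(_ x) h _].
case: (boolP (x \in dset (left_half I))) => /= [/set_mem xl|]; last by rewrite add0r.
by case: (boolP (x \in dset (right_half I))) => /= [/set_mem xr|_]; [case: h|rewrite addr0]. Qed.

Definition parent (I : dyadic) : dyadic := (I.1 + 1, (I.2 %/ 2)%Z).

Lemma parentP I : I = left_half (parent I) \/ I = right_half (parent I).
Proof.
case: I => k m; rewrite /left_half /right_half /parent /= addrK.
have h := divz_eq m 2.
have : (0 <= m %% 2)%Z /\ (m %% 2 < 2)%Z by rewrite modz_ge0 // ltz_pmod.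
move=> [h1 h2].
have [e|e] : ((m %% 2)%Z = 0 \/ (m %% 2)%Z = 1) by lia.
  by left; congr pair; rewrite {1}h e addr0.
by right; congr pair; rewrite {1}h e.
Qed.

Lemma sub_parent I : dset I `<=` dset (parent I).
Proof.
by rewrite (dyadic_set_halves (parent I)); case: (parentP I) => {1}->; [left|right].
Qed.

Lemma sub_iter_parent (j : nat) I : dset I `<=` dset (iter j parent I).
Proof.
elim: j => [|j ih] //=; apply: subset_trans ih _; exact: sub_parent.
Qed.

Lemma iter_parent1 j I : (iter j parent I).1 = I.1 + j%:Z.
Proof. by elim: j => [|j ih] /=; rewrite ?addr0// ih -addrA; congr +%R; lia. Qed.

Lemma dyadic_same_length I J x : I.1 = J.1 -> dset I x -> dset J x -> I = J.
Proof.
case: I J => k m [l n] /= ->.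
move=> /mem_dyadic_set /andP[/= h1 h2] /mem_dyadic_set /andP[/= h3 h4].
have h := dyadic_length_gt0 (l, m).
have h5 := le_lt_trans h1 h4; have h6 := le_lt_trans h3 h2.
move: h5 h6; rewrite /dyadic_length/= !ltr_pM2r ?exprz_gt0// !ltr_int => h5 h6.
congr pair; lia.
Qed.

(** The ancestor of I that is as long as J meets J, so it is J. *)
Lemma dyadic_nested_le (I J : dyadic) x : I.1 <= J.1 -> dset I x -> dset J x ->
  dset I `<=` dset J.
Proof.
move=> IJ Ix Jx.
have [j jE] : exists j : nat, J.1 = I.1 + j%:Z.
  by exists `|J.1 - I.1|%N; lia.
have e := iter_parent1 j I; rewrite -jE in e.
rewrite -(dyadic_same_length e (@sub_iter_parent j _ _ Ix) Jx).
exact: sub_iter_parent.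
Qed.

Lemma dyadic_nested I J x : dset I x -> dset J x ->
  dset I `<=` dset J \/ dset J `<=` dset I.
Proof.
move=> Ix Jx; have [h|h] := leP I.1 J.1.
  by left; exact: dyadic_nested_le Ix Jx.
by right; apply: dyadic_nested_le Jx Ix; exact: ltW.
Qed.

Lemma sum_indic_ge1 (T : eqType) (s : seq T) (E : T -> set R) (i : T) x :
  i \in s -> E i x -> (1 : R) <= \sum_(j <- s) \1_(E j) x.
Proof.
move=> si Eix; rewrite (big_rem i)//= indicE mem_set// lerDl.
by apply: sumr_ge0 => j _; rewrite indicE.
Qed.

Lemma sum_indic_gt0 (T : eqType) (s : seq T) (E : T -> set R) x :
  (0 : R) < \sum_(j <- s) \1_(E j) x -> exists2 i, i \in s & E i x.
Proof.
elim: s => [|a s ih]; first by rewrite big_nil ltxx.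
rewrite big_cons indicE; case: (boolP (x \in E a)) => [/set_mem Eax _|_].
  by exists a; rewrite ?mem_head.
by rewrite add0r => /ih[i si Ei]; exists i; rewrite ?in_cons ?si ?orbT.
Qed.

(** Dyadic intervals that meet are nested.  So a new interval either lies in a
    chosen one, or replaces the chosen ones inside it.  Disjointness and covering
    are stated with sums of indicators, the form in which they get integrated. *)
Lemma maximal_subfamily (L : seq dyadic) : exists2 M : seq dyadic,
  {subset M <= L} &
  (forall x, \sum_(I <- M) \1_(dset I) x <= (1 : R)) /\
  (forall I x, I \in L -> dset I x -> (1 : R) <= \sum_(J <- M) \1_(dset J) x).
Proof.
elim: L => [|I L [M ML [M1 M2]]].
  by exists [::] => //; split=> // x; rewrite big_nil ler01.
have [[J JM IJ]|nIM] := pselect (exists2 J, J \in M & dset I `<=` dset J).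
  exists M; first by move=> K /ML KL; rewrite in_cons KL orbT.
  split=> // K x; rewrite in_cons => /orP[/eqP->|]; last exact: M2.
  by move=> /IJ; exact: sum_indic_ge1.
pose M' := [seq J <- M | ~~ `[< dset J `<=` dset I >]].
have M'0 x : dset I x -> \sum_(J <- M') \1_(dset J) x = 0 :> R.
  move=> Ix; rewrite big_seq big1// => J; rewrite mem_filter => /andP[/asboolPn JI JM].
  rewrite indicE; case: (boolP (x \in _)) => // /set_mem Jx.
  have [h|//] := dyadic_nested Ix Jx.
  by exfalso; apply: nIM; exists J.
exists (I :: M').
  move=> K; rewrite !in_cons => /orP[->//|]; rewrite mem_filter => /andP[_ /ML ->].
  by rewrite orbT.
split.
  move=> x; rewrite big_cons {1}indicE; case: (boolP (x \in _)) => [/set_mem/M'0->|_].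
    by rewrite addr0.
  rewrite add0r; apply: le_trans (M1 x); rewrite big_filter [leLHS]big_mkcond.
  by apply: ler_sum => J _; case: ifP.
move=> K x KIL Kx; have [Ix|nIx] := pselect (dset I x).
  by apply: (@sum_indic_ge1 _ _ dset I) => //; rewrite mem_head.
move: KIL; rewrite in_cons => /orP[/eqP KI|KL]; first by rewrite KI in Kx.
have := lt_le_trans ltr01 (M2 K x KL Kx) => /sum_indic_gt0[J JM Jx].
apply: (@sum_indic_ge1 _ _ dset J) => //; rewrite in_cons mem_filter JM andbT.
by apply/orP; right; apply/asboolPn => /(_ x Jx).
Qed.

Fixpoint tree (n : nat) (Q : dyadic) : seq dyadic :=
  if n is m.+1 then Q :: tree m (left_half Q) ++ tree m (right_half Q) else [::].

Lemma mem_treeS n (I Q : dyadic) : I \in tree n Q -> I \in tree n.+1 Q.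
Proof.
elim: n Q => [//|n ih] Q.
have treeE m : (I \in tree m.+1 Q) = [|| I == Q, I \in tree m (left_half Q)
    | I \in tree m (right_half Q)] by rewrite [tree _ _]/= in_cons mem_cat.
by rewrite !treeE => /or3P[->//|/ih->|/ih->]; rewrite !orbT.
Qed.

Lemma mem_tree_leq n m (I Q : dyadic) : (n <= m)%N -> I \in tree n Q -> I \in tree m Q.
Proof.
move=> /subnK<-; elim: (m - n)%N => [//|k ih] /ih; rewrite addSn; exact: mem_treeS.
Qed.

Lemma mem_tree_parent n (I Q : dyadic) : I \in tree n Q -> I \in tree n.+1 (parent Q).
Proof.
move=> IQ; rewrite [tree n.+1 _]/= in_cons mem_cat.
by case: (parentP Q) => <-; rewrite IQ ?orbT.
Qed.

Lemma mem_tree_iter_parent j I : I \in tree j.+1 (iter j parent I).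
Proof.
by elim: j => [|j ih]; [rewrite mem_head|exact: mem_tree_parent].
Qed.

(** The parent of [m 2^k, (m + 1) 2^k) has position floor(m / 2), so the positions
    shrink until they reach one of the two fixed points 0 and -1. *)
Lemma iter_parent_origin I :
  exists j, (iter j parent I).2 = 0 \/ (iter j parent I).2 = -1.
Proof.
case: I => k m.
suff H n : forall k m, (`|m| <= n)%N -> exists j,
    (iter j parent (k, m)).2 = 0 \/ (iter j parent (k, m)).2 = -1 by exact: (H `|m|%N).
elim: n => [|n ih] {}k {}m mn.
  by exists 0%N => /=; left; lia.
have [[->|->]|h] : (m = 0 \/ m = -1) \/ (m != 0 /\ m != -1) by lia.
- by exists 0%N; left.
- by exists 0%N; right.
have := ih (k + 1) (m %/ 2)%Z; case.
  have := divz_eq m 2.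
  have : (0 <= m %% 2)%Z /\ (m %% 2 < 2)%Z by rewrite modz_ge0 // ltz_pmod.
  move: (m %/ 2)%Z (m %% 2)%Z => q r; lia.
by move=> j hj; exists j.+1; rewrite iterSr.
Qed.

(** The intervals on either side of the origin have a common ancestor on their own
    side only, hence one tree for each side. *)
Lemma finite_sub_two_trees (s : seq dyadic) : exists k n,
  forall I : dyadic, I \in s -> I \in tree n (k, 0) ++ tree n (k, -1).
Proof.
have up k n (I : dyadic) : I \in tree n (k, 0) ++ tree n (k, -1) ->
    I \in tree n.+1 (k + 1, 0) ++ tree n.+1 (k + 1, -1).
  rewrite !mem_cat => /orP[]/mem_tree_parent; rewrite /parent/= => ->//.
  by rewrite orbT.
have ups j k n (I : dyadic) : I \in tree n (k, 0) ++ tree n (k, -1) ->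
    I \in tree (j + n) (k + j%:Z, 0) ++ tree (j + n) (k + j%:Z, -1).
  elim: j => [|j ih]; first by rewrite addr0 add0n.
  move=> /ih/up; have -> : k + j.+1%:Z = k + j%:Z + 1 by lia.
  by rewrite addSn.
have upn n m k (I : dyadic) : (n <= m)%N -> I \in tree n (k, 0) ++ tree n (k, -1) ->
    I \in tree m (k, 0) ++ tree m (k, -1).
  by move=> nm; rewrite !mem_cat => /orP[]/(mem_tree_leq nm)->; rewrite ?orbT.
elim: s => [|J s [k [n ih]]]; first by exists 0, 0%N.
have [j hj] := iter_parent_origin J.
have JT : exists l m, J \in tree m (l, 0) ++ tree m (l, -1).
  exists (iter j parent J).1, j.+1; have := mem_tree_iter_parent j J.
  move: hj; case: (iter j parent J) => a b [] hb; rewrite mem_cat => h; apply/orP.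
    by left; have <- : b = 0 := hb.
  by right; have <- : b = -1 := hb.
have [l [m Jlm]] := JT.
have [a [b ab]] : exists a b : nat, k + a%:Z = l + b%:Z.
  by exists `|Num.max k l - k|%N, `|Num.max k l - l|%N; lia.
exists (k + a%:Z), (maxn (a + n) (b + m)) => I; rewrite in_cons => /orP[/eqP->|Is].
  rewrite ab; apply: (upn (b + m)%N); [exact: leq_maxr|exact: ups].
by apply: (upn (a + n)%N); [exact: leq_maxl|exact/ups/ih].
Qed.

End DyadicIntervals.

(** * Sparse domination of Haar sums *)

Lemma sum_uniq_sub_le (R : numDomainType) (T : eqType) (s t : seq T) (h : T -> R) :
  uniq s -> {subset s <= t} -> (forall i, 0 <= h i) ->
  \sum_(i <- s) h i <= \sum_(i <- t) h i.
Proof.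
elim: s t => [|i s ih] t /=; first by move=> *; rewrite big_nil sumr_ge0.
move=> /andP[si us] st h0; rewrite big_cons [leRHS](big_rem i)/=; last by apply: st; exact: mem_head.
rewrite lerD2l ih// => j sj.
have : j \in t by apply: st; rewrite in_cons sj orbT.
have ti : i \in t by apply: st; exact: mem_head.
rewrite (perm_mem (perm_to_rem ti)) in_cons => /orP[/eqP ji|//].
by rewrite -ji sj in si.
Qed.

Lemma le_double_of_half (R : realFieldType) (l : R) (z : \bar R) :
  (l%:E <= z + (l / 2)%:E -> l%:E <= 2%:E * z)%E.
Proof.
case: z => [z| |].
- by rewrite -EFinD -EFinM !lee_fin; lra.
- by rewrite gt0_muley ?leey// lte_fin.
- by rewrite addNye leeNy_eq.
Qed.

Section SparseDomination.
Variable R : realType.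
Local Notation mu := (@lebesgue_measure R).
Local Notation len := (@dyadic_length R).
Local Notation dset := (@dyadic_set R).

Definition additive_on_dyadics (F : dyadic -> R) :=
  forall I, F I = F (left_half I) + F (right_half I).

Definition haar_gap (F : dyadic -> R) I := F (left_half I) - F (right_half I).

(** The parallelogram identity: with a and b the values on the halves, the right
    side is (2 a^2 + 2 b^2 - (a + b)^2) / |I|.  It is the increment of F^2 / |I|
    under splitting, which is why sums of squared gaps telescope. *)
Lemma haar_energy F I : additive_on_dyadics F ->
  haar_gap F I ^+ 2 / len I = F (left_half I) ^+ 2 / len (left_half I) +
    F (right_half I) ^+ 2 / len (right_half I) - F I ^+ 2 / len I.
Proof.
move=> /(_ I) ->; rewrite /haar_gap dyadic_length_left dyadic_length_right.
by have := dyadic_length_neq0 R I; move: (len I) => l l0; field.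
Qed.

(** Telescoping leaves the sum of F^2 / |I| over the last generation, minus the
    same quantity for Q. *)
Lemma tree_energy n F Q (E : dyadic -> R) : additive_on_dyadics F ->
  (forall I, F I ^+ 2 / len I <= E I) ->
  (forall I, E I = E (left_half I) + E (right_half I)) ->
  \sum_(I <- tree n Q) haar_gap F I ^+ 2 / len I <= E Q.
Proof.
move=> Fadd FE Eadd.
suff : \sum_(I <- tree n Q) haar_gap F I ^+ 2 / len I + F Q ^+ 2 / len Q <= E Q.
  apply: le_trans; rewrite lerDl divr_ge0 ?sqr_ge0//; exact: dyadic_length_ge0.
elim: n Q => [|n ih] Q; first by rewrite big_nil add0r.
rewrite big_cons big_cat/= haar_energy// Eadd.
have := lerD (ih (left_half Q)) (ih (right_half Q)); lra.
Qed.

Variables F G Fh Gh : dyadic -> R.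
Hypotheses (Fadd : additive_on_dyadics F) (Gadd : additive_on_dyadics G).
Hypotheses (Fhadd : additive_on_dyadics Fh) (Ghadd : additive_on_dyadics Gh).
Hypotheses (FFh : forall I, `|F I| <= Fh I) (GGh : forall I, `|G I| <= Gh I).

Let Fh0 I : 0 <= Fh I. Proof. exact: le_trans (FFh I). Qed.
Let Gh0 I : 0 <= Gh I. Proof. exact: le_trans (GGh I). Qed.
Let len0 := dyadic_length_gt0 R.

Definition haar_product I := `|haar_gap F I| * `|haar_gap G I| / len I.

Lemma haar_gap_le (H Hh : dyadic -> R) I : (forall I, `|H I| <= Hh I) ->
  additive_on_dyadics Hh -> `|haar_gap H I| <= Hh I.
Proof. by move=> HHh ->; apply: le_trans (ler_normB _ _) _; exact: lerD. Qed.

Definition stopped (a b : R) I := (4 * a * len I < Fh I) || (4 * b * len I < Gh I).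

(** On intervals where the averages of Fh and Gh are about a and b, the mean
    inequality with ratio b / a bounds a product of gaps by energies that
    telescope, so only the energies at the end of the descent remain.  The average
    at most doubles in passing to a half, so an interval at which the descent ends
    has averages at most 8 a and 8 b, and energy at most 64 a b |I|. *)
Lemma stopping_time (a b : R) n Q : 0 < a -> 0 < b ->
  Fh Q <= 8 * a * len Q -> Gh Q <= 8 * b * len Q ->
  exists P : seq (nat * dyadic),
  [/\ forall q, q \in P -> (q.1 <= n)%N /\ (~~ stopped a b Q -> (q.1 < n)%N),
      forall q, q \in P -> stopped a b q.2,
      forall x, \sum_(q <- P) \1_(dset q.2) x <= \1_(dset Q) x :> R,
      \sum_(q <- P) Fh q.2 <= Fh Q /\ \sum_(q <- P) Gh q.2 <= Gh Q &
      \sum_(I <- tree n Q) haar_product I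
        + (b / a * (F Q ^+ 2 / len Q) + a / b * (G Q ^+ 2 / len Q)) / 2
      <= 64 * (a * b) * len Q +
         \sum_(q <- P) \sum_(I <- tree q.1 q.2) haar_product I].
Proof.
move=> a0 b0.
have energy I : Fh I <= 8 * a * len I -> Gh I <= 8 * b * len I ->
    (b / a * (F I ^+ 2 / len I) + a / b * (G I ^+ 2 / len I)) / 2
    <= 64 * (a * b) * len I.
  move=> h1 h2.
  have k1 : F I ^+ 2 <= (8 * a * len I) ^+ 2.
    by rewrite -real_normK ?num_real// lerXn2r ?nnegrE// ?(le_trans (FFh I))//
      (le_trans (Fh0 I)).
  have k2 : G I ^+ 2 <= (8 * b * len I) ^+ 2.
    by rewrite -real_normK ?num_real// lerXn2r ?nnegrE// ?(le_trans (GGh I))//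
      (le_trans (Gh0 I)).
  have l0 := len0 I.
  have -> : 64 * (a * b) * len I =
    (b / a * ((8 * a * len I) ^+ 2 / len I) + a / b * ((8 * b * len I) ^+ 2 / len I)) / 2.
    by field; rewrite !gt_eqF.
  rewrite ler_pM2r ?invr_gt0//; apply: lerD;
    by rewrite ler_pM2l ?divr_gt0// ler_pM2r ?invr_gt0.
elim: n Q => [|n ih] Q hF hG; have [st|nst] := boolP (stopped a b Q).
- exists [:: (0%N, Q)]; split => //.
  + by move=> q; rewrite inE => /eqP->.
  + by move=> q; rewrite inE => /eqP->.
  + by move=> x; rewrite big_seq1.
  + by rewrite !big_seq1.
  + by rewrite big_seq1/= big_nil add0r addr0 energy.
- exists [::]; split=> //; rewrite ?big_nil ?add0r ?addr0 ?energy//.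
  by move=> x; rewrite big_nil indicE.
- exists [:: (n.+1, Q)]; split => //.
  + by move=> q; rewrite inE => /eqP->.
  + by move=> q; rewrite inE => /eqP->.
  + by move=> x; rewrite big_seq1.
  + by rewrite !big_seq1.
  + by rewrite big_seq1 addrC lerD2r energy.
move: (nst); rewrite /stopped negb_or -!leNgt => /andP[nF nG].
(* no average on Q exceeds its threshold, and a half at most doubles it *)
have hFl : Fh (left_half Q) <= 8 * a * len (left_half Q).
  have := Fh0 (right_half Q); move: nF; rewrite Fhadd dyadic_length_left; lra.
have hFr : Fh (right_half Q) <= 8 * a * len (right_half Q).
  have := Fh0 (left_half Q); move: nF; rewrite Fhadd dyadic_length_right; lra.
have hGl : Gh (left_half Q) <= 8 * b * len (left_half Q).
  have := Gh0 (right_half Q); move: nG; rewrite Ghadd dyadic_length_left; lra.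
have hGr : Gh (right_half Q) <= 8 * b * len (right_half Q).
  have := Gh0 (left_half Q); move: nG; rewrite Ghadd dyadic_length_right; lra.
have [P1 [P11 P12 P13 [P14 P14'] P15]] := ih _ hFl hGl.
have [P2 [P21 P22 P23 [P24 P24'] P25]] := ih _ hFr hGr.
exists (P1 ++ P2); split.
- move=> q; rewrite mem_cat => /orP[/P11|/P21] [qn _]; split=> [|_].
  + exact: leqW.
  + by rewrite ltnS.
  + exact: leqW.
  + by rewrite ltnS.
- by move=> q; rewrite mem_cat => /orP[/P12|/P22].
- by move=> x; rewrite big_cat/= (indic_halves Q) lerD.
- by rewrite !big_cat/= (Fhadd Q) (Ghadd Q); split; exact: lerD.
rewrite [tree _ _]/= big_cons !big_cat/=.
have eF := haar_energy Q Fadd; have eG := haar_energy Q Gadd.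
have am : haar_product Q <=
   (b / a * (haar_gap F Q ^+ 2 / len Q) + a / b * (haar_gap G Q ^+ 2 / len Q)) / 2.
  rewrite /haar_product -[haar_gap F Q ^+ 2]real_normK ?num_real//.
  rewrite -[haar_gap G Q ^+ 2]real_normK ?num_real//.
  move: (`|haar_gap F Q|) (`|haar_gap G Q|) => x y; have l0 := len0 Q.
  rewrite -subr_ge0.
  have -> : (b / a * (x ^+ 2 / len Q) + a / b * (y ^+ 2 / len Q)) / 2 - x * y / len Q =
    (b * x - a * y) ^+ 2 / (2 * a * b * len Q) by field; rewrite !gt_eqF.
  by rewrite divr_ge0 ?sqr_ge0// !mulr_ge0// ltW.
move: am; rewrite eF eG => am.
have l1 := dyadic_length_left R Q; have l2 := dyadic_length_right R Q.
have l3 : 64 * (a * b) * len Q =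
  64 * (a * b) * len (left_half Q) + 64 * (a * b) * len (right_half Q).
  by rewrite l1 l2; field.
rewrite l3; move: P15 P25 am.
rewrite !mulrDr !mulrN.
lra.
Qed.

(** A pair (I, E) is an interval with a major subset E.  That the sets E are
    disjoint is expressed apart, by a bound on the sum of their indicators. *)
Definition sparse_family (S : seq (dyadic * set R)) := forall q, q \in S ->
  [/\ measurable q.2, q.2 `<=` dset q.1 & ((len q.1)%:E <= 2%:E * mu q.2)%E].

(** This settles the case in which an average vanishes and the stopping thresholds
    would be 0. *)
Lemma haar_product_tree0 n Q : Fh Q * Gh Q = 0 ->
  \sum_(I <- tree n Q) haar_product I = 0.
Proof.
elim: n Q => [|n ih] Q FG0; first by rewrite big_nil.
have h H Hh : (forall I, `|H I| <= Hh I) -> additive_on_dyadics Hh ->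
    Hh Q = 0 -> [/\ haar_gap H Q = 0, Hh (left_half Q) = 0 & Hh (right_half Q) = 0].
  move=> HHh Hadd H0; have Hh0 I : 0 <= Hh I by exact: le_trans (HHh I).
  have [l r] := (Hh0 (left_half Q), Hh0 (right_half Q)); move: (Hadd Q); rewrite H0 => e.
  have [el er] : Hh (left_half Q) = 0 /\ Hh (right_half Q) = 0 by split; lra.
  by split=> //; apply/eqP; rewrite -normr_le0 -H0; exact: haar_gap_le.
rewrite big_cons big_cat/=.
move/eqP: FG0; rewrite mulf_eq0 => /orP[/eqP/(h _ _ FFh Fhadd)|/eqP/(h _ _ GGh Ghadd)] [e el er].
  by rewrite !ih ?el ?er ?mul0r// /haar_product e normr0 !mul0r !addr0.
by rewrite !ih ?el ?er ?mulr0// /haar_product e normr0 mulr0 mul0r !addr0.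
Qed.

(** Stopping at four times the averages of Q, the intervals stopped because of Fh
    have total length at most |Q| / 4, and so have those stopped because of Gh: at
    least half of Q is left over and serves as E.  Since Q is not stopped, the
    trees below the stopped intervals are lower and the construction recurs. *)
Lemma sparse_tree n Q : exists S : seq (dyadic * set R),
  [/\ sparse_family S,
      forall x, \sum_(q <- S) \1_(q.2) x <= \1_(dset Q) x :> R &
      \sum_(I <- tree n Q) haar_product I
        <= 64 * \sum_(q <- S) Fh q.1 * Gh q.1 / len q.1].
Proof.
have [m] := ubnP n; elim: m n Q => // m ihm n Q nm.
have [FG0|FG0] := eqVneq (Fh Q * Gh Q) 0.
  exists [::]; split => //; first by move=> x; rewrite big_nil indicE.
  by rewrite big_nil mulr0 haar_product_tree0.
have l0 := len0 Q.
have [Fp Gp] : 0 < Fh Q /\ 0 < Gh Q.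
  by move: FG0; rewrite mulf_eq0 negb_or !lt_def Fh0 Gh0 => /andP[-> ->].
pose a := Fh Q / len Q; pose b := Gh Q / len Q.
have a0 : 0 < a by rewrite divr_gt0.
have b0 : 0 < b by rewrite divr_gt0.
have aE : a * len Q = Fh Q by rewrite /a divfK// gt_eqF.
have bE : b * len Q = Gh Q by rewrite /b divfK// gt_eqF.
clearbody a b.
have nst : ~~ stopped a b Q.
  by rewrite /stopped negb_or -!leNgt -!mulrA aE bE; apply/andP; split; lra.
have [||P [P1 P2 P3 [P4 P4'] P5]] := @stopping_time a b n Q a0 b0.
- by rewrite -mulrA aE; lra.
- by rewrite -mulrA bE; lra.
have [S [S1 S2 S3]] : exists S : seq (dyadic * set R),
  [/\ sparse_family S,
      forall x, \sum_(q <- S) \1_(q.2) x <= \sum_(q <- P) \1_(dset q.2) x :> R &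
      \sum_(q <- P) \sum_(I <- tree q.1 q.2) haar_product I
        <= 64 * \sum_(q <- S) Fh q.1 * Gh q.1 / len q.1].
  have : forall q, q \in P -> (q.1 < m)%N.
    by move=> q /P1[_ /(_ nst) h]; apply: leq_trans h _; rewrite -ltnS.
  elim: (P) => [|[k J] P' ih] Pm.
    by exists [::]; split=> // [x|]; rewrite !big_nil// mulr0.
  have [S1 [S11 S12 S13]] := ihm k J (Pm (k, J) (mem_head _ _)).
  have [|S2 [S21 S22 S23]] := ih.
    by move=> q qP; apply: Pm; rewrite in_cons qP orbT.
  exists (S1 ++ S2); split.
  - by move=> q; rewrite mem_cat => /orP[/S11|/S21].
  - by move=> x; rewrite big_cat/= big_cons; exact: lerD.
  by rewrite big_cons big_cat/= mulrDr; exact: lerD.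
pose U := \big[setU/set0]_(q <- P) dset q.2.
have mU : measurable U.
  by apply: bigsetU_measurable => q _; exact: measurable_dyadic_set.
have UP x : U x <-> exists2 q, q \in P & dset q.2 x.
  rewrite /U; elim: (P) => [|q P' ih]; first by rewrite big_nil; split=> // -[].
  rewrite big_cons; split.
    case=> [h|/ih[r rP rx]]; first by exists q; rewrite ?mem_head.
    by exists r; rewrite // in_cons rP orbT.
  case=> r; rewrite in_cons => /orP[/eqP->|rP] rx; first by left.
  by right; apply/ih; exists r.
exists ((Q, dset Q `\` U) :: S); split.
- move=> q; rewrite in_cons => /orP[/eqP->/=|/S1//]; split.
  + by apply: measurableD => //; exact: measurable_dyadic_set.
  + exact: subDsetl.
  have mE : measurable (dset Q `\` U).
    by apply: measurableD => //; exact: measurable_dyadic_set.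
  have h1 : (mu (dset Q) <= mu (dset Q `\` U) + mu U)%E.
    apply: le_trans (measureU2 mu mE mU); apply: le_measure; rewrite ?inE.
    - exact: measurable_dyadic_set.
    - exact: measurableU.
    by move=> x Qx; have [Ux|Ux] := pselect (U x); [right|left].
  have h2 : (mu U <= (\sum_(q <- P) len q.2)%:E)%E.
    rewrite /U; elim: (P) => [|r P' ih]; first by rewrite !big_nil measure0.
    rewrite !big_cons EFinD; apply: le_trans (measureU2 _ _ _) _.
    - exact: measurable_dyadic_set.
    - by apply: bigsetU_measurable => r' _; exact: measurable_dyadic_set.
    by apply: leeD => //; rewrite -lebesgue_dyadic_set.
  have h3 : \sum_(q <- P) len q.2 <= len Q / 2.
    have h4 : \sum_(q <- P) len q.2 <= \sum_(q <- P) (Fh q.2 / (4 * a) + Gh q.2 / (4 * b)).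
      rewrite big_seq [leRHS]big_seq; apply: ler_sum => r /P2 /orP[] h.
        have h5 : len r.2 <= Fh r.2 / (4 * a).
          by rewrite ler_pdivlMr ?mulr_gt0// mulrC ltW.
        by apply: le_trans h5 _; rewrite lerDl divr_ge0// mulr_ge0// ltW.
      have h5 : len r.2 <= Gh r.2 / (4 * b).
        by rewrite ler_pdivlMr ?mulr_gt0// mulrC ltW.
      by apply: le_trans h5 _; rewrite lerDr divr_ge0// mulr_ge0// ltW.
    apply: le_trans h4 _; rewrite big_split/= -!mulr_suml.
    have -> : len Q / 2 = Fh Q / (4 * a) + Gh Q / (4 * b).
      by rewrite -aE -bE; field; rewrite !gt_eqF.
    by apply: lerD; rewrite ler_pM2r// invr_gt0 mulr_gt0.
  move: h1; rewrite lebesgue_dyadic_set => h1.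
  have h6 : ((len Q)%:E <= mu (dset Q `\` U) + (len Q / 2)%:E)%E.
    by apply: le_trans h1 _; rewrite leeD2l// (le_trans h2)// lee_fin.
  exact: le_double_of_half.
- move=> x; rewrite big_cons/= !indicE in_setD.
  have [Ux|nUx] := boolP (x \in U).
    rewrite andbF add0r; apply: le_trans (S2 x) _; apply: le_trans (P3 x) _.
    by rewrite indicE.
  rewrite andbT [X in _ + X](_ : _ = 0) ?addr0//.
  apply/eqP; rewrite eq_le sumr_ge0 ?andbT => [|q _]; last by rewrite indicE.
  apply: le_trans (S2 x) _; rewrite big_seq big1// => q qP.
  rewrite indicE; case: (boolP (x \in _)) => // /set_mem qx.
  by move/negP: nUx; case; apply/mem_set/UP; exists q.
rewrite big_cons/= mulrDr.
have -> : Fh Q * Gh Q / len Q = a * b * len Q by rewrite -aE -bE; field; rewrite gt_eqF.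
have : 0 <= (b / a * (F Q ^+ 2 / len Q) + a / b * (G Q ^+ 2 / len Q)) / 2.
  apply: divr_ge0 => //; apply: addr_ge0; apply: mulr_ge0;
    by rewrite divr_ge0 ?sqr_ge0// ltW.
move: P5 S3; rewrite !mulrA; lra.
Qed.

(** A finite family fits into a tree on each side of the origin, and the sparse
    families of these two trees live on disjoint sets. *)
Lemma sparse_domination (s : seq dyadic) : uniq s ->
  exists S : seq (dyadic * set R),
  [/\ sparse_family S,
      forall x, \sum_(q <- S) \1_(q.2) x <= 1 :> R &
      \sum_(I <- s) haar_product I
        <= 64 * \sum_(q <- S) Fh q.1 * Gh q.1 / len q.1].
Proof.
move=> us; have [k [n sT]] := finite_sub_two_trees s.
have [S1 [S11 S12 S13]] := sparse_tree n (k, 0).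
have [S2 [S21 S22 S23]] := sparse_tree n (k, -1).
exists (S1 ++ S2); split.
- by move=> q; rewrite mem_cat => /orP[/S11|/S21].
- move=> x; rewrite big_cat/=; apply: le_trans (lerD (S12 x) (S22 x)) _.
  rewrite !indicE; case: (boolP (x \in _)) => [/set_mem h1|_].
    case: (boolP (x \in _)) => [/set_mem h2|_]; last by rewrite addr0.
    by have := dyadic_same_length (erefl : (k, 0).1 = (k, -1 : int).1) h1 h2.
  by rewrite add0r; case: (x \in _).
rewrite big_cat mulrDr/=; apply: le_trans (lerD S13 S23).
rewrite -big_cat/=; have hp I : 0 <= haar_product I.
  by rewrite /haar_product divr_ge0// ?mulr_ge0// dyadic_length_ge0.
exact: sum_uniq_sub_le.
Qed.

End SparseDomination.

(** * Integrals of non-negative functions and a Carleson embedding *)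

Section NonnegIntegral.
Variable R : realType.
Local Notation mu := (@lebesgue_measure R).

(** Intended for h >= 0, where the integral is always defined in [0, +oo]. *)
Definition nnint (h : R -> R) : \bar R := (\int[mu]_x (h x)%:E)%E.

Definition nnint_on (E : set R) (h : R -> R) : \bar R :=
  nnint (fun x => \1_E x * h x).

Implicit Types h k : R -> R.

Lemma ae_imp (P Q : R -> Prop) : (forall x, P x -> Q x) ->
  {ae mu, forall x, P x} -> {ae mu, forall x, Q x}.
Proof.
by move=> PQ; apply: negligibleS => x; apply: contra_not => /PQ.
Qed.

Lemma ae_and (P Q : R -> Prop) : {ae mu, forall x, P x} -> {ae mu, forall x, Q x} ->
  {ae mu, forall x, P x /\ Q x}.
Proof.
move=> hP hQ; have := negligibleU hP hQ; apply: negligibleS => x.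
by move=> nPQ; have [p|] := pselect (P x); [right => q; apply: nPQ|left].
Qed.

Lemma measurable_EFinT h : measurable_fun setT h ->
  measurable_fun setT (EFin \o h).
Proof. by move=> mh; exact/measurable_EFinP. Qed.

Lemma nnint_ge0 h : (forall x, 0 <= h x) -> (0 <= nnint h)%E.
Proof. by move=> h0; apply: integral_ge0 => x _; rewrite lee_fin. Qed.

Lemma eq_nnint h k : h =1 k -> nnint h = nnint k.
Proof. by move=> hk; apply: eq_integral => x _; rewrite hk. Qed.

Lemma le_nnint h k : measurable_fun setT h -> measurable_fun setT k ->
  (forall x, 0 <= h x) -> (forall x, h x <= k x) -> (nnint h <= nnint k)%E.
Proof.
move=> mh mk h0 hk; apply: ge0_le_integral => //.
- by move=> x _; rewrite lee_fin.
- exact: measurable_EFinT.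
- exact: measurable_EFinT.
- by move=> x _; rewrite lee_fin.
Qed.

Lemma nnintD h k : measurable_fun setT h -> measurable_fun setT k ->
  (forall x, 0 <= h x) -> (forall x, 0 <= k x) ->
  nnint (fun x => h x + k x) = (nnint h + nnint k)%E.
Proof.
move=> mh mk h0 k0; rewrite /nnint.
under eq_integral do rewrite EFinD.
apply: ge0_integralD => //.
- by move=> x _; rewrite lee_fin.
- exact: measurable_EFinT.
- by move=> x _; rewrite lee_fin.
- exact: measurable_EFinT.
Qed.

Lemma nnintZ (c : R) h : measurable_fun setT h -> (forall x, 0 <= h x) -> 0 <= c ->
  nnint (fun x => c * h x) = (c%:E * nnint h)%E.
Proof.
move=> mh h0 c0; rewrite /nnint; under eq_integral do rewrite EFinM.
apply: ge0_integralZl_EFin => //.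
- by move=> x _; rewrite lee_fin.
- exact: measurable_EFinT.
Qed.

Lemma nnint_sum (T : Type) (s : seq T) (h : T -> R -> R) :
  (forall i, measurable_fun setT (h i)) -> (forall i x, 0 <= h i x) ->
  nnint (fun x => \sum_(i <- s) h i x) = (\sum_(i <- s) nnint (h i))%E.
Proof.
move=> mh h0; rewrite /nnint.
under eq_integral do rewrite -sumEFin.
apply: ge0_integral_sum => // [i|i x _]; last by rewrite lee_fin.
exact: measurable_EFinT.
Qed.

Lemma nnint_restrict E h : measurable E ->
  (\int[mu]_(x in E) (h x)%:E = nnint_on E h)%E.
Proof.
move=> mE; rewrite integral_mkcond; apply: eq_integral => x _.
by rewrite patchE indicE; case: (x \in E); rewrite ?mul1r ?mul0r.
Qed.

Lemma measurable_indicM E h : measurable E -> measurable_fun setT h ->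
  measurable_fun setT (fun x => \1_E x * h x).
Proof.
by move=> mE mh; apply: measurable_funM => //; exact: measurable_indic.
Qed.

Lemma indicM_ge0 (E : set R) (x y : R) : 0 <= y -> 0 <= \1_E x * y.
Proof. by move=> h0; rewrite mulr_ge0// indicE. Qed.

Lemma nnint_indic_le (E F : set R) h : measurable E -> measurable F ->
  measurable_fun setT h -> (forall x, 0 <= h x) -> E `<=` F ->
  (nnint_on E h <= nnint_on F h)%E.
Proof.
move=> mE mF mh h0 EF; apply: le_nnint; try exact: measurable_indicM.
  by move=> x; apply: indicM_ge0.
move=> x; rewrite ler_wpM2r// !indicE.
by case: (boolP (x \in E)) => // /set_mem/EF/mem_set ->.
Qed.

Lemma nnint_indic E : measurable E -> nnint_on E (cst 1) = mu E.
Proof.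
by move=> mE; rewrite -nnint_restrict// (integral_cst mu mE 1%E) mul1e.
Qed.

Lemma nnint_eq0 h : measurable_fun setT h -> (forall x, 0 <= h x) ->
  nnint h = 0%E -> {ae mu, forall x, h x = 0}.
Proof.
move=> mh h0 ih.
have := (ae_eq_integral_abs mu measurableT (measurable_EFinT mh)).1.
under eq_integral do rewrite gee0_abs ?lee_fin//.
move=> /(_ ih); apply: filterS => x /(_ I) []; exact.
Qed.

Lemma ae_eq_nnint h k : measurable_fun setT h -> measurable_fun setT k ->
  {ae mu, forall x, h x = k x} -> nnint h = nnint k.
Proof.
move=> mh mk hk; apply: ae_eq_integral => //; try exact: measurable_EFinT.
by apply: ae_imp hk => x -> _.
Qed.

End NonnegIntegral.

Section MaximalTheorem.
Variable R : realType.
Local Notation dset := (@dyadic_set R).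

(** For i from 0 to 2 m these are the powers of 2 from 2^-m to 2^m: any finite set
    of positive numbers lies within such a window. *)
Definition level (m i : nat) : R := 2 ^ (i%:Z - m%:Z).

Lemma level_gt0 m i : 0 < level m i. Proof. by rewrite exprz_gt0. Qed.

Lemma levelS m i : level m i.+1 = 2 * level m i.
Proof.
rewrite /level; have -> : i.+1%:Z - m%:Z = 1 + (i%:Z - m%:Z) by lia.
by rewrite expfzDr.
Qed.

Lemma crossing_index (T : realDomainType) (f : nat -> T) (n : nat) N :
  f 0%N < N -> N <= f n -> exists2 i, (i < n)%N & f i < N <= f i.+1.
Proof.
elim: n => [|n ih] h0 hn; first by have := lt_le_trans h0 hn; rewrite ltxx.
have [h|h] := leP N (f n).
  by have [i ni Hi] := ih h0 h; exists i => //; exact: ltnW.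
by exists n => //; rewrite h hn.
Qed.

Lemma exists_level_range (T : eqType) (s : seq T) (N : T -> R) :
  (forall i, 0 <= N i) ->
  exists m, forall i, i \in s -> N i = 0 \/ level m 0 < N i <= level m m.*2.
Proof.
move=> N0.
have lev0 m : level m 0 = (2 ^+ m)^-1 by rewrite /level sub0r -exprnN.
have lev1 m : level m m.*2 = 2 ^+ m.
  by rewrite /level; have -> : m.*2%:Z - m%:Z = m%:Z by lia.
suff [m hm] : exists m : nat, forall i, i \in s -> N i <= 2 ^+ m /\
    (N i = 0 \/ (N i)^-1 < 2 ^+ m).
  exists m => i /hm[h [->|h']]; [by left|].
  have [->|Ni0] := eqVneq (N i) 0; [by left|right].
  rewrite lev0 lev1 h andbT invf_plt// posrE ?exprn_gt0//.
  by rewrite lt_def Ni0 N0.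
elim: s => [|a s [m hm]]; first by exists 0%N.
have [k hk] : exists k : nat, N a + (N a)^-1 < 2 ^+ k.
  (* one exponent controls both N a and its inverse *)
  exists (Num.trunc (N a + (N a)^-1)).+1.
  apply: lt_le_trans (truncnS_gt _) _.
  by rewrite -natrX ler_nat ltnW// ltn_expl.
have ik : 0 <= (N a)^-1 by rewrite invr_ge0.
have le2 i j : (i <= j)%N -> (2 : R) ^+ i <= 2 ^+ j by move=> ij; rewrite ler_eXn2l// ltr1n.
exists (maxn k m) => i; rewrite in_cons => /orP[/eqP->|/hm[h1 h2]].
  split; [|right].
    by apply: le_trans (le2 _ _ (leq_maxl _ _)); have := N0 a; lra.
  by apply: lt_le_trans (le2 _ _ (leq_maxl _ _)); have := N0 a; lra.
split; first exact: le_trans (le2 _ _ (leq_maxr _ _)).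
case: h2 => [->|h2]; [by left|right].
exact: lt_le_trans (le2 _ _ (leq_maxr _ _)).
Qed.

Variables (s phi : R -> R) (Psi : R -> R) (p D : R).
Hypotheses (p0 : 0 < p) (ms : measurable_fun setT s) (s0 : forall x, 0 <= s x).
Hypotheses (mphi : measurable_fun setT phi) (phi0 : forall x, 0 <= phi x).
Hypotheses (mPsi : measurable_fun setT Psi) (Psi0 : forall x, 0 <= Psi x).
Hypothesis PsiD : forall m x, 0 <= x ->
  \sum_(i <- iota 0 m.*2) level m i `^ p * Psi (2 * x / level m i) <= D * x `^ p.

Let mPsiphi l : measurable_fun setT (fun x => Psi (2 * phi x / l) * s x).
Proof.
apply: measurable_funM => //; apply: measurableT_comp => //.
by apply: measurable_funM => //; exact: measurable_funM.
Qed.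

Let mphis : measurable_fun setT (fun x => phi x `^ p * s x).
Proof.
by apply: measurable_funM => //; exact: (measurableT_comp (measurable_powR _)).
Qed.

(** Pass to the maximal intervals: they are disjoint, contain all the sets E, and
    each of them satisfies the hypothesis on the mass of s. *)
Lemma level_set_bound (S : seq (dyadic * set R)) (l : R) :
  (forall q, q \in S -> measurable q.2 /\ q.2 `<=` dset q.1) ->
  (forall x, \sum_(q <- S) \1_(q.2) x <= 1 :> R) ->
  (forall q, q \in S -> (nnint_on (dset q.1) s
     <= nnint_on (dset q.1) (fun x => Psi (2 * phi x / l) * s x)%R)%E) ->
  (\sum_(q <- S) nnint_on q.2 s
    <= nnint (fun x => Psi (2 * phi x / l) * s x)%R)%E.
Proof.
move=> S1 S2 S3.
have [M ML [M1 M2]] := maximal_subfamily R (map fst S).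
pose E' (q : dyadic * set R) := if q \in S then q.2 else set0.
have mE' q : measurable (E' q) by rewrite /E'; case: ifP => // /S1[].
have -> : (\sum_(q <- S) nnint_on q.2 s =
    nnint (fun x => \sum_(q <- S) \1_(E' q) x * s x)%R)%E.
  rewrite nnint_sum.
  - by rewrite big_seq [RHS]big_seq; apply: eq_bigr => q qS; rewrite /E' qS.
  - by move=> q; exact: measurable_indicM.
  - by move=> q x; by apply: indicM_ge0.
have mM (h : R -> R) : measurable_fun setT h ->
    measurable_fun setT (fun x => \sum_(J <- M) \1_(dset J) x * h x).
  move=> mh; apply: measurable_sum => J; apply: measurable_indicM => //.
  exact: measurable_dyadic_set.
have Ms : nnint (fun x => \sum_(J <- M) \1_(dset J) x * s x)%R =
    (\sum_(J <- M) nnint_on (dset J) s)%E.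
  rewrite nnint_sum// => [J|J x]; last by apply: indicM_ge0.
  by apply: measurable_indicM => //; exact: measurable_dyadic_set.
apply: (@le_trans _ _ (nnint (fun x => \sum_(J <- M) \1_(dset J) x * s x)%R)).
  apply: le_nnint; last move=> x.
  - by apply: measurable_sum => q; exact: measurable_indicM.
  - exact: mM.
  - by move=> x; apply: sumr_ge0 => q _; by apply: indicM_ge0.
  rewrite -!mulr_suml; apply: ler_wpM2r => //.
  have -> : \sum_(q <- S) \1_(E' q) x = \sum_(q <- S) \1_(q.2) x :> R.
    by rewrite big_seq [RHS]big_seq; apply: eq_bigr => q qS; rewrite /E' qS.
  have [h|h] := leP (\sum_(q <- S) \1_(q.2) x) (0 : R).
    by apply: le_trans h _; apply: sumr_ge0 => J _; rewrite indicE.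
  have [q qS qx] := sum_indic_gt0 h.
  apply: le_trans (S2 x) _; apply: (M2 q.1); first exact: map_f.
  by have [_] := S1 q qS; exact.
rewrite Ms; apply: (@le_trans _ _ (\sum_(J <- M) nnint_on (dset J) (fun x => Psi (2 * phi x / l) * s x)%R)%E).
  rewrite big_seq [leRHS]big_seq; apply: lee_sum => J /ML /mapP[q qS ->].
  exact: S3.
rewrite -nnint_sum => [|J|J x].
- apply: le_nnint => // [||x]; first exact: mM.
    by move=> x; apply: sumr_ge0 => J _; apply: indicM_ge0 ;exact: mulr_ge0.
  by rewrite -mulr_suml ler_piMl// mulr_ge0.
- by apply: measurable_indicM => //; exact: measurable_dyadic_set.
- by apply: indicM_ge0 ;exact: mulr_ge0.
Qed.

(** A positive N lies between two consecutive levels, so N^p is at most 2^p times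
    the p-th power of the last level below it.  At a fixed level the hypothesis
    on N holds for all intervals where N is larger, and [level_set_bound] applies;
    the hypothesis on Psi adds up the levels. *)
Lemma maximal_theorem (S : seq (dyadic * set R)) (N : dyadic -> R) :
  (forall q, q \in S -> measurable q.2 /\ q.2 `<=` dset q.1) ->
  (forall x, \sum_(q <- S) \1_(q.2) x <= 1 :> R) ->
  (forall I, 0 <= N I) ->
  (forall q l, q \in S -> 0 < l -> l < N q.1 ->
    (nnint_on (dset q.1) s
     <= nnint_on (dset q.1) (fun x => Psi (2 * phi x / l) * s x)%R)%E) ->
  (\sum_(q <- S) (N q.1 `^ p)%:E * nnint_on q.2 s
    <= (2 `^ p * D)%:E * nnint (fun x => phi x `^ p * s x)%R)%E.
Proof.
move=> S1 S2 N0 S3.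
have [m hm] := exists_level_range S (fun q => N0 q.1).
have D0 : 0 <= D.
  have := @PsiD 0 1 ler01; rewrite big_nil powR1 mulr1//.
pose c i := (2 `^ p * level m i `^ p : R).
have c0 i : 0 <= c i by rewrite mulr_ge0// powR_ge0.
pose Y : \bar R := (\sum_(i <- iota 0 m.*2) (c i)%:E *
    \sum_(q <- S | (level m i < N q.1)%R) nnint_on q.2 s)%E.
apply: (@le_trans _ _ Y).
  have -> : Y = (\sum_(q <- S) \sum_(i <- iota 0 m.*2)
      if (level m i < N q.1)%R then (c i)%:E * nnint_on q.2 s else 0)%E.
    rewrite exchange_big; apply: eq_bigr => i _.
    rewrite ge0_sume_distrr => [|q _]; last by apply: nnint_ge0 => x; by apply: indicM_ge0.
    by rewrite big_mkcond.
  rewrite big_seq [leRHS]big_seq; apply: lee_sum => q qS.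
  have pos : (0 <= nnint_on q.2 s)%E.
    by apply: nnint_ge0 => x; by apply: indicM_ge0.
  have pos' i : (0 <= if (level m i < N q.1)%R then
     (c i)%:E * nnint_on q.2 s else 0)%E.
    by case: ifP => // _; apply: mule_ge0; rewrite ?lee_fin.
  have [Nq0|/andP[h1 h2]] := hm q qS.
    by rewrite [X in X `^ p]Nq0 powR0 ?gt_eqF// mul0e; apply: sume_ge0 => i _.
  have [i im /andP[h3 h4]] := crossing_index h1 h2.
  rewrite (big_rem i)/= ?mem_iota// h3.
  apply: (@le_trans _ _ ((c i)%:E * nnint_on q.2 s))%E.
    rewrite lee_wpmul2r// lee_fin /c -powRM ?(ltW (level_gt0 _ _))//.
    rewrite -levelS ge0_ler_powR ?nnegrE ?(ltW p0)//; exact/ltW/level_gt0.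
  by rewrite leeDl//; apply: sume_ge0.
apply: (@le_trans _ _ (\sum_(i <- iota 0 m.*2) (c i)%:E *
    nnint (fun x => Psi (2 * phi x / level m i) * s x)%R)%E).
  apply: lee_sum => i _; apply: lee_wpmul2l; first by rewrite lee_fin.
  rewrite -big_filter; apply: level_set_bound.
  - by move=> q; rewrite mem_filter => /andP[_ /S1].
  - move=> x; apply: le_trans (S2 x); rewrite big_filter [leLHS]big_mkcond.
    by apply: ler_sum => q _; case: ifP.
  move=> q; rewrite mem_filter => /andP[h qS]; apply: S3 => //; exact: level_gt0.
have -> : (\sum_(i <- iota 0 m.*2) (c i)%:E *
    nnint (fun x => Psi (2 * phi x / level m i) * s x)%R =
    nnint (fun x => \sum_(i <- iota 0 m.*2) c i * (Psi (2 * phi x / level m i) * s x))%R)%E.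
  rewrite nnint_sum => [|i|i x].
  - by apply: eq_bigr => i _; rewrite nnintZ// => x; exact: mulr_ge0.
  - exact: measurable_funM.
  - by apply: mulr_ge0 => //; exact: mulr_ge0.
rewrite -nnintZ//; last 2 first.
- by move=> x; rewrite mulr_ge0// powR_ge0.
- by rewrite mulr_ge0// powR_ge0.
apply: le_nnint.
- by apply: measurable_sum => i; exact: measurable_funM.
- exact: measurable_funM.
- by move=> x; apply: sumr_ge0 => i _; rewrite mulr_ge0// mulr_ge0.
move=> x; rewrite mulrA -!mulrA mulrCA.
rewrite [leRHS]mulrCA.
have := ler_wpM2r (s0 x) (ler_wpM2l (powR_ge0 2 p) (PsiD m (phi0 x))).
rewrite !mulrA mulr_sumr mulr_suml; apply: le_trans.
by apply: ler_sum => i _; rewrite /c !mulrA.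
Qed.

End MaximalTheorem.

(** * Haar coefficients of locally integrable functions *)

Section AbsIntegrable.
Variable R : realType.
Local Notation mu := (@lebesgue_measure R).
Implicit Types h k : R -> R.

Definition abs_integrable h :=
  measurable_fun setT h /\ (nnint (fun x => `|h x|)%R < +oo)%E.

Lemma abs_integrableP h : abs_integrable h <-> mu.-integrable setT (EFin \o h).
Proof.
split=> [[mh hi]|/integrableP[mh hi]].
  by apply/integrableP; split=> //; exact: measurable_EFinT.
by split=> //; exact/measurable_EFinP.
Qed.

Lemma abs_integrableD h k : abs_integrable h -> abs_integrable k ->
  abs_integrable (fun x => h x + k x).
Proof.
move=> /abs_integrableP hi /abs_integrableP ki; apply/abs_integrableP.
exact: (integrableD measurableT hi ki).
Qed.

Lemma abs_integrableZ (c : R) h : abs_integrable h -> abs_integrable (fun x => c * h x).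
Proof. by move=> /abs_integrableP hi; apply/abs_integrableP; exact: (integrableZl measurableT c hi). Qed.

Lemma abs_integrable0 : abs_integrable (cst 0).
Proof. by apply/abs_integrableP; exact: integrable0. Qed.

Lemma abs_integrable_sum (T : Type) (s : seq T) (h : T -> R -> R) :
  (forall i, abs_integrable (h i)) -> abs_integrable (fun x => \sum_(i <- s) h i x).
Proof.
move=> hi; elim: s => [|i s ih].
  by under eq_fun do rewrite big_nil; exact: abs_integrable0.
by under eq_fun do rewrite big_cons; exact: abs_integrableD.
Qed.

Lemma integral_lin h k (a b : R) : abs_integrable h -> abs_integrable k ->
  (\int[mu]_x (a * h x + b * k x) = a * \int[mu]_x h x + b * \int[mu]_x k x)%R.
Proof.
move=> hi ki; rewrite RintegralD//; try exact/abs_integrableP/abs_integrableZ.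
by rewrite !RintegralZl//; exact/abs_integrableP.
Qed.

Lemma integral_lincomb (T : Type) (s : seq T) (a : T -> R) (h : T -> R -> R) :
  (forall i, abs_integrable (h i)) ->
  (\int[mu]_x (\sum_(i <- s) a i * h i x) = \sum_(i <- s) a i * \int[mu]_x h i x)%R.
Proof.
move=> hi; elim: s => [|i s ih].
  rewrite big_nil; under eq_Rintegral do rewrite big_nil.
  by rewrite Rintegral_cst// mul0r.
under eq_Rintegral do rewrite big_cons; rewrite big_cons -ih.
rewrite RintegralD//; last 2 first.
- exact/abs_integrableP/abs_integrableZ.
- by apply/abs_integrableP/abs_integrable_sum => j; exact: abs_integrableZ.
by rewrite RintegralZl//; exact/abs_integrableP.
Qed.

Lemma abs_integral_le h : abs_integrable h ->
  `|\int[mu]_x h x| <= fine (nnint (fun x => `|h x|)%R).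
Proof.
by move=> hi; apply: le_trans (le_normr_Rintegral _ _) _ => //; exact/abs_integrableP.
Qed.

Lemma nnint_fin h : (forall x, 0 <= h x) -> (nnint h < +oo)%E ->
  (fine (nnint h))%:E = nnint h.
Proof.
by move=> h0 hi; rewrite fineK// ge0_fin_numE// nnint_ge0.
Qed.

End AbsIntegrable.

Section NnintOn.
Variable R : realType.
Implicit Types (E : set R) (h k : R -> R).

Lemma nnint_on_ge0 E h : (forall x, 0 <= h x) -> (0 <= nnint_on E h)%E.
Proof. by move=> h0; apply: nnint_ge0 => x; apply: indicM_ge0. Qed.

Lemma le_nnint_on E h k : measurable E -> measurable_fun setT h ->
  measurable_fun setT k -> (forall x, 0 <= h x) -> (forall x, h x <= k x) ->
  (nnint_on E h <= nnint_on E k)%E.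
Proof.
move=> mE mh mk h0 hk; apply: le_nnint => [|||x]; try exact: measurable_indicM.
  by move=> x; apply: indicM_ge0.
by rewrite ler_wpM2l// indicE.
Qed.

Lemma nnint_onZ E (c : R) h : measurable E -> measurable_fun setT h ->
  (forall x, 0 <= h x) -> 0 <= c ->
  nnint_on E (fun x => c * h x) = (c%:E * nnint_on E h)%E.
Proof.
move=> mE mh h0 c0; rewrite -nnintZ//; last 2 first.
- exact: measurable_indicM.
- by move=> x; apply: indicM_ge0.
by apply: eq_nnint => x; rewrite mulrCA.
Qed.

Lemma nnint_onD E h k : measurable E -> measurable_fun setT h ->
  measurable_fun setT k -> (forall x, 0 <= h x) -> (forall x, 0 <= k x) ->
  nnint_on E (fun x => h x + k x) = (nnint_on E h + nnint_on E k)%E.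
Proof.
move=> mE mh mk h0 k0; rewrite -nnintD//; try exact: measurable_indicM;
  try by move=> x; apply: indicM_ge0.
by apply: eq_nnint => x; rewrite mulrDr.
Qed.

Lemma le_nnint_on_nnint E h : measurable E -> measurable_fun setT h ->
  (forall x, 0 <= h x) -> (nnint_on E h <= nnint h)%E.
Proof.
move=> mE mh h0; apply: le_nnint => [|||x] //; first exact: measurable_indicM.
  by move=> x; apply: indicM_ge0.
by rewrite ler_piMl// indicE lern1 leq_b1.
Qed.

Lemma measurable_norm h : measurable_fun setT h -> measurable_fun setT (fun x => `|h x|).
Proof. by move=> mh; exact: measurableT_comp. Qed.

Lemma measurable_pow h (r : R) : measurable_fun setT h ->
  measurable_fun setT (fun x => h x `^ r).
Proof. by move=> mh; apply: (measurableT_comp (measurable_powR _)). Qed.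

Lemma lte_mul_fin (c : R) (z : \bar R) : (0 <= z -> z < +oo -> c%:E * z < +oo)%E.
Proof. by case: z => //= r _ _; rewrite -EFinM ltry. Qed.

End NnintOn.

Section HaarPairing.
Variable R : realType.
Local Notation mu := (@lebesgue_measure R).
Local Notation len := (@dyadic_length R).
Local Notation dset := (@dyadic_set R).

Definition dyadic_integrable (f : R -> R) := measurable_fun setT f /\
  forall I, (nnint_on (dset I) (fun x => `|f x|)%R < +oo)%E.

Definition cell_integral (f : R -> R) I : R := \int[mu]_x (\1_(dset I) x * f x).

Definition cell_mass (f : R -> R) I : R := fine (nnint_on (dset I) (fun x => `|f x|)%R).

Lemma cell_abs_integrable f I : dyadic_integrable f ->
  abs_integrable (fun x => \1_(dset I) x * f x).
Proof.
move=> [mf fi]; split.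
  by apply: measurable_indicM => //; exact: measurable_dyadic_set.
apply: le_lt_trans (fi I); apply: le_of_eq.
by apply: eq_nnint => x; rewrite normrM (@ger0_norm _ (\1_ _ _))// indicE.
Qed.

Lemma cell_massE f I : dyadic_integrable f ->
  (cell_mass f I)%:E = nnint_on (dset I) (fun x => `|f x|)%R.
Proof.
by move=> [mf fi]; rewrite nnint_fin ?fi// => x; exact: indicM_ge0.
Qed.

Lemma dyadic_integrable_le (h k : R -> R) (c : R) : 0 <= c ->
  measurable_fun setT h -> (forall x, `|h x| <= c * `|k x|) ->
  dyadic_integrable k -> dyadic_integrable h.
Proof.
move=> c0 mh hk [mk ki]; split=> // I.
have md := @measurable_dyadic_set R I.
apply: (@le_lt_trans _ _ (nnint_on (dset I) (fun x => c * `|k x|)%R)).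
  apply: le_nnint_on => //; first exact: measurable_norm.
  by apply: measurable_funM => //; exact: measurable_norm.
rewrite nnint_onZ//; last exact: measurable_norm.
by apply: lte_mul_fin => //; exact: nnint_on_ge0.
Qed.

Lemma cell_mass_le (h k : R -> R) I : dyadic_integrable h -> dyadic_integrable k ->
  (forall x, `|h x| <= `|k x|) -> cell_mass h I <= cell_mass k I.
Proof.
move=> hi ki hk; rewrite -lee_fin !cell_massE//.
case: hi ki => mh _ [mk _]; apply: le_nnint_on => //; try exact: measurable_norm.
exact: measurable_dyadic_set.
Qed.

Lemma cell_integral_additive f : dyadic_integrable f ->
  additive_on_dyadics (cell_integral f).
Proof.
move=> fi I; rewrite /cell_integral.
under eq_Rintegral do rewrite (indic_halves I) mulrDl.
by rewrite RintegralD//; exact/abs_integrableP/cell_abs_integrable.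
Qed.

Lemma cell_mass_additive f : dyadic_integrable f ->
  additive_on_dyadics (cell_mass f).
Proof.
move=> fi I; apply: EFin_inj; rewrite EFinD !cell_massE// /nnint_on.
have m J : measurable_fun setT (fun x => \1_(dset J) x * `|f x|).
  apply: measurable_indicM; first exact: measurable_dyadic_set.
  by case: fi => mf _; exact: measurableT_comp.
rewrite -nnintD//; try by move=> x; apply: indicM_ge0.
by apply: eq_nnint => x; rewrite (indic_halves I) mulrDl.
Qed.

Lemma cell_integral_le_mass f I : dyadic_integrable f ->
  `|cell_integral f I| <= cell_mass f I.
Proof.
move=> fi; apply: le_trans (abs_integral_le (cell_abs_integrable I fi)) _.
apply: le_of_eq; congr fine.
by apply: eq_nnint => x; rewrite normrM (@ger0_norm _ (\1_ _ _))// indicE.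
Qed.

Lemma measurable_haar I : measurable_fun setT (@haar R I).
Proof.
apply: measurable_funM => //; apply: measurable_funB;
  apply: measurable_indic; exact: measurable_dyadic_set.
Qed.

Lemma mul_haarE f I x : f x * haar I x =
  (Num.sqrt (len I))^-1 * (\1_(dset (left_half I)) x * f x) +
  (- (Num.sqrt (len I))^-1) * (\1_(dset (right_half I)) x * f x).
Proof. by rewrite /haar; ring. Qed.

Lemma mul_haar_integrable f I : dyadic_integrable f ->
  abs_integrable (fun x => f x * haar I x).
Proof.
move=> fi; under eq_fun do rewrite mul_haarE.
by apply: abs_integrableD; apply: abs_integrableZ; exact: cell_abs_integrable.
Qed.

Lemma inner_haar f I : dyadic_integrable f ->
  inner f (haar I) = (Num.sqrt (len I))^-1 * haar_gap (cell_integral f) I.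
Proof.
move=> fi; rewrite /inner /haar_gap mulrBr.
under eq_Rintegral do rewrite mul_haarE.
by rewrite integral_lin ?mulNr//; exact: cell_abs_integrable.
Qed.

Lemma inner_haar_sqr f I : dyadic_integrable f ->
  inner f (haar I) ^+ 2 = haar_gap (cell_integral f) I ^+ 2 / len I.
Proof.
move=> /inner_haar->; rewrite exprMn exprVn sqr_sqrtr; last exact: dyadic_length_ge0.
by rewrite mulrC.
Qed.

Lemma inner_haar_mul f g I : dyadic_integrable f -> dyadic_integrable g ->
  `|inner f (haar I)| * `|inner g (haar I)| =
  haar_product (cell_integral f) (cell_integral g) I.
Proof.
move=> fi gi; rewrite !inner_haar// /haar_product !normrM.
have -> : len I = Num.sqrt (len I) ^+ 2 by rewrite sqr_sqrtr//; exact: dyadic_length_ge0.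
have s0 : Num.sqrt (len I) != 0 by rewrite gt_eqF// sqrtr_gt0 dyadic_length_gt0.
rewrite ger0_norm ?invr_ge0 ?sqrtr_ge0//.
rewrite [Num.sqrt (_ ^+ 2)](_ : _ = Num.sqrt (len I)).
  by move: (Num.sqrt _) s0 => s s0; field.
by rewrite sqr_sqrtr//; exact: dyadic_length_ge0.
Qed.

Lemma abs_haar_le I x : `|haar I x| <= (Num.sqrt (len I))^-1 * \1_(dset I) x :> R.
Proof.
rewrite /haar normrM (indic_halves I) ger0_norm ?invr_ge0 ?sqrtr_ge0//.
rewrite ler_wpM2l ?invr_ge0 ?sqrtr_ge0//; apply: le_trans (ler_normB _ _) _.
by rewrite !ger0_norm ?indicE.
Qed.

Variables (alpha : dyadic -> R) (F : {fset (int * int)}).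

Lemma measurable_haar_partial_sum f :
  measurable_fun setT (haar_partial_sum alpha F f).
Proof.
by apply: measurable_sum => I; apply: measurable_funM => //; exact: measurable_haar.
Qed.

(** A bounded majorant of the finite sums that vanishes off a bounded set, so that
    their powers can be integrated against any weight. *)
Definition haar_sum_majorant f x : R :=
  \sum_(I <- F) `|alpha I * inner f (haar I)| * (Num.sqrt (len I))^-1 * \1_(dset I) x.

Lemma abs_haar_partial_sum_le f x :
  `|haar_partial_sum alpha F f x| <= haar_sum_majorant f x.
Proof.
apply: le_trans (ler_norm_sum _ _ _) _; apply: ler_sum => I _.
by rewrite normrM -mulrA ler_wpM2l// abs_haar_le.
Qed.

Lemma haar_sum_majorant_bounded f : exists2 M, 0 <= M &
  forall x, haar_sum_majorant f x <= M.
Proof.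
exists (\sum_(I <- F) `|alpha I * inner f (haar I)| * (Num.sqrt (len I))^-1).
  by apply: sumr_ge0 => I _; rewrite mulr_ge0// invr_ge0 sqrtr_ge0.
move=> x; apply: ler_sum => I _; rewrite ler_piMr// ?indicE ?lern1 ?leq_b1//.
Qed.

(** The integral of |g|^p u is the pairing of g with sgn(g) |g|^(p-1) u, that is, a
    finite sum of products of Haar coefficients; [sparse_domination] bounds it.
    Its finiteness comes from the majorant and allows a later absorption. *)
Lemma pairing_bound (L p : R) (f u : R -> R) : 1 < p ->
  (forall I, `|alpha I| <= L) -> dyadic_integrable f ->
  (forall x, 0 <= u x) -> dyadic_integrable u ->
  let g := haar_partial_sum alpha F f in
  let gam x := `|g x| `^ (p - 1) in
  [/\ (nnint (fun x => `|g x| `^ p * u x)%R < +oo)%E,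
      dyadic_integrable (fun x => gam x * u x) &
  exists S : seq (dyadic * set R),
  [/\ sparse_family S, forall x, \sum_(q <- S) \1_(q.2) x <= 1 :> R &
  fine (nnint (fun x => `|g x| `^ p * u x)%R) <= L * (64 * \sum_(q <- S)
    cell_mass f q.1 * cell_mass (fun x => gam x * u x) q.1 / len q.1)]].
Proof.
move=> p1 aL fi u0 ui g gam.
have p10 : 0 < p - 1 by rewrite subr_gt0.
have p0 : 0 < p by exact: lt_trans p1.
have mg : measurable_fun setT g by exact: measurable_haar_partial_sum.
have mgam : measurable_fun setT gam.
  apply: (measurableT_comp (measurable_powR _)) => //; exact: measurableT_comp.
have mu_ : measurable_fun setT u by case: ui.
have [M M0 gM] := haar_sum_majorant_bounded f.
have gamM x : gam x <= M `^ (p - 1).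
  rewrite ge0_ler_powR ?nnegrE ?(ltW p10)//.
  by apply: le_trans (gM x); exact: abs_haar_partial_sum_le.
have gam0 x : 0 <= gam x by exact: powR_ge0.
have gamE x : `|g x| `^ p = `|g x| * gam x.
  by rewrite mulr_powRB1.
have gui : dyadic_integrable (fun x => gam x * u x).
  apply: (dyadic_integrable_le (c := M `^ (p - 1)) (k := u)) => //.
  - exact: powR_ge0.
  - exact: measurable_funM.
  by move=> x; rewrite normrM (ger0_norm (gam0 x)) ler_wpM2r.
pose g0 x := Num.sg (g x) * (gam x * u x).
have g0abs x : `|g0 x| = if g x == 0 then 0 else `|gam x * u x|.
  rewrite /g0 normrM normr_sg; case: eqP => /=; by rewrite ?mul0r ?mul1r.
have mg0 : measurable_fun setT g0.
  apply: measurable_funM; last exact: measurable_funM.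
  have -> : (fun x => Num.sg (g x)) = (@Num.sg R) \o g by [].
  apply: measurableT_comp => //.
  apply: nondecreasing_measurable => // x y xy.
  have [x0|x0|x0] := ltgtP x 0; have [y0|y0|y0] := ltgtP y 0;
    rewrite ?(gtr0_sg x0) ?(gtr0_sg y0) ?(ltr0_sg x0) ?(ltr0_sg y0) ?x0 ?y0 ?sgr0//; lra.
have g0le x : `|g0 x| <= `|gam x * u x| by rewrite g0abs; case: ifP.
have g0i : dyadic_integrable g0.
  by apply: (dyadic_integrable_le ler01 mg0 _ gui) => x; rewrite mul1r.
have fin : (nnint (fun x => `|g x| `^ p * u x)%R < +oo)%E.
  pose c I := `|alpha I * inner f (haar I)| * (Num.sqrt (len I))^-1.
  have c0 I : 0 <= c I by rewrite mulr_ge0// invr_ge0 sqrtr_ge0.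
  apply: (@le_lt_trans _ _ (nnint (fun x => \sum_(I <- F)
      c I * (\1_(dset I) x * `|gam x * u x|))%R)).
    apply: le_nnint => [|||x].
    - apply: measurable_funM => //; apply: (measurableT_comp (measurable_powR _)) => //.
      exact: measurableT_comp.
    - apply: measurable_sum => I; apply: measurable_funM => //.
      apply: measurable_indicM; first exact: measurable_dyadic_set.
      by apply: measurableT_comp => //; exact: measurable_funM.
    - by move=> x; rewrite mulr_ge0// powR_ge0.
    rewrite gamE -mulrA [leRHS](_ : _ = haar_sum_majorant f x * `|gam x * u x|); last first.
      by rewrite /haar_sum_majorant mulr_suml; apply: eq_bigr => I _; rewrite !mulrA.
    rewrite [X in _ <= _ * X]ger0_norm ?mulr_ge0// ler_wpM2r ?mulr_ge0//.
    exact: abs_haar_partial_sum_le.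
  have mI I : measurable_fun setT (fun x => \1_(dset I) x * `|gam x * u x|).
    apply: measurable_indicM; first exact: measurable_dyadic_set.
    by apply: measurableT_comp => //; exact: measurable_funM.
  rewrite nnint_sum => [|I|I x]; last by rewrite mulr_ge0// indicM_ge0.
    apply: lte_sum_pinfty => I _; rewrite nnintZ//.
    have := cell_massE I gui; rewrite /nnint_on => <-.
    by rewrite -EFinM ltry.
  exact: measurable_funM.
split=> //.
have g0_mass I : `|cell_integral g0 I| <= cell_mass (fun x => gam x * u x) I.
  by apply: le_trans (cell_integral_le_mass I g0i) _; exact: cell_mass_le.
have := sparse_domination (cell_integral_additive fi) (cell_integral_additive g0i)
  (cell_mass_additive fi) (cell_mass_additive gui)
  (fun I => cell_integral_le_mass I fi) g0_mass (fset_uniq F).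
move=> [S [S1 S2 S3]]; exists S; split=> //.
have L0 : 0 <= L by apply: le_trans (aL (0, 0)).
apply: le_trans (ler_wpM2l L0 S3).
have -> : fine (nnint (fun x => `|g x| `^ p * u x)%R) =
    \sum_(I <- F) (alpha I * inner f (haar I)) * inner g0 (haar I).
  rewrite -integral_lincomb => [|I]; last exact: mul_haar_integrable.
  apply: eq_Rintegral => x _; rewrite gamE.
  have -> : `|g x| * gam x * u x = g x * g0 x by rewrite normrEsg /g0; ring.
  move: (g0 x) => y; rewrite /g /haar_partial_sum mulr_suml.
  by apply: eq_bigr => I _; ring.
apply: le_trans (ler_norm _) _; apply: le_trans (ler_norm_sum _ _ _) _.
rewrite mulr_sumr; apply: ler_sum => I _.
by rewrite -inner_haar_mul// !normrM -mulrA ler_wpM2r// mulr_ge0.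
Qed.

End HaarPairing.

(** * From sparse sums to norm bounds *)

Section FiniteSumBound.
Variable R : realType.
Local Notation mu := (@lebesgue_measure R).
Local Notation len := (@dyadic_length R).

Lemma conj_exponent_gt1 (p : R) : 1 < p -> 1 < conj_exponent p.
Proof.
by move=> p1; rewrite /conj_exponent ltr_pdivlMr ?subr_gt0// mul1r ltrBlDr ltrDl.
Qed.

Lemma conj_exponentV (p : R) : 1 < p -> p^-1 + (conj_exponent p)^-1 = 1.
Proof.
move=> p1; have p0 : p != 0 by rewrite gt_eqF// (lt_trans ltr01).
have p10 : p - 1 != 0 by rewrite gt_eqF// subr_gt0.
by rewrite /conj_exponent; field; rewrite p0 p10.
Qed.

Lemma conj_exponent_mul (p : R) : 1 < p -> (p - 1) * conj_exponent p = p.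
Proof.
move=> p1; have p10 : p - 1 != 0 by rewrite gt_eqF// subr_gt0.
by rewrite /conj_exponent; field.
Qed.

Lemma conj_exponent_subr1 (p : R) : 1 < p -> conj_exponent p - 1 = (p - 1)^-1.
Proof.
move=> p1; have p10 : p - 1 != 0 by rewrite gt_eqF// subr_gt0.
by rewrite /conj_exponent; field.
Qed.

(** Young's inequality with a parameter th on each term; the choice of th makes
    the contribution of the y equal to X / 2, which moves to the left side. *)
Lemma young_absorption (p : R) (T : eqType) (S : seq T) (t x y : T -> R)
    (X Y A1 A2 K L : R) :
  1 < p -> 0 < A2 -> 0 <= L -> 0 <= K -> 0 <= A1 -> 0 <= Y ->
  (forall q, q \in S -> [/\ 0 <= x q, 0 <= y q &
     t q <= K * (x q `^ p^-1 * y q `^ (conj_exponent p)^-1)]) ->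
  X <= L * (64 * \sum_(q <- S) t q) ->
  \sum_(q <- S) x q <= A1 * Y -> \sum_(q <- S) y q <= A2 * X ->
  X <= (128 * L * K) `^ p * (A1 * A2 `^ (p - 1)) * Y.
Proof.
move=> p1 A20 L0 K0 A10 Y0 xy XS xA yA.
have p0 : 0 < p by exact: lt_trans p1.
have r1 := conj_exponent_gt1 p1; set r := conj_exponent p in xy r1 *.
have r0 : 0 < r by exact: lt_trans r1.
set c := 64 * L * K; have c0 : 0 <= c by rewrite !mulr_ge0.
have -> : 128 * L * K = 2 * c by rewrite /c; ring.
have Xc : X <= c * \sum_(q <- S) x q `^ p^-1 * y q `^ r^-1.
  apply: le_trans XS _.
  have -> : c * \sum_(q <- S) x q `^ p^-1 * y q `^ r^-1 =
    L * (64 * (K * \sum_(q <- S) x q `^ p^-1 * y q `^ r^-1)) by rewrite /c; ring.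
  rewrite ler_wpM2l// ler_wpM2l// mulr_sumr big_seq [leRHS]big_seq.
  by apply: ler_sum => q /xy[].
clearbody c.
have [c00|cn0] := eqVneq c 0.
  apply: le_trans Xc _; rewrite c00 mul0r !mulr_ge0// powR_ge0//.
have cp : 0 < c by rewrite lt_def cn0 c0.
have b0 : 0 < 2 * c * A2 by rewrite !mulr_gt0.
pose th := (2 * c * A2) `^ r^-1.
have th0 : 0 < th by exact: powR_gt0.
have thr : th `^ r = 2 * c * A2.
  by rewrite /th -powRrM mulVf ?gt_eqF// powRr1// ltW.
have thp : th `^ p = (2 * c * A2) `^ (p - 1).
  rewrite /th -powRrM; congr (_ `^ _); rewrite /r /conj_exponent.
  have p10 : p - 1 != 0 by rewrite gt_eqF// subr_gt0.
  by field; rewrite p10 gt_eqF.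
have young q : q \in S -> x q `^ p^-1 * y q `^ r^-1 <=
    th `^ p * x q + (2 * c * A2)^-1 * y q.
  move=> /xy[x0 y0 _].
  have -> : x q `^ p^-1 * y q `^ r^-1 = (th * x q `^ p^-1) * (th^-1 * y q `^ r^-1).
    by rewrite mulrACA mulfV ?mul1r// gt_eqF.
  apply: le_trans (conjugate_powR _ _ p0 r0 (conj_exponentV p1)) _.
  - by rewrite mulr_ge0 ?powR_ge0// ltW.
  - by rewrite mulr_ge0 ?powR_ge0// invr_ge0 ltW.
  rewrite !powRM ?powR_ge0 ?invr_ge0 ?(ltW th0)// -!powRrM !mulVf ?gt_eqF//.
  rewrite !powRr1//; apply: lerD.
    by rewrite ler_piMr ?mulr_ge0 ?powR_ge0// invf_le1// ltW.
  have -> : th^-1 `^ r = (2 * c * A2)^-1.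
    rewrite -[th^-1]powR_inv1 ?(ltW th0)// -powRrM mulN1r powRN thr//.
  by rewrite ler_piMr ?mulr_ge0 ?invr_ge0 ?(ltW b0)// invf_le1// ltW.
have : X <= c * (th `^ p * (A1 * Y)) + X / 2.
  apply: le_trans Xc _.
  have -> : c * (th `^ p * (A1 * Y)) + X / 2 =
      c * (th `^ p * (A1 * Y) + (2 * c * A2)^-1 * (A2 * X)).
    by field; rewrite cn0 gt_eqF.
  rewrite ler_wpM2l//.
  apply: (@le_trans _ _ (th `^ p * \sum_(q <- S) x q + (2 * c * A2)^-1 * \sum_(q <- S) y q)).
    rewrite !mulr_sumr -big_split/= big_seq [leRHS]big_seq.
    by apply: ler_sum => q /young.
  by apply: lerD; rewrite ler_wpM2l// ?powR_ge0// invr_ge0 ltW.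
have -> : (2 * c) `^ p = 2 * c * (2 * c) `^ (p - 1) by rewrite mulr_powRB1// mulr_ge0.
rewrite thp powRM ?(ltW A20) ?mulr_ge0//.
move: ((2 * c) `^ (p - 1)) (A2 `^ (p - 1)) => a b h.
have -> : 2 * c * a * (A1 * b) * Y = 2 * (c * (a * b * (A1 * Y))) by ring.
lra.
Qed.

Lemma fine_sum_le (T : eqType) (S : seq T) (t : T -> \bar R) (B : R) :
  (forall q, 0 <= t q)%E -> (\sum_(q <- S) t q <= B%:E)%E ->
  \sum_(q <- S) fine (t q) <= B /\ (forall q, q \in S -> (fine (t q))%:E = t q).
Proof.
move=> t0 tB.
have tq q : q \in S -> (fine (t q))%:E = t q.
  move=> qS; rewrite fineK// ge0_fin_numE//; apply: le_lt_trans (ltry B).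
  by apply: le_trans tB; rewrite (big_rem q)//= leeDl// sume_ge0.
split=> //; rewrite -lee_fin -sumEFin; apply: le_trans tB.
by rewrite big_seq [leRHS]big_seq; apply: lee_sum => q /tq ->.
Qed.

(** Besides local integrability, this is all that the norm inequality requires of
    the pair of weights. *)
Definition sparse_form_bound (p : R) (u v f : R -> R) (K A1 A2 : R) :=
  forall gam : R -> R, measurable_fun setT gam -> (forall x, 0 <= gam x) ->
    dyadic_integrable (fun x => gam x * u x) ->
    (nnint (fun x => gam x `^ conj_exponent p * u x)%R < +oo)%E ->
  forall S : seq (dyadic * set R), sparse_family S ->
    (forall x, \sum_(q <- S) \1_(q.2) x <= 1 :> R) ->
  exists x y : dyadic * set R -> R,
  [/\ forall q, q \in S -> [/\ 0 <= x q, 0 <= y q &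
        cell_mass f q.1 * cell_mass (fun x => gam x * u x) q.1 / len q.1
        <= K * (x q `^ p^-1 * y q `^ (conj_exponent p)^-1)],
      \sum_(q <- S) x q <= A1 * fine (nnint (fun x => `|f x| `^ p * v x)%R) &
      \sum_(q <- S) y q <= A2 * fine (nnint (fun x => gam x `^ conj_exponent p * u x)%R)].

(** With gam = |g|^(p-1) one has gam^p' = |g|^p: the y are bounded by the quantity
    under estimation, as [young_absorption] requires. *)
Lemma finite_sum_bound (p L : R) (alpha : dyadic -> R) (u v f : R -> R) (K A1 A2 : R) F :
  1 < p -> 0 <= K -> 0 <= A1 -> 0 < A2 -> (forall I, `|alpha I| <= L) ->
  (forall x, 0 <= u x) -> dyadic_integrable u -> (forall x, 0 <= v x) ->
  dyadic_integrable f -> in_Lp p v f ->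
  sparse_form_bound p u v f K A1 A2 ->
  (Lp_norm p u (haar_partial_sum alpha F f) <=
    (L * (128 * K * (A1 * A2 `^ (p - 1)) `^ p^-1))%:E * Lp_norm p v f)%E.
Proof.
move=> p1 K0 A10 A20 aL u0 ui v0 fi [mf fp] SB.
have p0 : 0 < p by exact: lt_trans p1.
have [gfin gui [S [S1 S2 S3]]] := pairing_bound F p1 aL fi u0 ui.
set g := haar_partial_sum alpha F f in gfin gui S3 *.
have mg : measurable_fun setT g by exact: measurable_haar_partial_sum.
pose gam x := `|g x| `^ (p - 1).
have gamE : (fun x => gam x `^ conj_exponent p * u x) = (fun x => `|g x| `^ p * u x).
  by apply/funext => x; rewrite /gam -powRrM conj_exponent_mul.
have [|||x [y [xy xA yA]]] := SB gam _ _ gui _ S S1 S2.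
- by apply: measurable_pow; exact: measurable_norm.
- by move=> x; exact: powR_ge0.
- by rewrite gamE.
rewrite gamE in yA.
have fpf : (nnint (fun x => `|f x| `^ p * v x)%R < +oo)%E.
  by apply: lty_poweRy fp; rewrite invr_neq0// gt_eqF.
have pos0 (h k : R -> R) z : (forall x, 0 <= k x) -> 0 <= `|h z| `^ p * k z.
  by move=> k0; rewrite mulr_ge0// powR_ge0.
have L0 : 0 <= L by apply: le_trans (aL (0, 0)).
have Y0 : 0 <= fine (nnint (fun x => `|f x| `^ p * v x)%R).
  by apply: fine_ge0; apply: nnint_ge0 => z; exact: pos0.
have := young_absorption p1 A20 L0 K0 A10 Y0 xy S3 xA yA.
move=> B; rewrite /Lp_norm.
have -> : (\int[mu]_x (`|g x| `^ p * u x)%:E)%E =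
   (fine (nnint (fun x => `|g x| `^ p * u x)%R))%:E.
  by rewrite nnint_fin// => z; exact: pos0.
have -> : (\int[mu]_x (`|f x| `^ p * v x)%:E)%E =
   (fine (nnint (fun x => `|f x| `^ p * v x)%R))%:E.
  by rewrite nnint_fin// => z; exact: pos0.
rewrite !poweR_EFin -EFinM lee_fin.
have -> : L * (128 * K * (A1 * A2 `^ (p - 1)) `^ p^-1) =
    ((128 * L * K) `^ p * (A1 * A2 `^ (p - 1))) `^ p^-1.
  have A0 : 0 <= A1 * A2 `^ (p - 1) by rewrite mulr_ge0// powR_ge0.
  rewrite (powRM _ (powR_ge0 _ _) A0) -powRrM mulfV ?gt_eqF//.
  by rewrite powRr1 ?mulr_ge0//; ring.
rewrite -powRM// ?mulr_ge0 ?powR_ge0//.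
rewrite ge0_ler_powR// ?nnegrE ?invr_ge0 ?(ltW p0)//.
- by apply: fine_ge0; apply: nnint_ge0 => z; exact: pos0.
- by rewrite !mulr_ge0// powR_ge0.
Qed.

End FiniteSumBound.

(** * Averages with respect to a weight *)

Section Averages.
Variable R : realType.
Local Notation dset := (@dyadic_set R).

Definition linear_tail (t : R) : R := if 1 < t then t else 0.

Lemma linear_tail_ge0 t : 0 <= linear_tail t.
Proof. by rewrite /linear_tail; case: ltP => // /(lt_trans ltr01)/ltW. Qed.

Lemma linear_tail_nondecreasing : {homo linear_tail : x y / x <= y}.
Proof.
move=> x y xy; rewrite /linear_tail; case: ltP => [x1|_].
  by rewrite (lt_le_trans x1 xy).
by case: ltP => // /(lt_trans ltr01)/ltW.
Qed.

Lemma measurable_linear_tail : measurable_fun setT linear_tail.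
Proof. apply: nondecreasing_measurable => //; exact: linear_tail_nondecreasing. Qed.

Definition linear_tail_const (p : R) : R :=
  2 `^ (p - 1) / (2 `^ (p - 1) - 1) * 2 `^ p.

Lemma pow2_gt1 (p : R) : 1 < p -> 1 < 2 `^ (p - 1) :> R.
Proof.
move=> p1; have := @gt0_ltr_powR R (p - 1) _ 1 2.
by rewrite powR1; apply; rewrite ?subr_gt0// ?nnegrE// ltr1n.
Qed.

Lemma linear_tail_const_gt0 p : 1 < p -> 0 < linear_tail_const p.
Proof.
move=> /pow2_gt1 h; rewrite /linear_tail_const mulr_gt0 ?powR_gt0//.
by rewrite divr_gt0 ?powR_gt0// subr_gt0.
Qed.

(** Only the levels below 2 x contribute, each of them 2 x level^(p-1), and these
    terms form a geometric progression because p > 1. *)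
Lemma linear_tail_sum p m (x : R) : 1 < p -> 0 <= x ->
  \sum_(i <- iota 0 m.*2) level R m i `^ p * linear_tail (2 * x / level R m i)
  <= linear_tail_const p * x `^ p.
Proof.
move=> p1 x0; have r1 := pow2_gt1 p1; have p0 : 0 < p by exact: lt_trans p1.
set r := 2 `^ (p - 1) in r1 *.
have p10 : 0 < p - 1 by rewrite subr_gt0.
have l0 i : 0 < level R m i := level_gt0 R m i.
have aS i : level R m i.+1 `^ (p - 1) = r * level R m i `^ (p - 1).
  by rewrite levelS powRM// ltW.
have term i : level R m i `^ p * linear_tail (2 * x / level R m i) =
    2 * x * (if level R m i < 2 * x then level R m i `^ (p - 1) else 0).
  rewrite /linear_tail ltr_pdivlMr// mul1r; case: ifP => _; last by rewrite !mulr0.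
  rewrite -(@mulr_powRB1 _ (level R m i) p) ?(ltW (l0 i))//.
  have := lt0r_neq0 (l0 i); move: (level R m i) (_ `^ _) => a b ha.
  by field.
under eq_bigr do rewrite term.
rewrite -mulr_sumr.
have H n : \sum_(i <- iota 0 n) (if level R m i < 2 * x then level R m i `^ (p - 1) else 0)
    <= level R m n `^ (p - 1) / (r - 1) /\
  \sum_(i <- iota 0 n) (if level R m i < 2 * x then level R m i `^ (p - 1) else 0)
    <= r * (2 * x) `^ (p - 1) / (r - 1).
  have r10 : 0 < r - 1 by rewrite subr_gt0.
  elim: n => [|n [ih1 ih2]].
    by rewrite big_nil; split; apply: divr_ge0; rewrite ?mulr_ge0 ?powR_ge0// ltW.
  rewrite -addn1 iotaD add0n big_cat/= big_cons big_nil addr0 addn1.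
  case: ifP => h; last first.
    rewrite addr0; split=> //; apply: le_trans ih1 _.
    by rewrite ler_pM2r ?invr_gt0// aS ler_peMl ?powR_ge0// ltW.
  have k : \sum_(i <- iota 0 n) (if level R m i < 2 * x then level R m i `^ (p - 1) else 0)
     + level R m n `^ (p - 1) <= level R m n.+1 `^ (p - 1) / (r - 1).
    rewrite aS; have -> : r * level R m n `^ (p - 1) / (r - 1) =
      level R m n `^ (p - 1) / (r - 1) + level R m n `^ (p - 1).
      by field; rewrite gt_eqF.
    by rewrite lerD2r.
  split=> //; apply: le_trans k _; rewrite ler_pM2r ?invr_gt0// aS ler_wpM2l ?powR_ge0//.
  by rewrite ge0_ler_powR ?nnegrE ?(ltW p10) ?(ltW (l0 n)) ?mulr_ge0// ltW.
have [_ h] := H m.*2.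
apply: le_trans (ler_wpM2l _ h) _; first by rewrite mulr_ge0.
apply: le_of_eq.
rewrite /linear_tail_const -/r.
have -> : 2 * x * (r * (2 * x) `^ (p - 1) / (r - 1)) =
  (2 * x * (2 * x) `^ (p - 1)) * r / (r - 1) by field; rewrite gt_eqF// subr_gt0.
rewrite mulr_powRB1 ?mulr_ge0// powRM//.
by field; rewrite gt_eqF// subr_gt0.
Qed.

Definition weighted_average (s phi : R -> R) I : R :=
  fine (nnint_on (dset I) (fun x => phi x * s x)%R) / fine (nnint_on (dset I) s).

Lemma weighted_average_ge0 s phi I : (forall x, 0 <= s x) -> (forall x, 0 <= phi x) ->
  0 <= weighted_average s phi I.
Proof.
by move=> s0 phi0; rewrite divr_ge0// fine_ge0// nnint_on_ge0// => x; rewrite mulr_ge0.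
Qed.

Lemma le_of_level (a b c : \bar R) (l : R) :
  (0 <= a -> 0 <= b -> 0 <= c -> (2 / l)%:E * a <= c + b)%E ->
  0 < l -> l < fine a / fine b -> (0 <= a -> 0 <= b -> 0 <= c -> b <= c)%E.
Proof.
move=> H l0 lab a0 b0 c0; move: lab (H a0 b0 c0).
case: c c0 {H} => [c| |] // c0; last by rewrite leey.
case: b b0 => [b| |] //= b0; last by rewrite invr0 mulr0 => /(lt_trans l0); rewrite ltxx.
case: a a0 => [a| |] //= a0; last by rewrite mul0r => /(lt_trans l0); rewrite ltxx.
rewrite -EFinM -EFinD !lee_fin => lab h; rewrite lee_fin in b0.
have [bz|bn0] := eqVneq b 0; first by move: lab; rewrite bz invr0 mulr0 ltNge ltW.
have bp : 0 < b by rewrite lt_def bn0.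
move: lab; rewrite ltr_pdivlMr// => lab.
have : 2 * b < 2 / l * a by rewrite -ltr_pdivrMl ?divr_gt0// invf_div; lra.
lra.
Qed.

(** Integrate 2 phi / l <= 1 + linear_tail (2 phi / l) against s: when the average of
    phi exceeds l, the left side gives more than twice the mass of s. *)
Lemma weighted_average_level (s phi : R -> R) I (l : R) :
  measurable_fun setT s -> (forall x, 0 <= s x) ->
  measurable_fun setT phi -> (forall x, 0 <= phi x) ->
  0 < l -> l < weighted_average s phi I ->
  (nnint_on (dset I) s <=
   nnint_on (dset I) (fun x => linear_tail (2 * phi x / l) * s x)%R)%E.
Proof.
move=> ms s0 mphi phi0 l0.
have md := @measurable_dyadic_set R I.
have mps : measurable_fun setT (fun x => phi x * s x) by exact: measurable_funM.
have ps0 x : 0 <= phi x * s x by rewrite mulr_ge0.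
have m2 : measurable_fun setT (fun x => 2 * phi x / l).
  by apply: measurable_funM => //; exact: measurable_funM.
have mt : measurable_fun setT (fun x => linear_tail (2 * phi x / l) * s x).
  apply: measurable_funM => //; apply: measurableT_comp => //.
  exact: measurable_linear_tail.
have t0 x : 0 <= linear_tail (2 * phi x / l) * s x.
  by rewrite mulr_ge0// linear_tail_ge0.
have : (nnint_on (dset I) (fun x => 2 / l * (phi x * s x))%R <=
   nnint_on (dset I) (fun x => linear_tail (2 * phi x / l) * s x + s x)%R)%E.
  apply: le_nnint_on => //.
  - exact: measurable_funM.
  - exact: measurable_funD.
  - by move=> x; rewrite mulr_ge0// divr_ge0// ltW.
  move=> x; rewrite mulrA -[X in _ + X]mul1r -mulrDl ler_wpM2r//.
  have -> : 2 / l * phi x = 2 * phi x / l by rewrite mulrAC.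
  by rewrite /linear_tail; case: ltP => // h; rewrite ?lerDl// add0r.
rewrite nnint_onZ// ?divr_ge0 ?(ltW l0)// nnint_onD//.
move=> h; rewrite /weighted_average => lt_l.
by apply: (le_of_level _ l0 lt_l) => //; exact: nnint_on_ge0.
Qed.

End Averages.

Section GeometricMean.
Variable R : realType.
Local Notation mu := (@lebesgue_measure R).

Lemma Lnorm_nnint (f : R -> R) (r : R) :
  Lnorm mu r%:E (EFin \o f) = (nnint (fun x => `|f x| `^ r)%R `^ r^-1)%E.
Proof.
by rewrite unlock /=; congr (_ `^ _)%E; apply: eq_integral => x _ /=; rewrite poweR_EFin.
Qed.

Lemma nnint_on_hoelder (E : set R) (h k : R -> R) (p q : R) : measurable E ->
  0 < p -> 0 < q -> p^-1 + q^-1 = 1 ->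
  measurable_fun setT h -> measurable_fun setT k ->
  (forall x, 0 <= h x) -> (forall x, 0 <= k x) ->
  (nnint_on E (fun x => h x `^ p^-1 * k x `^ q^-1)%R <=
   nnint_on E h `^ p^-1 * nnint_on E k `^ q^-1)%E.
Proof.
move=> mE p0 q0 pq mh mk h0 k0.
have := @hoelder _ _ R mu (fun x => \1_E x * h x `^ p^-1)
  (fun x => \1_E x * k x `^ q^-1) p q.
have powE (g : R -> R) (r : R) x : 0 < r -> (forall x, 0 <= g x) ->
    `|\1_E x * g x `^ r^-1| `^ r = \1_E x * g x.
  move=> r0 g0; rewrite indicE; case: (x \in E); rewrite /= ?mul1r ?mul0r.
    by rewrite ger0_norm ?powR_ge0// -powRrM mulVf ?gt_eqF// powRr1.
  by rewrite normr0 powR0 ?gt_eqF.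
rewrite !Lnorm_nnint invr1 poweRe1; last by apply: nnint_ge0 => x; exact: powR_ge0.
move=> H; have := H _ _ p0 q0 pq.
under [X in (_ <= nnint X `^ _ * _)%E]eq_fun do rewrite powE//.
under [X in (_ <= _ * nnint X `^ _)%E]eq_fun do rewrite powE//.
move=> {}H; apply: le_trans (H _ _).
- apply: le_of_eq; apply: eq_nnint => x /=.
  rewrite indicE; case: (x \in E); rewrite /= ?mul1r ?mul0r ?normr0 powRr1//.
  by rewrite ger0_norm// mulr_ge0// powR_ge0.
- by apply: measurable_indicM => //; exact: measurable_pow.
- by apply: measurable_indicM => //; exact: measurable_pow.
Qed.

End GeometricMean.

(** * The A_p condition on one dyadic interval *)

Section Weights.
Variable R : realType.
Local Notation mu := (@lebesgue_measure R).
Local Notation len := (@dyadic_length R).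
Local Notation dset := (@dyadic_set R).

Lemma bounded_interval_dyadic_set I : bounded_interval (dset I).
Proof.
exists (I.2%:~R * len I), ((I.2 + 1)%:~R * len I), true, true; split=> //.
by rewrite ltr_pM2r ?dyadic_length_gt0// ltr_int ltrDl.
Qed.

Lemma weight_dyadic_integrable (w : R -> R) : weight w -> dyadic_integrable w.
Proof.
move=> [w0 [mw _ wK]]; split=> // I.
pose K := `[I.2%:~R * len I, (I.2 + 1)%:~R * len I]%classic : set R.
have := wK K (@subsetT _ _) (@segment_compact _ _ _).
have mK : measurable K by exact: measurable_itv.
rewrite nnint_restrict//; apply: le_lt_trans.
apply: nnint_indic_le => //.
- exact: measurable_dyadic_set.
- exact: measurable_norm.
by move=> x /mem_dyadic_set /andP[h1 h2]; rewrite /K /= in_itv/= h1 ltW.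
Qed.

Lemma measurable_epow (w : R -> R) (r : R) : measurable_fun setT w ->
  measurable_fun setT (fun x => epow (w x) r).
Proof.
move=> mw; rewrite /epow; apply: measurable_fun_ifT => //.
  have [r0|r0] := ltP r 0; last by under eq_fun do rewrite andbF; exact: measurable_cst.
  by under eq_fun do rewrite andbT; exact: measurable_fun_eqr.
by apply: measurable_EFinT; exact: measurable_pow.
Qed.

Lemma epow_ge0 (x r : R) : (0 <= epow x r)%E.
Proof. by rewrite /epow; case: ifP => // _; rewrite lee_fin powR_ge0. Qed.

Lemma dyadic_average I (F : R -> \bar R) :
  average (dset I) F = ((len I)^-1%:E * \int[mu]_(x in dset I) F x)%E.
Proof. by rewrite /average lebesgue_dyadic_set. Qed.

Lemma nnint_on_fin_le E (h : R -> R) Q : measurable E -> measurable Q ->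
  measurable_fun setT h -> (forall x, 0 <= h x) -> E `<=` Q ->
  (nnint_on Q h < +oo)%E ->
  (nnint_on E h < +oo)%E /\ fine (nnint_on E h) <= fine (nnint_on Q h).
Proof.
move=> mE mQ mh h0 EQ Qfin; have EleQ := nnint_indic_le mE mQ mh h0 EQ.
have Efin := le_lt_trans EleQ Qfin; split=> //.
by rewrite -lee_fin !fineK// ge0_fin_numE// nnint_on_ge0.
Qed.

(** Here W and S stand for the masses of w and of its dual weight on an interval
    of length l, and We, Se for those on its major subset.  Write W S as
    W S^(p-1) S^(2-p): the A_p condition bounds the first part, and
    S^(2-p) <= Se^(2-p) because p >= 2.  What is left is l^(p-1), comparable with
    e^(p-1), for which Hoelder's inequality (the last hypothesis) gives powers of
    We and Se. *)
Lemma moen_inequality (p W S We Se l e a : R) : 2 <= p -> 0 <= W -> 0 < We ->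
  0 < Se -> Se <= S -> 0 < e -> 0 < l -> l <= 2 * e -> 0 <= a ->
  W * S `^ (p - 1) <= a * l `^ p -> e `^ p <= We * Se `^ (p - 1) ->
  W * S / l <= 2 `^ (p - 1) * a * (Se `^ p^-1 * We `^ (conj_exponent p)^-1).
Proof.
move=> p2 W0 We0 Se0 SeS e0 l0 le2 a0 hA hE.
have p1 : 1 < p by lra.
have p0 : 0 < p by lra.
have pn0 : p != 0 by rewrite gt_eqF.
have p10 : 0 < p - 1 by lra.
have S0 : 0 < S by exact: lt_le_trans SeS.
have pn (x : R) r s : 0 < x -> x `^ (r + s) = x `^ r * x `^ s.
  by move=> x0; apply: powRD; rewrite (gt_eqF x0) implybT.
have -> : W * S / l = W * S `^ (p - 1) * S `^ (2 - p) / l.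
  rewrite -mulrA -[X in _ = X / l]mulrA -pn//.
  have -> : p - 1 + (2 - p) = 1 by ring.
  by rewrite powRr1 ?(ltW S0)// mulrA.
apply: (@le_trans _ _ (a * l `^ p * S `^ (2 - p) / l)).
  by rewrite ler_pM2r ?invr_gt0// ler_wpM2r ?powR_ge0.
have -> : a * l `^ p * S `^ (2 - p) / l = a * (l `^ (p - 1) * S `^ (2 - p)).
  by rewrite -(@mulr_powRB1 _ l p) ?(ltW l0)//; field; rewrite gt_eqF.
have -> : 2 `^ (p - 1) * a * (Se `^ p^-1 * We `^ (conj_exponent p)^-1) =
  a * (2 `^ (p - 1) * (Se `^ p^-1 * We `^ (conj_exponent p)^-1)) by ring.
apply: ler_wpM2l => //.
have hl : l `^ (p - 1) <= 2 `^ (p - 1) * e `^ (p - 1).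
  rewrite -powRM// ?(ltW e0)// ge0_ler_powR ?nnegrE ?(ltW p10) ?(ltW l0)//.
  by rewrite mulr_ge0// ltW.
have hS : S `^ (2 - p) <= Se `^ (2 - p).
  have -> : 2 - p = - (p - 2) by ring.
  rewrite !powRN lef_pV2 ?posrE ?powR_gt0// ge0_ler_powR ?nnegrE ?(ltW S0) ?(ltW Se0)//.
  by rewrite subr_ge0.
have he : e `^ (p - 1) <= We `^ (conj_exponent p)^-1 * Se `^ ((p - 1) * (conj_exponent p)^-1).
  have cE : (conj_exponent p)^-1 = (p - 1) / p by rewrite /conj_exponent invf_div.
  have -> : e `^ (p - 1) = (e `^ p) `^ (conj_exponent p)^-1.
    by rewrite -powRrM cE; congr (_ `^ _); field.
  apply: le_trans (_ : (We * Se `^ (p - 1)) `^ (conj_exponent p)^-1 <= _).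
    by rewrite ge0_ler_powR ?nnegrE ?powR_ge0 ?mulr_ge0 ?powR_ge0 ?(ltW We0)// cE divr_ge0 ?ltW.
  by rewrite powRM ?powR_ge0 ?(ltW We0)// -powRrM.
apply: le_trans (ler_pM _ _ hl hS) _; rewrite ?powR_ge0//.
rewrite -mulrA ler_wpM2l ?powR_ge0//.
apply: le_trans (ler_wpM2r (powR_ge0 _ _) he) _.
rewrite -mulrA -pn// [leRHS]mulrC; apply: le_of_eq.
congr (_ * _ `^ _); rewrite /conj_exponent invf_div.
by field.
Qed.

(** The power is 0 at the zeros of w, where the A_p condition has +oo.  By [Ap_cell]
    this concerns a null set in any interval of positive mass. *)
Definition dual_weight (p : R) (w : R -> R) x := w x `^ (1 - conj_exponent p).

Lemma Ap_const_ge0 (p : R) (w : R -> R) : weight w -> (0 <= Ap_const p w)%E.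
Proof.
move=> [w0 _]; pose Q := `[0, 1]%classic : set R.
apply: le_trans (ereal_sup_ubound (ex_intro2 _ _ Q _ erefl)); last first.
  by exists 0, 1, true, false; split.
apply: mule_ge0; last exact: poweR_ge0.
apply: mule_ge0; first by rewrite lee_fin invr_ge0 fine_ge0.
by apply: integral_ge0 => x _; rewrite lee_fin.
Qed.

(** If w vanished on a set of positive measure in I, the average of the dual power
    would be infinite; as w has positive mass on I, so would be the A_p constant. *)
Lemma Ap_cell p w I : 1 < p -> weight w -> (Ap_const p w < +oo)%E ->
  0 < fine (nnint_on (dset I) w) ->
  [/\ (nnint_on (dset I) (dual_weight p w) < +oo)%E,
      {ae mu, forall x, dset I x -> w x != 0} &
      fine (nnint_on (dset I) w) *
        fine (nnint_on (dset I) (dual_weight p w)) `^ (p - 1)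
      <= fine (Ap_const p w) * len I `^ p].
Proof.
move=> p1 ww Aoo Wp.
have p10 : 0 < p - 1 by rewrite subr_gt0.
have w0 : forall x, 0 <= w x by case: ww.
have mw : measurable_fun setT w by case: ww => _ [].
have md := @measurable_dyadic_set R I.
have l0 := dyadic_length_gt0 R I.
have r0 : 1 - conj_exponent p < 0 by rewrite subr_lt0 conj_exponent_gt1.
have WE : (fine (nnint_on (dset I) w))%:E = nnint_on (dset I) w.
  rewrite fineK// ge0_fin_numE ?nnint_on_ge0//.
  have [_ /(_ I)] := weight_dyadic_integrable ww.
  by under [X in nnint_on _ X]eq_fun do rewrite ger0_norm//.
set W := fine _ in Wp WE *.
set Z := (\int[mu]_(x in dset I) epow (w x) (1 - conj_exponent p))%E.
have Z0 : (0 <= Z)%E by apply: integral_ge0 => x _; exact: epow_ge0.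
have prod : ((W / len I)%:E * ((len I)^-1%:E * Z) `^ (p - 1) <= Ap_const p w)%E.
  apply: ereal_sup_ubound; exists (dset I); first exact: bounded_interval_dyadic_set.
  rewrite !dyadic_average; congr (_ * _)%E.
  by rewrite nnint_restrict// -WE -EFinM mulrC.
have Zoo : (Z < +oo)%E.
  rewrite ltNge leye_eq; apply/eqP => Ze; move: prod; rewrite Ze.
  rewrite gt0_muley ?lte_fin ?invr_gt0// poweRyr ?gt_eqF//.
  by rewrite gt0_muley ?lte_fin ?divr_gt0// leye_eq => /eqP h; rewrite h ltxx in Aoo.
have mep : measurable_fun (dset I) (fun x => epow (w x) (1 - conj_exponent p)).
  by apply: measurable_funTS; exact: measurable_epow.
have aew : {ae mu, forall x, dset I x -> w x != 0}.
  have : {ae mu, forall x, dset I x -> epow (w x) (1 - conj_exponent p) \is a fin_num}.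
    apply: integrable_ae => //; apply/integrableP; split=> //.
    by under eq_integral do rewrite gee0_abs ?epow_ge0//.
  apply: ae_imp => x h /h.
  by rewrite /epow; case: eqP => // ->; rewrite r0.
have sZ : (nnint_on (dset I) (dual_weight p w) <= Z)%E.
  rewrite -nnint_restrict//; apply: ge0_le_integral => //.
  - by move=> x _; rewrite lee_fin powR_ge0.
  - by apply: measurable_funTS; apply: measurable_EFinT; exact: measurable_pow.
  by move=> x _; rewrite /epow /dual_weight; case: ifP => // _; rewrite leey.
have sfin := le_lt_trans sZ Zoo.
split=> //.
have Afin : (fine (Ap_const p w))%:E = Ap_const p w.
  by rewrite fineK// ge0_fin_numE// Ap_const_ge0.
clearbody Z; move: prod; rewrite -[X in (_ <= X)%E]Afin.
case: Z Z0 Zoo sZ => [z| |]//; rewrite lee_fin => z0 _ sz.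
have -> : ((W / len I)%:E * ((len I)^-1%:E * z%:E) `^ (p - 1))%E =
   (W / len I * ((len I)^-1 * z) `^ (p - 1))%:E by [].
rewrite lee_fin powRM ?invr_ge0 ?(ltW l0)//.
have -> : (len I)^-1 `^ (p - 1) = (len I `^ (p - 1))^-1.
  by rewrite -[X in X `^ _]powR_inv1 ?(ltW l0)// -powRrM mulN1r powRN.
move=> h; rewrite -(@mulr_powRB1 _ (len I) p) ?(ltW l0)//; last exact: lt_trans p1.
have lp : 0 < len I `^ (p - 1) by exact: powR_gt0.
have {}h : W * z `^ (p - 1) <= fine (Ap_const p w) * (len I * len I `^ (p - 1)).
  rewrite -ler_pdivrMr ?mulr_gt0//; apply: le_trans h.
  by apply: le_of_eq; field; rewrite !gt_eqF.
apply: le_trans h; rewrite ler_wpM2l ?(ltW Wp)// ge0_ler_powR ?nnegrE ?(ltW p10)//.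
- by rewrite fine_ge0// nnint_on_ge0// => x; exact: powR_ge0.
rewrite -lee_fin fineK// ge0_fin_numE// nnint_on_ge0// => x; exact: powR_ge0.
Qed.

End Weights.

(** * The sparse estimate for A_p weights *)

Section ApSparse.
Variable R : realType.
Local Notation mu := (@lebesgue_measure R).
Local Notation dset := (@dyadic_set R).

Lemma conj_exponentK (p : R) : 1 < p -> conj_exponent (conj_exponent p) = p.
Proof.
move=> p1; rewrite {1}/conj_exponent conj_exponent_subr1// invrK /conj_exponent.
by rewrite divfK// gt_eqF// subr_gt0.
Qed.

(** For p < 2 exchange w and its dual weight: the conjugate exponent is at least 2,
    and the A_p condition of the dual weight is that of w to the power 1 / (p - 1),
    which is where the exponent of a comes from. *)
Lemma moen_inequality_max (p W S We Se l e a : R) : 1 < p ->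
  0 < We -> We <= W -> 0 < Se -> Se <= S -> 0 < e -> 0 < l -> l <= 2 * e -> 0 <= a ->
  W * S `^ (p - 1) <= a * l `^ p -> e `^ p <= We * Se `^ (p - 1) ->
  W * S / l <= (2 `^ (p - 1) + 2 `^ (conj_exponent p - 1)) *
    a `^ Num.max 1 (p - 1)^-1 * (Se `^ p^-1 * We `^ (conj_exponent p)^-1).
Proof.
move=> p1 We0 WeW Se0 SeS e0 l0 le2 a0 hA hE.
have W0 : 0 < W by exact: lt_le_trans WeW.
have S0 : 0 < S by exact: lt_le_trans SeS.
have p0 : 0 < p by exact: lt_trans p1.
have p10 : 0 < p - 1 by rewrite subr_gt0.
have pow0 (r : R) : 0 <= 2 `^ r by exact: powR_ge0.
have [p2|p2] := leP 2 p.
  have -> : Num.max 1 (p - 1)^-1 = 1.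
    by apply/max_idPl; rewrite invf_le1//; lra.
  rewrite powRr1//; apply: le_trans (moen_inequality p2 (ltW W0) We0 Se0 SeS e0 l0 le2 a0 hA hE) _.
  by rewrite ler_wpM2r ?mulr_ge0 ?powR_ge0// ler_wpM2r// lerDl.
have -> : Num.max 1 (p - 1)^-1 = (p - 1)^-1.
  by apply/max_idPr; rewrite invf_ge1//; lra.
have r1 := conj_exponent_gt1 p1.
have r2 : 2 <= conj_exponent p by rewrite /conj_exponent ler_pdivlMr//; lra.
have rE : p * (p - 1)^-1 = conj_exponent p by [].
have up (x y : R) : 0 <= x -> x <= y -> x `^ (p - 1)^-1 <= y `^ (p - 1)^-1.
  move=> x0 xy; rewrite ge0_ler_powR ?nnegrE ?invr_ge0 ?(ltW p10)//.
  exact: le_trans xy.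
have hA' : S * W `^ (conj_exponent p - 1) <= a `^ (p - 1)^-1 * l `^ conj_exponent p.
  have := up _ _ (mulr_ge0 (ltW W0) (powR_ge0 _ _)) hA.
  rewrite !powRM ?powR_ge0 ?(ltW W0)// -!powRrM.
  by rewrite mulfV ?gt_eqF// powRr1 ?(ltW S0)// rE conj_exponent_subr1// mulrC.
have hE' : e `^ conj_exponent p <= Se * We `^ (conj_exponent p - 1).
  have := up _ _ (powR_ge0 _ _) hE; rewrite powRM ?powR_ge0 ?(ltW We0)// -!powRrM.
  by rewrite mulfV ?gt_eqF// powRr1 ?(ltW Se0)// rE conj_exponent_subr1// mulrC.
have := moen_inequality r2 (ltW S0) Se0 We0 WeW e0 l0 le2 (powR_ge0 _ _) hA' hE'.
rewrite conj_exponentK// mulrC [_ * S]mulrC [We `^ _ * _]mulrC mulrC => h.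
apply: le_trans h _.
by rewrite ler_wpM2r ?mulr_ge0 ?powR_ge0// ler_wpM2r ?powR_ge0// lerDr.
Qed.

Lemma nnint_on_fin (E : set R) (h : R -> R) : (forall x, 0 <= h x) ->
  (nnint_on E h < +oo)%E -> (fine (nnint_on E h))%:E = nnint_on E h.
Proof. by move=> h0 hfin; rewrite fineK// ge0_fin_numE// nnint_on_ge0. Qed.

Lemma ae_nnint_on (Q : set R) (h k : R -> R) : measurable Q ->
  measurable_fun setT h -> measurable_fun setT k ->
  {ae mu, forall x, Q x -> h x = k x} -> nnint_on Q h = nnint_on Q k.
Proof.
move=> mQ mh mk hk; apply: ae_eq_nnint; try exact: measurable_indicM.
apply: ae_imp hk => x; rewrite indicE; case: (boolP (x \in Q)).
  by move=> /set_mem Qx ->.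
by rewrite !mul0r.
Qed.

(** Hoelder's inequality, the product of the roots of the two weights being 1. *)
Lemma dual_weight_mass p w (E : set R) : 1 < p -> weight w -> measurable E ->
  {ae mu, forall x, E x -> w x != 0} ->
  (mu E <= nnint_on E w `^ p^-1 * nnint_on E (dual_weight p w) `^ (conj_exponent p)^-1)%E.
Proof.
move=> p1 ww mE aew.
have w0 : forall x, 0 <= w x by case: ww.
have mw : measurable_fun setT w by case: ww => _ [].
have p0 : 0 < p by exact: lt_trans p1.
have r0 : 0 < conj_exponent p by exact: lt_trans (conj_exponent_gt1 p1).
have ms : measurable_fun setT (dual_weight p w) by exact: measurable_pow.
apply: le_trans (nnint_on_hoelder mE p0 r0 (conj_exponentV p1) mw ms w0 _).
  rewrite -nnint_indic//; apply: le_of_eq.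
  apply: ae_nnint_on => //.
    by apply: measurable_funM; exact: measurable_pow.
  apply: ae_imp aew => x h /h wx; rewrite /dual_weight -powRrM -powRD ?wx ?implybT//.
  have -> : p^-1 + (1 - conj_exponent p) / conj_exponent p = 0.
    by have := conj_exponentV p1; rewrite mulrBl mul1r mulfV ?gt_eqF// => h'; lra.
  by rewrite powRr0.
by move=> x; exact: powR_ge0.
Qed.

Definition Ap_form_const (p : R) : R := 2 `^ (p - 1) + 2 `^ (conj_exponent p - 1).

Definition embedding_const (p : R) : R := 2 `^ p * linear_tail_const p.

Lemma embedding_const_gt0 p : 1 < p -> 0 < embedding_const p.
Proof. by move=> p1; rewrite mulr_gt0 ?powR_gt0// linear_tail_const_gt0. Qed.

Lemma average_embedding (p : R) (s phi : R -> R) (S : seq (dyadic * set R)) :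
  1 < p -> measurable_fun setT s -> (forall x, 0 <= s x) ->
  measurable_fun setT phi -> (forall x, 0 <= phi x) -> sparse_family S ->
  (forall x, \sum_(q <- S) \1_(q.2) x <= 1 :> R) ->
  (nnint (fun x => phi x `^ p * s x)%R < +oo)%E ->
  let t q := ((weighted_average s phi q.1 `^ p)%:E * nnint_on q.2 s)%E in
  \sum_(q <- S) fine (t q)
    <= embedding_const p * fine (nnint (fun x => phi x `^ p * s x)%R) /\
  (forall q, q \in S -> (fine (t q))%:E = t q).
Proof.
move=> p1 ms s0 mphi phi0 S1 S2 fin t.
have p0 : 0 < p by exact: lt_trans p1.
apply: fine_sum_le => [q|].
  by rewrite mule_ge0 ?lee_fin ?powR_ge0// nnint_on_ge0.
rewrite EFinM nnint_fin//; last by move=> x; rewrite mulr_ge0// powR_ge0.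
apply: (maximal_theorem (Psi := @linear_tail R)) => //.
- exact: measurable_linear_tail.
- exact: linear_tail_ge0.
- by move=> m x; exact: linear_tail_sum.
- by move=> q /S1[].
- by move=> I; exact: weighted_average_ge0.
- by move=> q l _; exact: weighted_average_level.
Qed.

Lemma geometric_mean_pos (p e We Se : R) : 1 < p -> 0 < e -> 0 <= We -> 0 <= Se ->
  e <= We `^ p^-1 * Se `^ (conj_exponent p)^-1 ->
  [/\ 0 < We, 0 < Se & e `^ p <= We * Se `^ (p - 1)].
Proof.
move=> p1 e0 We0 Se0 eH.
have p0 : 0 < p by exact: lt_trans p1.
have r0 : 0 < conj_exponent p by exact: lt_trans (conj_exponent_gt1 p1).
split.
- rewrite lt_def We0 andbT; apply/eqP => We00; move: eH.
  by rewrite We00 powR0 ?mul0r ?invr_neq0 ?gt_eqF// leNgt e0.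
- rewrite lt_def Se0 andbT; apply/eqP => Se00; move: eH.
  by rewrite Se00 powR0 ?mulr0 ?invr_neq0 ?gt_eqF// leNgt e0.
have -> : We * Se `^ (p - 1) = (We `^ p^-1 * Se `^ (conj_exponent p)^-1) `^ p.
  rewrite powRM ?powR_ge0// -!powRrM mulVf ?gt_eqF// powRr1//.
  by congr (_ * _ `^ _); rewrite /conj_exponent invf_div divfK// gt_eqF.
by rewrite ge0_ler_powR ?nnegrE ?mulr_ge0 ?powR_ge0 ?(ltW p0) ?(ltW e0).
Qed.

Lemma sparse_term_le (p r W SS We Se l K N1 N2 mf mg x y : R) : 0 < p -> 0 < r ->
  0 <= We -> 0 <= Se -> 0 <= N1 -> 0 <= N2 ->
  x = N1 `^ p * Se -> y = N2 `^ r * We -> mf = N1 * SS -> mg = N2 * W ->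
  W * SS / l <= K * (Se `^ p^-1 * We `^ r^-1) ->
  mf * mg / l <= K * (x `^ p^-1 * y `^ r^-1).
Proof.
move=> p0 r0 We0 Se0 N10 N20 -> -> -> -> h.
rewrite !powRM ?powR_ge0// -!powRrM !mulfV ?gt_eqF// !powRr1//.
have -> : N1 * SS * (N2 * W) / l = (N1 * N2) * (W * SS / l) by ring.
have -> : K * (N1 * Se `^ p^-1 * (N2 * We `^ r^-1)) =
   (N1 * N2) * (K * (Se `^ p^-1 * We `^ r^-1)) by ring.
by rewrite ler_wpM2l// mulr_ge0.
Qed.

(** For phi = |f| w^(p'-1) the integrals of |f| and gam w over an interval are the
    averages of phi and gam, for the dual weight and for w, times the masses of
    these weights.  [moen_inequality_max] trades the masses on the interval for
    those on its major subset, and [average_embedding] sums the averages. *)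
Lemma Ap_sparse_form_bound p w f : 1 < p -> Ap_weight p w ->
  dyadic_integrable f -> in_Lp p w f ->
  sparse_form_bound p w w f
    (Ap_form_const p * fine (Ap_const p w) `^ Num.max 1 (p - 1)^-1)
    (embedding_const p) (embedding_const (conj_exponent p)).
Proof.
move=> p1 [ww Aoo] fi [mf fLp] gam mgam gam0 gwi gfin S S1 S2.
have p0 : 0 < p by exact: lt_trans p1.
have r1 := conj_exponent_gt1 p1; set r := conj_exponent p in r1 *.
have r0 : 0 < r by exact: lt_trans r1.
have w0 : forall x, 0 <= w x by case: ww.
have mw : measurable_fun setT w by case: ww => _ [].
pose sig := dual_weight p w.
have sig0 x : 0 <= sig x by exact: powR_ge0.
have msig : measurable_fun setT sig by exact: measurable_pow.
pose phi x := `|f x| * w x `^ (r - 1).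
have phi0 x : 0 <= phi x by rewrite mulr_ge0// powR_ge0.
have mphi : measurable_fun setT phi.
  by apply: measurable_funM; [exact: measurable_norm|exact: measurable_pow].
have phis x : w x != 0 -> phi x * sig x = `|f x|.
  move=> wx; rewrite /phi /sig /dual_weight -mulrA -powRD ?wx ?implybT//.
  have -> : r - 1 + (1 - conj_exponent p) = 0 by rewrite /r; ring.
  by rewrite powRr0 mulr1.
have phips x : phi x `^ p * sig x = `|f x| `^ p * w x.
  have [wx|wx] := eqVneq (w x) 0.
    by rewrite /sig /dual_weight wx powR0 ?mulr0// lt_eqF// subr_lt0.
  rewrite /phi /sig /dual_weight powRM ?powR_ge0// -powRrM -mulrA -powRD ?wx ?implybT//.
  have -> : (r - 1) * p + (1 - conj_exponent p) = 1.
    rewrite /r /conj_exponent; field.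
    by rewrite gt_eqF// subr_gt0.
  by rewrite powRr1.
have phiE : (fun x => phi x `^ p * sig x) = (fun x => `|f x| `^ p * w x).
  by apply/funext => x; exact: phips.
have ffin : (nnint (fun x => phi x `^ p * sig x)%R < +oo)%E.
  by rewrite phiE; apply: lty_poweRy fLp; rewrite invr_neq0// gt_eqF.
have [X1 X2] := average_embedding p1 msig sig0 mphi phi0 S1 S2 ffin.
have [Y1 Y2] := average_embedding r1 mw w0 mgam gam0 S1 S2 gfin.
rewrite phiE in X1.
exists (fun q => fine ((weighted_average sig phi q.1 `^ p)%:E * nnint_on q.2 sig)%E).
exists (fun q => fine ((weighted_average w gam q.1 `^ r)%:E * nnint_on q.2 w)%E).
split=> // q qS; clear X1 X2 Y1 Y2.
have N10 := weighted_average_ge0 q.1 sig0 phi0.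
have N20 := weighted_average_ge0 q.1 w0 gam0.
have x0 : 0 <= fine ((weighted_average sig phi q.1 `^ p)%:E * nnint_on q.2 sig)%E.
  by rewrite fine_ge0// mule_ge0 ?lee_fin ?powR_ge0// nnint_on_ge0.
have y0 : 0 <= fine ((weighted_average w gam q.1 `^ r)%:E * nnint_on q.2 w)%E.
  by rewrite fine_ge0// mule_ge0 ?lee_fin ?powR_ge0// nnint_on_ge0.
split; [exact: x0|exact: y0|].
have a0 : 0 <= fine (Ap_const p w) `^ Num.max 1 (p - 1)^-1 by exact: powR_ge0.
have C0 : 0 <= Ap_form_const p by rewrite addr_ge0// powR_ge0.
have [mE EQ lE] := S1 q qS.
have md := @measurable_dyadic_set R q.1.
have l0 := dyadic_length_gt0 R q.1.
have Wfin : (nnint_on (dset q.1) w < +oo)%E.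
  have [_ /(_ q.1)] := weight_dyadic_integrable ww.
  by under [X in nnint_on _ X]eq_fun do rewrite ger0_norm//.
have mgw : measurable_fun setT (fun x => gam x * w x) by exact: measurable_funM.
have gw0 x : 0 <= gam x * w x by rewrite mulr_ge0.
have massg : cell_mass (fun x => gam x * w x) q.1 =
    fine (nnint_on (dset q.1) (fun x => gam x * w x)%R).
  by rewrite /cell_mass; under [X in nnint_on _ X]eq_fun do rewrite ger0_norm//.
(* An interval on which w vanishes almost everywhere escapes the A_p condition,
   but contributes nothing. *)
have [Wz|Wn0] := eqVneq (fine (nnint_on (dset q.1) w)) 0.
  have : nnint_on (dset q.1) w = 0%E.
    by rewrite -(nnint_on_fin w0 Wfin) Wz.
  move=> /nnint_eq0 h.
  have {}h : {ae mu, forall x, \1_(dset q.1) x * w x = 0}.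
    apply: h; first exact: measurable_indicM.
    by move=> x; apply: indicM_ge0.
  rewrite massg (_ : nnint_on _ _ = nnint_on (dset q.1) (cst 0)); last first.
    apply: ae_nnint_on => //; apply: ae_imp h => x + Qx.
    by rewrite indicE mem_set// mul1r => ->; rewrite mulr0.
  have -> : nnint_on (dset q.1) (cst 0) = 0%E :> \bar R.
    rewrite /nnint_on /nnint; under eq_integral do rewrite mulr0.
    by rewrite integral0.
  by rewrite mulr0 mul0r !mulr_ge0// powR_ge0.
have Wp : 0 < fine (nnint_on (dset q.1) w).
  by rewrite lt_def Wn0 fine_ge0// nnint_on_ge0.
have [sfin aew hA] := Ap_cell p1 ww Aoo Wp.
have [Wefin WeW] := nnint_on_fin_le mE md mw w0 EQ Wfin.
have [Sefin SeS] := nnint_on_fin_le mE md msig sig0 EQ sfin.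
have aewE : {ae mu, forall x, q.2 x -> w x != 0} by apply: ae_imp aew => x h /EQ.
have hmass := dual_weight_mass p1 ww mE aewE.
have WeE : (fine (nnint_on q.2 w))%:E = nnint_on q.2 w.
  exact: nnint_on_fin.
have SeE : (fine (nnint_on q.2 sig))%:E = nnint_on q.2 sig.
  exact: nnint_on_fin.
rewrite -/sig -/r -WeE -SeE in hmass.
have We0 : 0 <= fine (nnint_on q.2 w) by rewrite fine_ge0// nnint_on_ge0.
have Se0 : 0 <= fine (nnint_on q.2 sig) by rewrite fine_ge0// nnint_on_ge0.
have xE : fine ((weighted_average sig phi q.1 `^ p)%:E * nnint_on q.2 sig)%E =
    weighted_average sig phi q.1 `^ p * fine (nnint_on q.2 sig) by rewrite -SeE.
have yE : fine ((weighted_average w gam q.1 `^ r)%:E * nnint_on q.2 w)%E =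
    weighted_average w gam q.1 `^ r * fine (nnint_on q.2 w) by rewrite -WeE.
have muEfin : (mu q.2 < +oo)%E.
  apply: (@le_lt_trans _ _ (mu (dset q.1))); last by rewrite lebesgue_dyadic_set ltry.
  by apply: le_measure; rewrite ?inE.
have muE : (fine (mu q.2))%:E = mu q.2 by rewrite fineK// ge0_fin_numE.
move: lE; rewrite -muE -EFinM lee_fin => lE.
have e0 : 0 < fine (mu q.2).
  by move: (lt_le_trans l0 lE); rewrite pmulr_rgt0.
have eH : fine (mu q.2) <=
    fine (nnint_on q.2 w) `^ p^-1 * fine (nnint_on q.2 sig) `^ r^-1.
  by rewrite -lee_fin muE EFinM -!poweR_EFin.
have [{}We0 {}Se0 hE] := geometric_mean_pos p1 e0 We0 Se0 eH.
have A0 : 0 <= fine (Ap_const p w) by rewrite fine_ge0// Ap_const_ge0.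
have h_moen := moen_inequality_max p1 We0 WeW Se0 SeS e0 l0 lE A0 hA hE.
have massf : cell_mass f q.1 = weighted_average sig phi q.1 * fine (nnint_on (dset q.1) sig).
  rewrite /weighted_average divfK; last by rewrite gt_eqF// (lt_le_trans Se0 SeS).
  congr fine; apply: ae_nnint_on => //.
  - exact: measurable_norm.
  - exact: measurable_funM.
  by apply: ae_imp aew => x h /h /phis ->.
have massg' : cell_mass (fun x => gam x * w x) q.1 =
    weighted_average w gam q.1 * fine (nnint_on (dset q.1) w).
  by rewrite /weighted_average divfK// massg.
exact: (sparse_term_le p0 r0 (ltW We0) (ltW Se0) N10 N20 xE yE massf massg' h_moen).
Qed.

End ApSparse.

(** * Conjugate Young functions and the B_p condition *)

Section YoungFunctions.
Variable R : realType.
Local Notation mu := (@lebesgue_measure R).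

Variable B : R -> R.
Hypothesis yB : young_function B.

Lemma young_ge0 s : 0 <= s -> 0 <= B s.
Proof. by case: yB => + _ _ _ _; apply. Qed.

Lemma young0 : B 0 = 0.
Proof. by case: yB => _ _ _ _ []. Qed.

Lemma young_homo s t : 0 <= s -> s <= t -> B s <= B t.
Proof.
move=> s0; rewrite le_eqVlt => /orP[/eqP->//|st]; case: yB => _ _ _ mono _.
by apply/ltW/mono => //; rewrite in_itv/= andbT// ltW// (le_lt_trans s0).
Qed.

Lemma young_le_chord s : 0 < s -> s <= 1 -> B s <= s * B 1.
Proof.
move=> s0 s1; case: yB => _ _ cvx _ _.
have := cvx (Itv01 (ltW s0) s1) 1 0.
rewrite !inE /= !in_itv /= ler01 lexx /= => /(_ isT isT).
have -> : conv (Itv01 (ltW s0) s1) (1 : convex_lmodType R^o) 0 = s.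
  by rewrite /conv /= /unstable.onem scaler0 addr0 /GRing.scale/= mulr1.
have -> : conv (Itv01 (ltW s0) s1) (B 1 : R^o) (B 0) = s * B 1 + (1 - s) * B 0 by [].
by rewrite young0 mulr0 addr0.
Qed.

Definition conjugate t := fine (associate B t).

(** For small s convexity gives B s <= s B 1, so s t - B s is close to 0. *)
Lemma associate_ge0 t : (0 <= associate B t)%E.
Proof.
apply/lee_addgt0Pr => e e0.
pose s := Num.min 1 (e / (`|t| + B 1 + 1)).
have B1 : 0 <= B 1 by exact: young_ge0.
have d0 : 0 < `|t| + B 1 + 1 by have := normr_ge0 t; lra.
have s0 : 0 < s by rewrite lt_min ltr01 divr_gt0.
have s1 : s <= 1 by rewrite ge_min lexx.
have se : s * (`|t| + B 1 + 1) <= e.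
  by rewrite -ler_pdivlMr// /s ge_min lexx orbT.
have h : ((s * t - B s)%:E <= associate B t)%E.
  by apply: ereal_sup_ubound; exists s.
apply: le_trans (leeD2r e%:E h); rewrite -EFinD lee_fin.
have := young_le_chord s0 s1.
have : - `|t| <= t by rewrite lerNl -normrN ler_norm.
move=> h1 h2; have : s * (- `|t|) <= s * t by rewrite ler_wpM2l// ltW.
move: se; rewrite !mulrDr mulrN mulr1; lra.
Qed.

(** B s >= |t| s for large s, since B s / s tends to infinity. *)
Lemma associate_lty t : (associate B t < +oo)%E.
Proof.
case: yB => _ _ _ _ [_ /cvgryPge /(_ `|t|) [M [_ hM]]].
apply: (@le_lt_trans _ _ (`|t| * `|M|)%:E); last exact: ltry.
apply: ge_ereal_sup => _ [s /= s0 <-]; rewrite lee_fin.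
have [sM|Ms] := leP s `|M|.
  have := young_ge0 (ltW s0).
  have : s * t <= `|t| * `|M|.
    rewrite mulrC; apply: le_trans (ler_wpM2r (ltW s0) (ler_norm t)) _.
    by rewrite ler_wpM2l.
  lra.
have : `|t| <= B s / s by apply: hM; apply: le_lt_trans Ms; exact: ler_norm.
rewrite ler_pdivlMr// => h.
have : t * s <= `|t| * s by rewrite ler_wpM2r ?ler_norm// ltW.
have : 0 <= `|t| * `|M| by rewrite mulr_ge0.
rewrite [t * s]mulrC; lra.
Qed.

Lemma conjugateE t : (conjugate t)%:E = associate B t.
Proof. by rewrite fineK// ge0_fin_numE ?associate_ge0// associate_lty. Qed.

Lemma conjugate_ge0 t : 0 <= conjugate t.
Proof. by rewrite -lee_fin conjugateE associate_ge0. Qed.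

Lemma young_conjugate s t : 0 <= s -> s * t <= B s + conjugate t.
Proof.
rewrite le_eqVlt => /orP[/eqP<-|s0]; first by rewrite mul0r young0 add0r conjugate_ge0.
rewrite -lerBlDl -lee_fin conjugateE.
by apply: ereal_sup_ubound; exists s.
Qed.

Lemma conjugate_homo : {homo conjugate : x y / x <= y}.
Proof.
move=> x y xy; rewrite -lee_fin !conjugateE.
apply: ge_ereal_sup => _ [s /= s0 <-].
apply: (@le_trans _ _ (s * y - B s)%:E); first by rewrite lee_fin lerD2r ler_pM2l.
by apply: ereal_sup_ubound; exists s.
Qed.

Lemma measurable_conjugate : measurable_fun setT conjugate.
Proof. apply: nondecreasing_measurable => //; exact: conjugate_homo. Qed.

Variable c0 : R.
Hypothesis c00 : 0 < c0.

(** Cutting the conjugate off near 0 makes its sums over all dyadic levels finite;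
    in Young's inequality this costs an additive constant only. *)
Definition conjugate_tail t := if c0 < t then conjugate t else 0.

Lemma conjugate_tail_ge0 t : 0 <= conjugate_tail t.
Proof. by rewrite /conjugate_tail; case: ifP => // _; exact: conjugate_ge0. Qed.

Lemma conjugate_tail_homo : {homo conjugate_tail : x y / x <= y}.
Proof.
move=> x y xy; rewrite /conjugate_tail; case: (ltP c0 x) => [cx|_].
  by rewrite (lt_le_trans cx xy) conjugate_homo.
by case: ifP => // _; exact: conjugate_ge0.
Qed.

Lemma measurable_conjugate_tail : measurable_fun setT conjugate_tail.
Proof. apply: nondecreasing_measurable => //; exact: conjugate_tail_homo. Qed.

Lemma young_conjugate_tail s t : 0 <= s ->
  s * t <= B s + conjugate_tail t + conjugate c0.
Proof.
move=> s0; rewrite /conjugate_tail; case: ltP => [_|tc].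
  by apply: le_trans (young_conjugate t s0) _; rewrite lerDl conjugate_ge0.
by rewrite addr0; apply: le_trans (young_conjugate c0 s0); rewrite ler_wpM2l.
Qed.

Variable p : R.
Hypothesis p1 : 1 < p.
Let p0 : 0 < p. Proof. exact: lt_trans p1. Qed.

(** The integrand of the B_p condition, which says nothing below c0. *)
Definition tail_density t : R := \1_(`[c0, +oo[%classic : set R) t *
  (conjugate t * t `^ (- (p + 1))).

Lemma tail_density_ge0 t : 0 <= tail_density t.
Proof. by apply: indicM_ge0; rewrite mulr_ge0 ?powR_ge0// conjugate_ge0. Qed.

Lemma measurable_tail_density : measurable_fun setT tail_density.
Proof.
apply: measurable_indicM; first exact: measurable_itv.
by apply: measurable_funM; [exact: measurable_conjugate|exact: measurable_powR].
Qed.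

Lemma nnint_tail_density : nnint tail_density =
  (\int[mu]_(t in `[c0, +oo[) (associate B t * (t `^ p)^-1%:E * t^-1%:E))%E.
Proof.
rewrite -[LHS]/(nnint_on _ (fun t => conjugate t * t `^ (- (p + 1)))%R).
rewrite -nnint_restrict; last exact: measurable_itv.
apply: eq_integral => t; rewrite inE/= in_itv/= andbT => ct.
have t0 : 0 < t by exact: lt_le_trans ct.
rewrite -conjugateE -!EFinM -mulrA; congr (_ * _)%:E.
by rewrite opprD powRD ?(gt_eqF t0) ?implybT// powRN powR_inv1 ?ltW.
Qed.

Let t_ (x : R) m i := 2 * x / level R m i.

Let t_S x m i : t_ x m i = 2 * t_ x m i.+1.
Proof.
rewrite /t_ levelS; have := lt0r_neq0 (level_gt0 R m i).
by move: (level R m i) => l l0; field.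
Qed.

Let block x m i : set R := `[t_ x m i, 2 * t_ x m i[%classic.

Let block_disjoint x m n t : 0 < x ->
  \sum_(i <- iota 0 n) \1_(block x m i) t <= (nat_of_bool (2 * t_ x m n <= t)%R)%:R :> R.
Proof.
move=> x0; elim: n => [|n ih]; first by rewrite big_nil.
rewrite -addn1 iotaD add0n big_cat/= big_cons big_nil addr0 addn1 -t_S.
apply: le_trans (lerD ih (lexx _)) _; rewrite indicE.
have tp : 0 < t_ x m n by rewrite divr_gt0 ?level_gt0// mulr_gt0.
have [h|h] := leP (2 * t_ x m n) t.
  have -> : t \in block x m n = false.
    by apply/negP => /set_mem; rewrite /block/= in_itv/= ltNge h andbF.
  have -> : t_ x m n <= t by apply: le_trans h; lra.
  by rewrite addr0.
have -> : t \in block x m n = (t_ x m n <= t).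
  by apply/idP/idP => [/set_mem|h']; [|apply/mem_set]; rewrite /block/= in_itv/= h andbT.
by rewrite add0r.
Qed.

(** The sum is a Riemann sum of the B_p integral.  For t_i = 2 x / level the
    factor level^p is (2 x / t_i)^p, and by monotonicity the conjugate at t_i times
    t_i^-p is at most a constant times the integral of the density over
    [t_i, 2 t_i).  These blocks are disjoint, as the t_i are powers of 2 apart. *)
Lemma conjugate_tail_sum m (x : R) : (nnint tail_density < +oo)%E -> 0 <= x ->
  \sum_(i <- iota 0 m.*2) level R m i `^ p * conjugate_tail (2 * x / level R m i)
  <= 2 `^ p * 2 `^ (p + 1) * fine (nnint tail_density) * x `^ p.
Proof.
move=> Jfin; rewrite le_eqVlt => /orP[/eqP<-|x0].
  rewrite big1 => [|i _]; last first.
    by rewrite mulr0 mul0r /conjugate_tail ltNge (ltW c00) mulr0.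
  by rewrite powR0 ?mulr0// gt_eqF.
have y0 : 0 < 2 * x by rewrite mulr_gt0.
rewrite -lee_fin -sumEFin.
have blockE i : measurable (block x m i) by exact: measurable_itv.
apply: (@le_trans _ _ (\sum_(i <- iota 0 m.*2)
   ((2 * x) `^ p * 2 `^ (p + 1))%:E * nnint_on (block x m i) tail_density)%E).
  apply: lee_sum => i _; rewrite -/(t_ x m i).
  have l0 := level_gt0 R m i.
  have t0 : 0 < t_ x m i by rewrite divr_gt0.
  have [ct|ct] := ltP c0 (t_ x m i); last first.
    rewrite /conjugate_tail ltNge ct/= mulr0 mule_ge0 ?lee_fin ?mulr_ge0 ?powR_ge0//.
    exact/nnint_on_ge0/tail_density_ge0.
  rewrite /conjugate_tail ct.
  pose k := conjugate (t_ x m i) * (2 * t_ x m i) `^ (- (p + 1)).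
  have k0 : 0 <= k by rewrite mulr_ge0 ?powR_ge0// conjugate_ge0.
  have kint : nnint_on (block x m i) (cst k) = (k * t_ x m i)%:E.
    rewrite (_ : cst k = fun t => k * cst 1 t); last by apply/funext => t; rewrite mulr1.
    rewrite nnint_onZ// nnint_indic//.
    rewrite lebesgue_measure_itv/= lte_fin.
    have -> : t_ x m i < 2 * t_ x m i by lra.
    by rewrite -EFinB -EFinM; congr (_ * _)%:E; ring.
  have -> : (level R m i `^ p * conjugate (t_ x m i))%:E =
     (((2 * x) `^ p * 2 `^ (p + 1))%:E * nnint_on (block x m i) (cst k))%E.
    rewrite kint -EFinM; congr EFin.
    have -> : level R m i = 2 * x / t_ x m i.
      by rewrite /t_; field; rewrite !gt_eqF.
    have tv0 : 0 <= (t_ x m i)^-1 by rewrite invr_ge0 ltW.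
    rewrite /k !powRN (powRM (p + 1) _ (ltW t0))// (powRM p (ltW y0) tv0).
    have -> : (t_ x m i)^-1 `^ p = (t_ x m i `^ p)^-1.
      by rewrite -[X in X `^ _]powR_inv1 ?(ltW t0)// -powRrM mulN1r powRN.
    have -> : t_ x m i `^ (p + 1) = t_ x m i `^ p * t_ x m i.
      by rewrite powRD ?(gt_eqF t0) ?implybT// powRr1 ?(ltW t0).
    have := powR_gt0 p t0; have := @powR_gt0 R 2 (p + 1) ltac:(lra).
    move: (_ `^ (p + 1)) (t_ x m i `^ p) => a b a0 b0.
    by field; rewrite !gt_eqF.
  apply: lee_wpmul2l; first by rewrite lee_fin mulr_ge0 ?powR_ge0.
  apply: le_nnint.
  - exact: measurable_indicM.
  - by apply: measurable_indicM => //; exact: measurable_tail_density.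
  - by move=> t; apply: indicM_ge0.
  move=> t; rewrite !indicE; case: (boolP (t \in block x m i)); last by rewrite !mul0r.
  move=> /set_mem; rewrite /block/= in_itv/= => /andP[h1 h2]; rewrite !mul1r.
  rewrite /tail_density indicE mem_set; last by rewrite /= in_itv/= andbT ltW// (lt_le_trans ct).
  rewrite mul1r /k; apply: ler_pM; rewrite ?powR_ge0 ?conjugate_ge0//.
    exact: conjugate_homo.
  have tt0 : 0 < t by exact: lt_le_trans h1.
  rewrite !powRN lef_pV2 ?posrE ?powR_gt0//; last by rewrite mulr_gt0.
  have pp : 0 <= p + 1 by have := p0; lra.
  exact: (ge0_ler_powR pp (ltW tt0) (ltW (lt_trans tt0 h2)) (ltW h2)).
have -> : 2 `^ p * 2 `^ (p + 1) * fine (nnint tail_density) * x `^ p =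
   (2 * x) `^ p * 2 `^ (p + 1) * fine (nnint tail_density).
  by rewrite powRM ?(ltW x0)//; ring.
rewrite -ge0_sume_distrr => [|i _]; last exact/nnint_on_ge0/tail_density_ge0.
rewrite [leRHS]EFinM; apply: lee_wpmul2l; first by rewrite lee_fin mulr_ge0 ?powR_ge0.
rewrite nnint_fin//; last exact: tail_density_ge0.
rewrite -nnint_sum => [|i|i t]; last by apply: indicM_ge0; exact: tail_density_ge0.
  apply: le_nnint => [|||t].
  - apply: measurable_sum => i; apply: measurable_indicM => //.
    exact: measurable_tail_density.
  - exact: measurable_tail_density.
  - move=> t; apply: sumr_ge0 => i _; apply: indicM_ge0; exact: tail_density_ge0.
  rewrite -mulr_suml ler_piMl ?tail_density_ge0//.
  apply: le_trans (block_disjoint m m.*2 t x0) _.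
  by rewrite lern1 leq_b1.
by apply: measurable_indicM => //; exact: measurable_tail_density.
Qed.

End YoungFunctions.

(** * Gauges and a Hoelder inequality for Luxemburg norms *)

Section Gauge.
Variable R : realType.
Local Notation len := (@dyadic_length R).
Local Notation dset := (@dyadic_set R).

Definition gauge_set (Psi F : R -> R) I : set R :=
  [set l | 0 < l /\ (nnint_on (dset I) (fun x => Psi (F x / l))%R <= (len I)%:E)%E].

(** A Luxemburg norm for Psi, up to the factor 2.  Thanks to this factor, l < gauge
    makes the defining condition fail at l / 2, that is, for 2 F / l; this is what
    [maximal_theorem] asks for. *)
Definition gauge (Psi F : R -> R) I : R := 2 * inf (gauge_set Psi F I).

Variables (Psi F : R -> R) (p D : R).
Hypotheses (p0 : 0 < p) (D0 : 0 <= D).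
Hypotheses (mPsi : measurable_fun setT Psi) (Psi0 : forall t, 0 <= Psi t).
Hypothesis PsiD : forall x, 0 <= x -> Psi (2 * x) <= D * x `^ p.
Hypotheses (mF : measurable_fun setT F) (F0 : forall x, 0 <= F x).
Hypothesis Fp : (nnint (fun x => F x `^ p)%R < +oo)%E.

Lemma gauge_set_lbound I : has_lbound (gauge_set Psi F I).
Proof. by exists 0 => l [/ltW]. Qed.

Lemma measurable_gauge_fun l : measurable_fun setT (fun x => Psi (F x / l)).
Proof. by apply: measurableT_comp => //; exact: measurable_funM. Qed.

(** Since Psi grows at most like a p-th power and F^p is integrable, the condition
    holds for large l. *)
Lemma gauge_set_nonempty I : gauge_set Psi F I !=set0.
Proof.
set X := fine (nnint (fun x => F x `^ p)%R).
have Fp0 x : 0 <= F x `^ p by exact: powR_ge0.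
have XE : X%:E = nnint (fun x => F x `^ p)%R by rewrite nnint_fin.
have X0 : 0 <= X by rewrite fine_ge0// nnint_ge0.
have l0 := dyadic_length_gt0 R I.
have c0 : 0 <= D * X / len I by rewrite divr_ge0 ?mulr_ge0// ltW.
pose b := (D * X / len I) `^ p^-1 + 1.
have b0 : 0 < b by rewrite ltr_wpDl ?powR_ge0.
exists (b / 2); split; first by rewrite divr_gt0.
have bp : D * X / len I <= b `^ p.
  have -> : D * X / len I = ((D * X / len I) `^ p^-1) `^ p.
    by rewrite -powRrM mulVf ?gt_eqF// powRr1.
  by rewrite ge0_ler_powR ?nnegrE ?powR_ge0 ?(ltW p0) ?(ltW b0)// lerDl.
have md := @measurable_dyadic_set R I.
have mFp : measurable_fun setT (fun x => F x `^ p) by exact: measurable_pow.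
have k0 : 0 <= D * (b `^ p)^-1 by rewrite mulr_ge0// invr_ge0 powR_ge0.
apply: (@le_trans _ _ (nnint_on (dset I) (fun x => D * (b `^ p)^-1 * F x `^ p)%R)).
  apply: le_nnint_on => //; first exact: measurable_gauge_fun.
    exact: measurable_funM.
  move=> x; have -> : F x / (b / 2) = 2 * (F x / b) by field; rewrite gt_eqF.
  apply: le_trans (PsiD _) _; first by rewrite divr_ge0// ltW.
  rewrite powRM ?invr_ge0 ?(ltW b0)//.
  have -> : b^-1 `^ p = (b `^ p)^-1.
    by rewrite -[X in X `^ _]powR_inv1 ?(ltW b0)// -powRrM mulN1r powRN.
  by rewrite -mulrA [X in _ * X]mulrC.
rewrite nnint_onZ//; apply: (@le_trans _ _ ((D * (b `^ p)^-1)%:E * X%:E)%E).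
  by rewrite lee_wpmul2l ?lee_fin// XE; exact: le_nnint_on_nnint.
rewrite -EFinM lee_fin mulrAC ler_pdivrMr ?powR_gt0//.
by rewrite [leRHS]mulrC -ler_pdivrMr.
Qed.

Lemma inf_gauge_set_ge0 I : 0 <= inf (gauge_set Psi F I).
Proof.
by apply: lb_le_inf; [exact: gauge_set_nonempty|move=> l [/ltW]].
Qed.

Lemma gauge_ge0 I : 0 <= gauge Psi F I.
Proof. by rewrite mulr_ge0// inf_gauge_set_ge0. Qed.

Lemma gauge_admissible I (e : R) : 0 < e ->
  exists2 l, gauge_set Psi F I l & l < gauge Psi F I + e.
Proof.
move=> e0; have [l hl le] := inf_adherent e0
  (conj (gauge_set_nonempty I) (gauge_set_lbound I)).
by exists l => //; rewrite /gauge; have := inf_gauge_set_ge0 I; lra.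
Qed.

Lemma gauge_level I l : 0 < l -> l < gauge Psi F I ->
  ((len I)%:E <= nnint_on (dset I) (fun x => Psi (2 * F x / l))%R)%E.
Proof.
move=> l0 lN; rewrite leNgt; apply/negP => h.
have : gauge_set Psi F I (l / 2).
  split; first by rewrite divr_gt0.
  apply/ltW/(le_lt_trans _ h); apply: le_of_eq.
  by apply: eq_nnint => x; congr (_ * Psi _); field; rewrite gt_eqF.
move=> /(ge_inf (gauge_set_lbound I)); move: lN; rewrite /gauge; lra.
Qed.

End Gauge.

Section LuxemburgHoelder.
Variable R : realType.
Local Notation mu := (@lebesgue_measure R).
Local Notation len := (@dyadic_length R).
Local Notation dset := (@dyadic_set R).

Lemma measurable_young_comp (B : R -> R) (G : R -> \bar R) (l : R) :
  young_function B -> 0 < l -> measurable_fun setT G -> (forall x, 0 <= G x)%E ->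
  measurable_fun setT (fun x => er_map B (`|G x| * l^-1%:E)%E).
Proof.
move=> yB l0 mG G0; pose Bp t := B (Num.max 0 t).
(* B is monotone on [0, oo) only *)
have mBp : measurable_fun setT Bp.
  apply: nondecreasing_measurable => // x y xy; apply: (young_homo yB).
    by rewrite le_max lexx.
  by rewrite ge_max !le_max lexx/= xy orbT.
have -> : (fun x => er_map B (`|G x| * l^-1%:E)%E) = er_map Bp \o (fun x => (G x * l^-1%:E)%E).
  apply/funext => x /=; rewrite gee0_abs//.
  have : (0 <= G x * l^-1%:E)%E by rewrite mule_ge0// lee_fin invr_ge0 ltW.
  by case: (G x * _)%E => //= r; rewrite lee_fin => r0; rewrite /Bp max_r.
apply: measurableT_comp; first exact: (@measurable_er_map _ (measurableTypeR R)).
exact: emeasurable_funM.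
Qed.

(** Integrate Young's inequality for F / N and G / l.  The two norm conditions
    contribute |I| each, and the cut-off of the conjugate contributes the constant
    times |I|.  Where G is infinite, so is the right side of Young's inequality. *)
Lemma young_hoelder (B : R -> R) (c0 : R) (f F : R -> R) (G : R -> \bar R) I (l N : R) :
  young_function B -> 0 < c0 -> 0 < l ->
  measurable_fun setT f -> (forall x, 0 <= f x) ->
  measurable_fun setT F -> (forall x, 0 <= F x) ->
  measurable_fun setT G -> (forall x, 0 <= G x)%E ->
  (forall x, (f x)%:E <= (F x)%:E * G x \/ G x = +oo)%E ->
  (average (dset I) (fun x => er_map B (`|G x| * l^-1%:E)) <= 1)%E ->
  gauge_set (conjugate_tail B c0) F I N ->
  (nnint_on (dset I) f <= (N * l * ((2 + conjugate B c0) * len I))%:E)%E.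
Proof.
move=> yB c00 l0 mf f0 mF F0 mG G0 fFG lux [N0 gN].
have md := @measurable_dyadic_set R I.
have len0 := dyadic_length_gt0 R I.
have nl0 : 0 < N * l by rewrite mulr_gt0.
have b0 := conjugate_ge0 yB c0.
pose EB x := er_map B (`|G x| * l^-1%:E)%E.
have EB0 x : (0 <= EB x)%E.
  rewrite /EB gee0_abs//.
  have : (0 <= G x * l^-1%:E)%E by rewrite mule_ge0// lee_fin invr_ge0 ltW.
  case: (G x * _)%E => //= r; rewrite !lee_fin; exact: young_ge0.
have mEB : measurable_fun setT EB by exact: measurable_young_comp.
have luxI : (\int[mu]_(x in dset I) EB x <= (len I)%:E)%E.
  move: lux; rewrite dyadic_average => h.
  have := lee_wpmul2l (_ : 0 <= (len I)%:E)%E h; rewrite mule1 muleA -EFinM.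
  by rewrite mulfV ?gt_eqF// mul1e; apply; rewrite lee_fin ltW.
have mPs : measurable_fun setT (fun x => conjugate_tail B c0 (F x / N)).
  apply: measurableT_comp; first exact: measurable_conjugate_tail.
  exact: measurable_funM.
pose H x := conjugate_tail B c0 (F x / N) + conjugate B c0.
have mH : measurable_fun setT H by exact: measurable_funD.
have H0 x : 0 <= H x by rewrite addr_ge0// conjugate_tail_ge0.
have pt x : (((N * l)^-1 * f x)%:E <= (H x)%:E + EB x)%E.
  case: (fFG x) => [|Goo]; last first.
    by rewrite /EB Goo /= gt0_mulye ?lte_fin ?invr_gt0//= addey// leey.
  have := G0 x; rewrite /EB; case: (G x) => [g| |] //= g0; last first.
    by rewrite gt0_mulye ?lte_fin ?invr_gt0//= addey// leey.
  rewrite -EFinM -EFinD !lee_fin in g0 *; rewrite ger0_norm// => fFg.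
  have := @young_conjugate_tail _ _ yB c0 (g / l) (F x / N).
  rewrite divr_ge0 ?(ltW l0)// => /(_ isT) hy.
  apply: (@le_trans _ _ ((N * l)^-1 * (F x * g))).
    by rewrite ler_wpM2l// invr_ge0 ltW.
  have -> : (N * l)^-1 * (F x * g) = g / l * (F x / N) by field; rewrite !gt_eqF.
  by apply: le_trans hy _; rewrite /H; lra.
have : (\int[mu]_(x in dset I) ((N * l)^-1 * f x)%:E <=
   \int[mu]_(x in dset I) ((H x)%:E + EB x))%E.
  apply: ge0_le_integral => //.
  - by move=> x _; rewrite lee_fin mulr_ge0// invr_ge0 ltW.
  - by apply: measurable_funTS; apply: measurable_EFinT; exact: measurable_funM.
  - apply: measurable_funTS; apply: emeasurable_funD => //; exact: measurable_EFinT.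
rewrite ge0_integralD//; last 3 first.
- by move=> x _; rewrite lee_fin.
- by apply: measurable_funTS; exact: measurable_EFinT.
- by apply: measurable_funTS.
rewrite nnint_restrict// nnint_onZ// ?invr_ge0 ?(ltW nl0)// nnint_restrict// => h.
have hH : (nnint_on (dset I) H <= ((1 + conjugate B c0) * len I)%:E)%E.
  rewrite nnint_onD//; last by move=> x; exact: conjugate_tail_ge0.
  rewrite mulrDl mul1r EFinD; apply: leeD => //.
  rewrite (_ : (fun=> conjugate B c0) = fun t => conjugate B c0 * cst 1 t); last first.
    by apply/funext => t; rewrite mulr1.
  by rewrite nnint_onZ// nnint_indic// lebesgue_dyadic_set.
have {}h := le_trans h (leeD hH luxI).
have := lee_wpmul2l (_ : 0 <= (N * l)%:E)%E h; rewrite lee_fin (ltW nl0) => /(_ isT).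
rewrite muleA -EFinM mulfV ?gt_eqF// mul1e => /le_trans; apply.
by rewrite -EFinD -EFinM lee_fin; apply: le_of_eq; ring.
Qed.

Lemma le_mul_inf (S : set R) (m c b : R) : 0 <= c ->
  ereal_inf [set l%:E | l in S] = b%:E -> (forall l, S l -> m <= c * l) -> m <= c * b.
Proof.
move=> c0 infE hS; apply/ler_addgt0Pr => e e0.
have e1 : 0 < e / (c + 1) by rewrite divr_gt0// ltr_wpDl.
have : (ereal_inf [set l%:E | l in S] < (b + e / (c + 1))%:E)%E.
  by rewrite infE lte_fin ltrDl.
move=> /ereal_inf_lt[_ [l Sl <-]]; rewrite lte_fin => lb.
apply: le_trans (hS _ Sl) _; apply: le_trans (ler_wpM2l c0 (ltW lb)) _.
rewrite mulrDr lerD2l mulrCA ler_piMr ?(ltW e0)//.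
by rewrite ler_pdivrMr ?ltr_wpDl// mul1r lerDl.
Qed.

(** Each bound passes to the infimum.  If one infimum is infinite, the other one
    vanishes, the product being finite; then so does the number that it bounds. *)
Lemma le_inf_product (SA SB : set R) (mA mB cA cB K : R) : 0 <= cA -> 0 <= cB ->
  0 <= mA -> 0 <= mB -> 0 <= K -> (forall l, SA l -> 0 < l) -> (forall l, SB l -> 0 < l) ->
  (forall l, SA l -> mA <= cA * l) -> (forall l, SB l -> mB <= cB * l) ->
  (ereal_inf [set l%:E | l in SA] * ereal_inf [set l%:E | l in SB] <= K%:E)%E ->
  mA * mB <= cA * cB * K.
Proof.
move=> cA0 cB0 mA0 mB0 K0 SA0 SB0 hA hB.
have inf0 (S : set R) : (forall l, S l -> 0 < l) ->
    (0 <= ereal_inf [set l%:E | l in S])%E.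
  by move=> S0; apply: le_ereal_inf_tmp => _ [l Sl <-]; rewrite lee_fin ltW// S0.
have rhs0 : 0 <= cA * cB * K by rewrite !mulr_ge0.
have := inf0 _ SA0; have := inf0 _ SB0.
case eB : (ereal_inf [set l%:E | l in SB]) => [b| |] // b0;
case eA : (ereal_inf [set l%:E | l in SA]) => [a| |] // a0.
- rewrite -EFinM lee_fin => ab; rewrite !lee_fin in a0 b0.
  have := le_mul_inf cA0 eA hA; have := le_mul_inf cB0 eB hB => h1 h2.
  apply: le_trans (ler_pM mA0 mB0 h2 h1) _.
  by rewrite mulrACA ler_wpM2l// mulr_ge0.
- have [bz|bn] := eqVneq b 0.
    have := le_mul_inf cB0 eB hB; rewrite bz mulr0 => h _.
    have -> : mB = 0 by apply/eqP; rewrite eq_le h mB0.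
    by rewrite mulr0.
  by rewrite gt0_mulye ?leye_eq// lte_fin lt_def bn -lee_fin.
- have [az|an] := eqVneq a 0.
    have := le_mul_inf cA0 eA hA; rewrite az mulr0 => h _.
    have -> : mA = 0 by apply/eqP; rewrite eq_le h mA0.
    by rewrite mul0r.
  by rewrite gt0_muley ?leye_eq// lte_fin lt_def an -lee_fin.
Qed.

End LuxemburgHoelder.

(** * The sparse estimate under a bump condition *)

Section BumpSparse.
Variable R : realType.
Local Notation mu := (@lebesgue_measure R).
Local Notation len := (@dyadic_length R).
Local Notation dset := (@dyadic_set R).

Definition gauge_tail_const (B : R -> R) (c0 p : R) : R :=
  2 `^ p * 2 `^ (p + 1) * fine (nnint (tail_density B c0 p)).

Lemma gauge_tail_const_ge0 B c0 p : young_function B -> 0 <= gauge_tail_const B c0 p.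
Proof.
move=> yB; rewrite !mulr_ge0 ?powR_ge0// fine_ge0// nnint_ge0//.
exact: tail_density_ge0.
Qed.

(** The term at level 1 of the sum in [conjugate_tail_sum]. *)
Lemma conjugate_tail_le_pow (B : R -> R) (c0 p x : R) : young_function B -> 0 < c0 ->
  1 < p -> (nnint (tail_density B c0 p) < +oo)%E -> 0 <= x ->
  conjugate_tail B c0 (2 * x) <= gauge_tail_const B c0 p * x `^ p.
Proof.
move=> yB c00 p1 fin x0.
apply: le_trans (conjugate_tail_sum yB c00 p1 1 fin x0).
have -> : iota 0 1.*2 = [:: 0%N; 1%N] by [].
rewrite !big_cons big_nil addr0 [level R 1 1](_ : _ = 1); last first.
  by rewrite /level subrr expr0z.
by rewrite powR1 mul1r divr1 lerDr mulr_ge0 ?powR_ge0// conjugate_tail_ge0.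
Qed.

Lemma sub_dyadic_lty (E : set R) I : measurable E -> E `<=` dset I -> (mu E < +oo)%E.
Proof.
move=> mE EI; apply: (@le_lt_trans _ _ (mu (dset I))); last by rewrite lebesgue_dyadic_set ltry.
by apply: le_measure; rewrite ?inE//; exact: measurable_dyadic_set.
Qed.

Lemma tail_gauge_ge0 (B F : R -> R) (c0 p : R) I : young_function B -> 0 < c0 -> 1 < p ->
  (nnint (tail_density B c0 p) < +oo)%E -> measurable_fun setT F -> (forall x, 0 <= F x) ->
  (nnint (fun x => F x `^ p)%R < +oo)%E -> 0 <= gauge (conjugate_tail B c0) F I.
Proof.
move=> yB c00 p1 fin mF F0 Ffin.
exact: (gauge_ge0 (lt_trans ltr01 p1) (gauge_tail_const_ge0 c0 p yB)
  (measurable_conjugate_tail yB c0) (conjugate_tail_ge0 yB c0)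
  (fun x => conjugate_tail_le_pow yB c00 p1 fin) mF F0 Ffin).
Qed.

Lemma gauge_embedding (B F : R -> R) (c0 p : R) (S : seq (dyadic * set R)) :
  young_function B -> 0 < c0 -> 1 < p -> (nnint (tail_density B c0 p) < +oo)%E ->
  measurable_fun setT F -> (forall x, 0 <= F x) ->
  (nnint (fun x => F x `^ p)%R < +oo)%E -> sparse_family S ->
  (forall x, \sum_(q <- S) \1_(q.2) x <= 1 :> R) ->
  \sum_(q <- S) gauge (conjugate_tail B c0) F q.1 `^ p * fine (mu q.2)
    <= 2 `^ p * gauge_tail_const B c0 p * fine (nnint (fun x => F x `^ p)%R).
Proof.
move=> yB c00 p1 fin mF F0 Ffin S1 S2.
have p0 : 0 < p by exact: lt_trans p1.
have mPs := measurable_conjugate_tail yB c0.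
have Ps0 := conjugate_tail_ge0 yB c0.
have -> : \sum_(q <- S) gauge (conjugate_tail B c0) F q.1 `^ p * fine (mu q.2) =
    \sum_(q <- S) fine ((gauge (conjugate_tail B c0) F q.1 `^ p)%:E * mu q.2)%E.
  rewrite big_seq [RHS]big_seq; apply: eq_bigr => q /S1[mE EQ _].
  by rewrite fineM// ge0_fin_numE// (sub_dyadic_lty mE EQ).
apply: (proj1 (fine_sum_le _ _)) => [q|].
  by rewrite mule_ge0 ?lee_fin ?powR_ge0.
rewrite EFinM nnint_fin//; last by move=> x; exact: powR_ge0.
have := @maximal_theorem R (cst 1) F (conjugate_tail B c0) p (gauge_tail_const B c0 p)
  p0 _ _ mF F0 mPs Ps0 _ S (gauge (conjugate_tail B c0) F) _ S2.
rewrite (_ : (fun x => F x `^ p * cst 1 x) = (fun x => F x `^ p)); last first.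
  by apply/funext => x; rewrite mulr1.
move=> H; apply: le_trans (H _ _ _ _ _ _).
- rewrite big_seq [leRHS]big_seq; apply: lee_sum => q /S1[mE _ _].
  by rewrite nnint_indic.
- exact: measurable_cst.
- by move=> x; exact: ler01.
- by move=> m x; exact: conjugate_tail_sum.
- by move=> q /S1[].
- by move=> I; exact: (tail_gauge_ge0 I yB c00 p1 fin mF F0 Ffin).
move=> q l _ l0 lN.
rewrite nnint_indic ?lebesgue_dyadic_set; last exact: measurable_dyadic_set.
apply: le_trans (gauge_level l0 lN) _.
apply: le_of_eq.
by apply: eq_nnint => x; rewrite mulr1.
Qed.

(** The gauge need not be admissible, in particular when it is 0; admissible values
    close to it suffice. *)
Lemma gauge_hoelder (B : R -> R) (c0 p : R) (f F : R -> R) (G : R -> \bar R) I (l : R) :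
  young_function B -> 0 < c0 -> 1 < p -> (nnint (tail_density B c0 p) < +oo)%E ->
  measurable_fun setT f -> (forall x, 0 <= f x) -> (nnint_on (dset I) f < +oo)%E ->
  measurable_fun setT F -> (forall x, 0 <= F x) ->
  (nnint (fun x => F x `^ p)%R < +oo)%E ->
  measurable_fun setT G -> (forall x, 0 <= G x)%E ->
  (forall x, (f x)%:E <= (F x)%:E * G x \/ G x = +oo)%E -> 0 < l ->
  (average (dset I) (fun x => er_map B (`|G x| * l^-1%:E)) <= 1)%E ->
  fine (nnint_on (dset I) f) <=
    gauge (conjugate_tail B c0) F I * ((2 + conjugate B c0) * len I) * l.
Proof.
move=> yB c00 p1 fin mf f0 ffin mF F0 Ffin mG G0 fFG l0 lux.
have p0 : 0 < p by exact: lt_trans p1.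
have k0 : 0 < l * ((2 + conjugate B c0) * len I).
  by rewrite !mulr_gt0 ?dyadic_length_gt0// ltr_wpDr// conjugate_ge0.
apply/ler_addgt0Pr => e e0.
have D0 := gauge_tail_const_ge0 c0 p yB.
have PsD x : 0 <= x -> conjugate_tail B c0 (2 * x) <= gauge_tail_const B c0 p * x `^ p.
  exact: conjugate_tail_le_pow.
have mPs := measurable_conjugate_tail yB c0.
have Ps0 := conjugate_tail_ge0 yB c0.
have [N hN Nlt] := gauge_admissible p0 D0 mPs Ps0 PsD mF F0 Ffin I (divr_gt0 e0 k0).
have := young_hoelder yB c00 l0 mf f0 mF F0 mG G0 fFG lux hN.
rewrite -nnint_on_fin// lee_fin => /le_trans; apply.
have -> : N * l * ((2 + conjugate B c0) * len I) = N * (l * ((2 + conjugate B c0) * len I)).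
  by rewrite -mulrA.
have -> : gauge (conjugate_tail B c0) F I * ((2 + conjugate B c0) * len I) * l + e =
   (gauge (conjugate_tail B c0) F I + e / (l * ((2 + conjugate B c0) * len I))) *
   (l * ((2 + conjugate B c0) * len I)).
  by rewrite [RHS]mulrDl divfK ?gt_eqF//; congr (_ + _); ring.
by rewrite ler_pM2r// ltW.
Qed.

Lemma Bp_tail (B : R -> R) (p : R) : young_function B -> Bp p (associate B) ->
  exists2 c0, 0 < c0 & (nnint (tail_density B c0 p) < +oo)%E.
Proof.
by move=> yB [c [c0 h]]; exists c => //; rewrite nnint_tail_density.
Qed.

(** The second case is that of a zero of v, at which v^(-1/p) is infinite and f is
    not controlled. *)
Lemma bump_factor_v (p : R) (f v : R -> R) x : 0 < p -> 0 <= v x ->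
  ((`|f x|)%:E <= (`|f x| * v x `^ p^-1)%:E * epow (v x) (- p^-1) \/
   epow (v x) (- p^-1) = +oo)%E.
Proof.
move=> p0 v0; rewrite /epow oppr_lt0 invr_gt0 p0 andbT.
case: eqVneq => [_|vx]; [by right|left].
rewrite -EFinM lee_fin -mulrA -powRD ?vx ?implybT// subrr powRr0 mulr1//.
Qed.

Lemma bump_factor_u (p : R) (gam u : R -> R) x : 1 < p -> 0 <= u x ->
  ((gam x * u x)%:E <= (gam x * u x `^ (conj_exponent p)^-1)%:E * epow (u x) p^-1 \/
   epow (u x) p^-1 = +oo)%E.
Proof.
move=> p1 u0; left; have p0 : 0 < p by exact: lt_trans p1.
rewrite /epow [_ < 0]ltNge invr_ge0 (ltW p0) andbF.
have e : (conj_exponent p)^-1 + p^-1 = 1 by rewrite addrC conj_exponentV.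
by rewrite -EFinM lee_fin -mulrA -powRD e ?oner_eq0// powRr1.
Qed.

Lemma bump_term_le (p r e l n1 n2 m1 m2 kA kB Kb : R) : 0 < p -> 0 < r ->
  p^-1 + r^-1 = 1 -> 0 < e -> 0 < l -> l <= 2 * e -> 0 <= n1 -> 0 <= n2 ->
  0 <= kA -> 0 <= kB -> 0 <= Kb ->
  m2 * m1 <= n2 * (kA * l) * (n1 * (kB * l)) * Kb ->
  m1 * m2 / l <= 2 * (kA * kB * Kb) * ((n1 `^ p * e) `^ p^-1 * (n2 `^ r * e) `^ r^-1).
Proof.
move=> p0 r0 pr e0 l0 lE n10 n20 kA0 kB0 Kb0 prod.
rewrite !powRM ?powR_ge0 ?(ltW e0)// -!powRrM !mulfV ?gt_eqF// !powRr1//.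
have -> : n1 * e `^ p^-1 * (n2 * e `^ r^-1) = n1 * n2 * e.
  rewrite mulrACA -powRD ?(gt_eqF e0) ?implybT// pr powRr1//.
  exact: ltW.
rewrite ler_pdivrMr// [leLHS]mulrC; apply: le_trans prod _.
have -> : n2 * (kA * l) * (n1 * (kB * l)) * Kb =
  (kA * kB * Kb * (n1 * n2) * l) * l by ring.
have -> : 2 * (kA * kB * Kb) * (n1 * n2 * e) * l =
  (kA * kB * Kb * (n1 * n2) * (2 * e)) * l by ring.
by rewrite ler_wpM2r ?(ltW l0)// ler_wpM2l// !mulr_ge0.
Qed.

(** By [gauge_hoelder] the integrals of |f| and gam u over an interval are bounded by
    the gauges of |f| v^(1/p) and gam u^(1/p') times the two Luxemburg norms, whose
    product the bump condition bounds.  The gauges are summed by [gauge_embedding]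
    with respect to Lebesgue measure. *)
Lemma bump_sparse_form_bound (p : R) (A B u v : R -> R) : 1 < p ->
  young_function A -> young_function B ->
  Bp (conj_exponent p) (associate A) -> Bp p (associate B) ->
  weight u -> weight v -> (bump_const p A B u v < +oo)%E ->
  exists K A1 A2, [/\ 0 <= K, 0 <= A1, 0 < A2 &
    forall f, dyadic_integrable f -> in_Lp p v f ->
      sparse_form_bound p u v f K A1 A2].
Proof.
move=> p1 yA yB bpA bpB wu wv bump.
have p0 : 0 < p by exact: lt_trans p1.
have r1 := conj_exponent_gt1 p1; set r := conj_exponent p in bpA r1 *.
have r0 : 0 < r by exact: lt_trans r1.
have [cA cA0 finA] := Bp_tail yA bpA.
have [cB cB0 finB] := Bp_tail yB bpB.
have u0 : forall x, 0 <= u x by case: wu.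
have v0 : forall x, 0 <= v x by case: wv.
have mu_ : measurable_fun setT u by case: wu => _ [].
have mv : measurable_fun setT v by case: wv => _ [].
pose Kb := fine (bump_const p A B u v).
pose kA := 2 + conjugate A cA; pose kB := 2 + conjugate B cB.
have kA0 : 0 < kA by rewrite ltr_wpDr// conjugate_ge0.
have kB0 : 0 < kB by rewrite ltr_wpDr// conjugate_ge0.
have lux0 (C : R -> R) Q G : (0 <= luxemburg C Q G)%E.
  by apply: le_ereal_inf_tmp => _ [l [l0 _] <-]; rewrite lee_fin ltW.
have bumpQ I : (luxemburg A (dset I) (fun x => epow (u x) p^-1) *
    luxemburg B (dset I) (fun x => epow (v x) (- p^-1)) <= bump_const p A B u v)%E.
  by apply: ereal_sup_ubound; exists (dset I) => //; exact: bounded_interval_dyadic_set.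
have bump0 : (0 <= bump_const p A B u v)%E.
  by apply: le_trans (bumpQ (0, 0)); exact: mule_ge0.
have KbE : Kb%:E = bump_const p A B u v by rewrite fineK// ge0_fin_numE.
have Kb0 : 0 <= Kb by exact: fine_ge0.
(* the last constant must be positive, hence the summand 1 *)
exists (2 * (kA * kB * Kb)), (2 `^ p * gauge_tail_const B cB p),
  (2 `^ r * gauge_tail_const A cA r + 1); split.
- by rewrite !mulr_ge0// ltW.
- by rewrite mulr_ge0 ?powR_ge0// gauge_tail_const_ge0.
- by rewrite ltr_wpDl// mulr_ge0 ?powR_ge0// gauge_tail_const_ge0.
move=> f fi [mf fLp] gam mgam gam0 gui gfin S S1 S2.
pose F x := `|f x| * v x `^ p^-1.
pose H x := gam x * u x `^ r^-1.
have F0 x : 0 <= F x by rewrite mulr_ge0// powR_ge0.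
have H0 x : 0 <= H x by rewrite mulr_ge0// powR_ge0.
have mF : measurable_fun setT F.
  by apply: measurable_funM; [exact: measurable_norm|exact: measurable_pow].
have mH : measurable_fun setT H.
  by apply: measurable_funM => //; exact: measurable_pow.
have FE : (fun x => F x `^ p) = (fun x => `|f x| `^ p * v x).
  apply/funext => x; rewrite /F powRM ?powR_ge0// -powRrM mulVf ?gt_eqF//.
  by rewrite powRr1.
have HE : (fun x => H x `^ r) = (fun x => gam x `^ r * u x).
  apply/funext => x; rewrite /H powRM ?powR_ge0// -powRrM mulVf ?gt_eqF//.
  by rewrite powRr1.
have Ffin : (nnint (fun x => F x `^ p)%R < +oo)%E.
  by rewrite FE; apply: lty_poweRy fLp; rewrite invr_neq0// gt_eqF.
have Hfin : (nnint (fun x => H x `^ r)%R < +oo)%E by rewrite HE.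
have X := gauge_embedding yB cB0 p1 finB mF F0 Ffin S1 S2.
have Y := gauge_embedding yA cA0 r1 finA mH H0 Hfin S1 S2.
rewrite FE in X; rewrite HE in Y.
pose N1 := gauge (conjugate_tail B cB) F; pose N2 := gauge (conjugate_tail A cA) H.
exists (fun q => N1 q.1 `^ p * fine (mu q.2)), (fun q => N2 q.1 `^ r * fine (mu q.2)).
split; [|exact: X|]; last first.
  apply: le_trans Y _; rewrite mulrDl mul1r lerDl fine_ge0// nnint_ge0// => x.
  by rewrite mulr_ge0// powR_ge0.
move=> q qS; clear X Y.
split; try by rewrite mulr_ge0 ?powR_ge0 ?fine_ge0.
have [mE EQ lE] := S1 q qS.
have md := @measurable_dyadic_set R q.1.
have l0 := dyadic_length_gt0 R q.1.
have muEfin := sub_dyadic_lty mE EQ.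
have muE : (fine (mu q.2))%:E = mu q.2 by rewrite fineK// ge0_fin_numE.
rewrite -muE -EFinM lee_fin in lE.
have e0 : 0 < fine (mu q.2).
  by move: (lt_le_trans l0 lE); rewrite pmulr_rgt0.
have N10 : 0 <= N1 q.1 by exact: tail_gauge_ge0 yB cB0 p1 finB mF F0 Ffin.
have N20 : 0 <= N2 q.1 by exact: tail_gauge_ge0 yA cA0 r1 finA mH H0 Hfin.
have prod : cell_mass (fun x => gam x * u x) q.1 * cell_mass f q.1 <=
   (N2 q.1 * (kA * len q.1)) * (N1 q.1 * (kB * len q.1)) * Kb.
  apply: (le_inf_product
    (SA := [set l | 0 < l /\ (average (dset q.1)
       (fun x => er_map A (`|epow (u x) p^-1| * l^-1%:E)) <= 1)%E])
    (SB := [set l | 0 < l /\ (average (dset q.1)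
       (fun x => er_map B (`|epow (v x) (- p^-1)%R| * l^-1%:E)) <= 1)%E])) => //.
  - exact: (mulr_ge0 N20 (mulr_ge0 (ltW kA0) (ltW l0))).
  - exact: (mulr_ge0 N10 (mulr_ge0 (ltW kB0) (ltW l0))).
  - by rewrite fine_ge0// nnint_on_ge0.
  - by rewrite fine_ge0// nnint_on_ge0.
  - by move=> l [].
  - by move=> l [].
  - move=> l [lp lux].
    have [mgu /(_ q.1) gufin] := gui.
    have gu0 x : 0 <= gam x * u x by rewrite mulr_ge0.
    rewrite /cell_mass; under [X in nnint_on _ X]eq_fun do rewrite ger0_norm//.
    move: gufin; under [X in nnint_on _ X]eq_fun do rewrite ger0_norm//.
    move=> gufin; apply: (gauge_hoelder yA cA0 r1 finA _ _ _ _ _ _ _ _ _ lp lux) => //.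
    + exact: measurable_epow.
    + by move=> x; exact: epow_ge0.
    + by move=> x; exact: bump_factor_u.
  - move=> l [lp lux]; have [_ /(_ q.1) ffin] := fi.
    apply: (gauge_hoelder yB cB0 p1 finB _ _ _ _ _ _ _ _ _ lp lux) => //.
    + exact: measurable_norm.
    + exact: measurable_epow.
    + by move=> x; exact: epow_ge0.
    + by move=> x; exact: bump_factor_v.
  rewrite KbE; exact: bumpQ.
exact: (bump_term_le p0 r0 (conj_exponentV p1) e0 l0 lE N10 N20 (ltW kA0) (ltW kB0) Kb0 prod).
Qed.

End BumpSparse.

(** * Weighted Lebesgue spaces *)

Lemma inv_pow2_small (R : realType) (e : R) : 0 < e -> exists n, 2^-1 ^+ n < e.
Proof.
move=> e0; have : (fun n => 2^-1 ^+ n : R) @ \oo --> (0 : R).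
  by apply: cvg_expr; rewrite ger0_norm ?invr_ge0// invf_lt1// ltr1n.
move=> /cvgr0Pnorm_lt/(_ _ e0)[N _ /(_ N)] /=; rewrite leqnn => /(_ isT).
by rewrite ger0_norm ?exprn_ge0 ?invr_ge0// => h; exists N.
Qed.

Lemma le_of_geometric_error (R : realType) (a : \bar R) (b c : R) : (forall n, a <= (b + c * 2^-1 ^+ n)%:E)%E ->
  (a <= b%:E)%E.
Proof.
move=> h; apply/lee_addgt0Pr => e e0.
have c1 : 0 < `|c| + 1 by rewrite ltr_wpDl.
have [n hn] := inv_pow2_small (divr_gt0 e0 c1).
apply: le_trans (h n) _; rewrite -EFinD lee_fin lerD2l.
have q0 : 0 <= (2^-1 : R) ^+ n by rewrite exprn_ge0// invr_ge0.
apply: (@le_trans _ _ ((`|c| + 1) * 2^-1 ^+ n)).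
  by rewrite ler_wpM2r// (le_trans (ler_norm c))// lerDl.
by rewrite mulrC -ler_pdivlMr// ltW.
Qed.

(** At 0 the power is continuous from the right only, hence the sign hypothesis. *)
Lemma cvg_powR (R : realType) (p : R) (u : nat -> R) (l : R) : 0 < p -> (forall n, 0 <= u n) ->
  0 <= l -> u @ \oo --> l -> (fun n => u n `^ p) @ \oo --> l `^ p.
Proof.
move=> p0 u0; rewrite le_eqVlt => /orP[/eqP<-|l0] ul.
  rewrite powR0 ?gt_eqF//; apply/cvgr0Pnorm_lt => e e0.
  have d0 : 0 < e `^ p^-1 by rewrite powR_gt0.
  move/cvgr0Pnorm_lt : ul => /(_ _ d0); apply: filterS => n.
  rewrite !ger0_norm ?powR_ge0// => h.
  have -> : e = (e `^ p^-1) `^ p by rewrite -powRrM mulVf ?gt_eqF// powRr1// ltW.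
  by apply: gt0_ltr_powR => //; rewrite nnegrE// powR_ge0.
apply: (cvg_comp u (fun y => y `^ p) ul).
have [dl _] := is_derive1_powR p l0.
exact: (differentiable_continuous (proj1 (derivable1_diffP _ _) dl)).
Qed.

Lemma nnint0 (R : realType) (h : R -> R) : (forall x, h x = 0) -> nnint h = 0%E.
Proof. by move=> h0; apply: integral0_eq => x _; rewrite h0. Qed.

Section WeightedNorm.
Variable R : realType.
Local Notation mu := (@lebesgue_measure R).
Variables (p : R) (w : R -> R).
Hypotheses (p0 : 0 < p) (mw : measurable_fun setT w) (w0 : forall x, 0 <= w x).
Implicit Types f g h : R -> R.

Lemma weighted_pow_ge0 f x : 0 <= `|f x| `^ p * w x.
Proof. by rewrite mulr_ge0// powR_ge0. Qed.

Lemma measurable_weighted_pow f : measurable_fun setT f ->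
  measurable_fun setT (fun x => `|f x| `^ p * w x).
Proof.
move=> mf; apply: measurable_funM => //; apply: measurable_pow.
exact: measurable_norm.
Qed.

Lemma Lp_normE f : Lp_norm p w f = (nnint (fun x => `|f x| `^ p * w x)%R `^ p^-1)%E.
Proof. by []. Qed.

Lemma Lp_norm0 f : (forall x, f x = 0) -> Lp_norm p w f = 0%E.
Proof.
move=> f0; rewrite Lp_normE nnint0 ?poweR0r ?invr_neq0 ?gt_eqF// => x.
by rewrite f0 normr0 powR0 ?gt_eqF// mul0r.
Qed.

Lemma Lp_norm_ge0 f : (0 <= Lp_norm p w f)%E.
Proof. exact: poweR_ge0. Qed.

Lemma le_Lp_norm f (c : \bar R) : (0 <= c)%E ->
  (Lp_norm p w f <= c)%E <-> (nnint (fun x => `|f x| `^ p * w x)%R <= c `^ p)%E.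
Proof.
move=> c0; rewrite Lp_normE; set N := nnint _.
have N0 : (0 <= N)%E by apply: nnint_ge0 => x; exact: weighted_pow_ge0.
split=> h.
- have -> : N = ((N `^ p^-1) `^ p)%E by rewrite -poweRrM mulVf ?gt_eqF// poweRe1.
  by apply: gt0_ler_poweR; rewrite ?(ltW p0)// in_itv/= leey andbT// poweR_ge0.
have -> : c = ((c `^ p) `^ p^-1)%E by rewrite -poweRrM mulfV ?gt_eqF// poweRe1.
by apply: gt0_ler_poweR; rewrite ?invr_ge0 ?(ltW p0)// in_itv/= leey andbT// poweR_ge0.
Qed.

(** Absorbing the weight into f gives access to Minkowski's inequality. *)
Lemma Lp_norm_Lnorm f :
  Lp_norm p w f = Lnorm mu p%:E (EFin \o (fun x => f x * w x `^ p^-1)).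
Proof.
rewrite Lnorm_nnint Lp_normE; congr (_ `^ _)%E; apply: eq_nnint => x.
by rewrite normrM (ger0_norm (powR_ge0 _ _)) powRM ?powR_ge0// -powRrM mulVf ?gt_eqF// powRr1.
Qed.

Let mroot f : measurable_fun setT f ->
  measurable_fun setT (fun x => f x * w x `^ p^-1).
Proof. by move=> mf; apply: measurable_funM => //; exact: measurable_pow. Qed.

Lemma le_Lp_normD f g : 1 <= p -> measurable_fun setT f -> measurable_fun setT g ->
  (Lp_norm p w (fun x => f x + g x)%R <= Lp_norm p w f + Lp_norm p w g)%E.
Proof.
move=> p1 mf mg; rewrite !Lp_norm_Lnorm.
have := @minkowski_EFin _ _ R mu _ _ p (mroot mf) (mroot mg) p1.
apply: le_trans; apply: le_of_eq; congr Lnorm.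
by apply/funext => x /=; rewrite mulrDl.
Qed.

Lemma eq_Lp_norm f g : (forall x, `|f x| = `|g x|) -> Lp_norm p w f = Lp_norm p w g.
Proof. by move=> fg; rewrite !Lp_normE; congr (_ `^ _)%E; apply: eq_nnint => x; rewrite fg. Qed.

Lemma Lp_normC f g : Lp_norm p w (fun x => f x - g x)%R = Lp_norm p w (fun x => g x - f x)%R.
Proof. by apply: eq_Lp_norm => x; rewrite distrC. Qed.

Lemma le_Lp_norm_via f g h : 1 <= p -> measurable_fun setT f -> measurable_fun setT g ->
  measurable_fun setT h -> (Lp_norm p w (fun x => f x - h x)%R <=
    Lp_norm p w (fun x => f x - g x)%R + Lp_norm p w (fun x => g x - h x)%R)%E.
Proof.
move=> p1 mf mg mh.
have -> : (fun x => f x - h x) = (fun x => (f x - g x) + (g x - h x)).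
  by apply/funext => x; rewrite addrA subrK.
by apply: le_Lp_normD => //; exact: measurable_funB.
Qed.

Lemma Lp_norm_ae_eq f g : measurable_fun setT f -> measurable_fun setT g ->
  ae_eq_weight w f g -> Lp_norm p w f = Lp_norm p w g.
Proof.
move=> mf mg fg; rewrite !Lp_normE; congr (_ `^ _)%E.
apply: ae_eq_nnint; try exact: measurable_weighted_pow.
apply: ae_imp fg => x h; have [->|wx] := eqVneq (w x) 0; first by rewrite !mulr0.
by rewrite h.
Qed.

Lemma Lp_norm_eq0 f g : measurable_fun setT f -> measurable_fun setT g ->
  Lp_norm p w (fun x => f x - g x)%R = 0%E -> ae_eq_weight w f g.
Proof.
move=> mf mg; rewrite Lp_normE => h.
have : nnint (fun x => `|f x - g x| `^ p * w x)%R = 0%E.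
  by apply: poweR_eq0_eq0 h; apply: nnint_ge0 => x; exact: (weighted_pow_ge0 (fun x => f x - g x)).
move=> /nnint_eq0 H.
have {}H := H (measurable_weighted_pow (measurable_funB mf mg))
  (weighted_pow_ge0 (fun x => f x - g x)).
apply: ae_imp H => x /eqP; rewrite mulf_eq0 => /orP[|/eqP->]; last by rewrite eqxx.
by rewrite powR_eq0 normr_eq0 subr_eq0 => /andP[/eqP].
Qed.

Lemma limn_einf_le (a : (\bar R)^nat) (B : \bar R) : (forall n, a n <= B)%E ->
  (limn_einf a <= B)%E.
Proof.
move=> aB; rewrite limn_einf_lim; apply: lime_le; first exact: is_cvg_einfs.
by apply: nearW => n; apply: le_trans (aB n); apply: ereal_inf_lbound; exists n => /=.
Qed.

Lemma measurable_limn_einf (h : (R -> \bar R)^nat) :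
  (forall n, measurable_fun setT (h n)) ->
  measurable_fun setT (fun x => limn_einf (h^~ x)).
Proof.
move=> mh.
have -> : (fun x => limn_einf (h^~ x)) = (fun x => - limn_esup (fun n => - h n x))%E.
  by apply/funext => x; rewrite (limn_esupN (h^~ x)) oppeK.
apply: measurableT_comp => //; apply: measurable_fun_limn_esup => n.
exact: measurableT_comp.
Qed.

Lemma nnint_fatou (h : nat -> R -> R) (k : R -> R) (B : \bar R) :
  (forall n, measurable_fun setT (h n)) -> (forall n x, 0 <= h n x) ->
  measurable_fun setT k -> (forall x, 0 <= k x) ->
  {ae mu, forall x, h^~ x @ \oo --> k x} ->
  (forall n, nnint (h n) <= B)%E -> (nnint k <= B)%E.
Proof.
move=> mh h0 mk k0 hk hB.
have mhE n : measurable_fun setT (fun x => (h n x)%:E) by exact: measurable_EFinT.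
have -> : nnint k = (\int[mu]_x limn_einf (fun n => (h n x)%:E))%E.
  apply: ae_eq_integral => //; first exact: measurable_EFinT.
    exact: measurable_limn_einf.
  apply: ae_imp hk => x hx _.
  have : (fun n => (h n x)%:E) @ \oo --> (k x)%:E by apply: cvg_EFin; [exact: nearW|].
  by move=> /cvg_limn_einf_sup[->].
apply: le_trans (fatou mu measurableT mhE _) _.
  by move=> n x _; rewrite lee_fin.
exact: limn_einf_le.
Qed.

Lemma Lp_fatou (g_ : nat -> R -> R) (g : R -> R) (B : \bar R) : (0 <= B)%E ->
  (forall n, measurable_fun setT (g_ n)) -> measurable_fun setT g ->
  {ae mu, forall x, w x != 0 -> g_^~ x @ \oo --> g x} ->
  (forall n, Lp_norm p w (g_ n) <= B)%E -> (Lp_norm p w g <= B)%E.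
Proof.
move=> B0 mg_ mg gg gB; apply/le_Lp_norm => //.
apply: (@nnint_fatou (fun n x => `|g_ n x| `^ p * w x)).
- by move=> n; exact: measurable_weighted_pow.
- by move=> n x; exact: weighted_pow_ge0.
- exact: measurable_weighted_pow.
- by move=> x; exact: weighted_pow_ge0.
- apply: ae_imp gg => x h; have [wx|wx] := eqVneq (w x) 0.
    by rewrite wx mulr0; under eq_fun do rewrite mulr0; exact: cvg_cst.
  apply: cvgM; last exact: cvg_cst.
  have c : `|g_ n x| @[n --> \oo] --> `|g x| by apply: cvg_norm; exact: h.
  exact: cvg_powR c.
by move=> n; apply/le_Lp_norm.
Qed.

(** By Fatou's lemma the lower limit of the sequence has a finite integral, so it is
    finite almost everywhere; by monotonicity it bounds the sequence. *)
Lemma ae_bounded (h : nat -> R -> R) (B : R) :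
  (forall n, measurable_fun setT (h n)) -> (forall n x, 0 <= h n x) ->
  (forall x, {homo h^~ x : m n / (m <= n)%N >-> m <= n}) ->
  (forall n, nnint (h n) <= B%:E)%E ->
  {ae mu, forall x, exists M, forall n, h n x <= M}.
Proof.
move=> mh h0 hn hB.
have mhE n : measurable_fun setT (fun x => (h n x)%:E) by exact: measurable_EFinT.
pose k x := limn_einf (fun n => (h n x)%:E).
have hk n x : ((h n x)%:E <= k x)%E.
  rewrite /k limn_einf_lim.
  have /cvg_lim -> // := ereal_nondecreasing_cvgn (nondecreasing_einfs (fun n => (h n x)%:E)).
  apply: le_trans (ereal_sup_ubound (ex_intro2 _ _ n I erefl)).
  by apply: le_ereal_inf_tmp => _ [m /= nm <-]; rewrite lee_fin; exact: hn.
have k0 x : (0 <= k x)%E by apply: le_trans (hk 0%N x); rewrite lee_fin.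
have mk : measurable_fun setT k by exact: measurable_limn_einf.
have kB : (\int[mu]_x k x <= B%:E)%E.
  apply: le_trans (fatou mu measurableT mhE _) _; first by move=> n x _; rewrite lee_fin.
  exact: limn_einf_le.
have ik : mu.-integrable setT k.
  apply/integrableP; split => //.
  under eq_integral do rewrite gee0_abs//.
  exact: le_lt_trans kB (ltry _).
have := integrable_ae measurableT ik; apply: ae_imp => x /(_ I) kf.
by exists (fine (k x)) => n; rewrite -lee_fin fineK.
Qed.

Lemma partial_sum_homo (a : nat -> R) : (forall k, 0 <= a k) ->
  {homo (fun n => \sum_(0 <= k < n) a k) : m n / (m <= n)%N >-> m <= n}.
Proof.
by move=> a0 m n mn; rewrite (@big_cat_nat _ _ _ m 0 n)//= lerDl sumr_ge0.
Qed.

Lemma series_bounded_cvg (u : nat -> R) (M : R) :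
  (forall n, \sum_(0 <= k < n) `|u k.+1 - u k| <= M) -> cvgn u.
Proof.
move=> uM.
have c : cvgn (series (telescope u)).
  apply: normed_cvg; apply: nondecreasing_is_cvgn.
    by apply: partial_sum_homo => k; exact: normr_ge0.
  by exists M => _ [n _ <-]; exact: uM.
have -> : u = (fun n => u 0%N + series (telescope u) n).
  by apply/funext => n; exact: eq_sum_telescope.
by apply: is_cvgD => //; exact: is_cvg_cst.
Qed.

Lemma geometric_tail (c : R) (n : nat) (d : nat -> \bar R) :
  (d n <= 0)%E -> (forall k, d k.+1 <= d k + (c / 2 ^+ k)%:E)%E ->
  forall m, (d (n + m)%N <= (2 * c / 2 ^+ n - 2 * c / 2 ^+ (n + m))%:E)%E.
Proof.
move=> d0 dS; elim=> [|m IH]; first by rewrite addn0 subrr.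
rewrite addnS; apply: le_trans (dS _) _; apply: le_trans (leeD2r _ IH) _.
rewrite -EFinD lee_fin exprS; apply: le_of_eq.
rewrite -addrA; congr (_ + _).
have : (2 : R) ^+ (n + m) != 0 by rewrite expf_neq0.
by move: (2 ^+ (n + m)) => y y0; field.
Qed.

Hypothesis p1 : 1 <= p.

(** By Minkowski's inequality the partial sums of |g_(n+1) - g_n| have bounded norms,
    so by [ae_bounded] the series converges absolutely almost everywhere off the
    zeros of w.  The rate follows from Fatou's lemma. *)
Lemma riesz_fischer (g_ : nat -> R -> R) (c : R) : 0 <= c ->
  (forall n, measurable_fun setT (g_ n)) ->
  (forall n, Lp_norm p w (fun x => g_ n.+1 x - g_ n x)%R <= (c / 2 ^+ n)%:E)%E ->
  exists g, [/\ measurable_fun setT g,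
    {ae mu, forall x, w x != 0 -> g_^~ x @ \oo --> g x} &
    forall n, (Lp_norm p w (fun x => g x - g_ n x)%R <= (2 * c / 2 ^+ n)%:E)%E].
Proof.
move=> c0 mg hg.
have md n m : measurable_fun setT (fun x => g_ n x - g_ m x) by exact: measurable_funB.
pose S n x := \sum_(0 <= k < n) `|g_ k.+1 x - g_ k x|.
have mS n : measurable_fun setT (S n).
  by apply: measurable_sum => k; exact: measurable_norm.
have S0 n x : 0 <= S n x by apply: sumr_ge0.
have NS n : (Lp_norm p w (S n) <= (2 * c)%:E)%E.
  have := @geometric_tail c 0 (fun k => Lp_norm p w (S k)) _ _ n; rewrite add0n expr0 divr1.
  move=> h; apply: le_trans (h _ _) _.
  - by rewrite Lp_norm0// => x; rewrite /S big_geq.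
  - move=> k; have -> : S k.+1 = (fun x => S k x + `|g_ k.+1 x - g_ k x|).
      by apply/funext => x; rewrite /S big_nat_recr.
    apply: le_trans (le_Lp_normD _ _ _) _ => //; first exact: measurable_norm.
    rewrite leeD2l// (le_trans _ (hg k))// (@eq_Lp_norm _ (fun x => g_ k.+1 x - g_ k x))//.
    by move=> x; rewrite normr_id.
  by rewrite lee_fin lerBlDr lerDl divr_ge0// mulr_ge0.
have N2 n m : (Lp_norm p w (fun x => g_ (n + m)%N x - g_ n x)%R <= (2 * c / 2 ^+ n)%:E)%E.
  have := @geometric_tail c n (fun k => Lp_norm p w (fun x => g_ k x - g_ n x)) _ _ m.
  move=> h; apply: le_trans (h _ _) _.
  - by rewrite Lp_norm0// => x; rewrite subrr.
  - move=> k; rewrite addeC; apply: le_trans (@le_Lp_norm_via _ (g_ k) _ _ _ _ _) _ => //.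
    by rewrite leeD2r.
  by rewrite lee_fin lerBlDr lerDl divr_ge0// mulr_ge0.
have hae : {ae mu, forall x, exists M, forall n, S n x `^ p * w x <= M}.
  apply: (@ae_bounded _ ((2 * c) `^ p)).
  - by move=> n; apply: measurable_funM => //; exact: measurable_pow.
  - by move=> n x; rewrite mulr_ge0 ?powR_ge0.
  - move=> x m n mn; rewrite ler_wpM2r//; apply: ge0_ler_powR; rewrite ?nnegrE ?(ltW p0)//.
    by apply: (partial_sum_homo (a := fun k => `|g_ k.+1 x - g_ k x|)) mn.
  move=> n; rewrite -poweR_EFin.
  have -> : nnint (fun x => S n x `^ p * w x)%R = nnint (fun x => `|S n x| `^ p * w x)%R.
    by apply: eq_nnint => x; rewrite ger0_norm.
  by apply/le_Lp_norm => //; rewrite lee_fin mulr_ge0.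
(* an upper limit is measurable even where the sequence diverges *)
pose g x := fine (limn_esup (fun n => (g_ n x)%:E)).
have mgg : measurable_fun setT g.
  apply: measurableT_comp; first exact: fine_measurable.
  by apply: measurable_fun_limn_esup => n; exact: measurable_EFinT.
have gg : {ae mu, forall x, w x != 0 -> g_^~ x @ \oo --> g x}.
  apply: ae_imp hae => x [M hM] wx.
  have wp : 0 < w x by rewrite lt_neqAle eq_sym wx w0.
  have cg : cvgn (g_^~ x).
    apply: (@series_bounded_cvg _ ((M / w x) `^ p^-1)) => n; rewrite -/(S n x).
    have -> : S n x = (S n x `^ p) `^ p^-1 by rewrite -powRrM mulfV ?gt_eqF// powRr1.
    have M0 : 0 <= M by apply: le_trans (hM 0%N); rewrite mulr_ge0 ?powR_ge0.
    apply: ge0_ler_powR; rewrite ?nnegrE ?invr_ge0 ?powR_ge0 ?divr_ge0 ?(ltW p0)//.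
    by rewrite ler_pdivlMr.
  have -> // : g x = limn (g_^~ x).
  rewrite /g; have : (fun n => (g_ n x)%:E) @ \oo --> (limn (g_^~ x))%:E.
    by apply: cvg_EFin; [exact: nearW|exact: cg].
  by move=> /cvg_limn_einf_sup[_ ->].
exists g; split => // n.
apply: (@Lp_fatou (fun m x => g_ (n + m)%N x - g_ n x)) => //.
- by rewrite lee_fin divr_ge0// mulr_ge0.
- exact: measurable_funB.
apply: ae_imp gg => x h wx; apply: cvgB; last exact: cvg_cst.
have := h wx; rewrite -(cvg_shiftn n (g_^~ x)) /=.
by under eq_fun do rewrite addnC.
Qed.

(** By [riesz_fischer] the sequence has an almost everywhere limit, whose distance to
    k is 0. *)
Lemma fast_cvg_ae (h_ : nat -> R -> R) (k : R -> R) (c : R) : 0 <= c ->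
  (forall n, measurable_fun setT (h_ n)) -> measurable_fun setT k ->
  (forall n, Lp_norm p w (fun x => h_ n x - k x)%R <= (c * 2^-1 ^+ n)%:E)%E ->
  {ae mu, forall x, w x != 0 -> h_^~ x @ \oo --> k x}.
Proof.
move=> c0 mh mk hk.
have via := le_Lp_norm_via p1.
have [|||g [mg gcv hg]] := @riesz_fischer h_ (2 * c).
- by rewrite mulr_ge0.
- exact: mh.
- move=> n; apply: le_trans (via _ k _ _ _ _) _ => //.
  rewrite (Lp_normC k); apply: le_trans (leeD (hk _) (hk _)) _.
  rewrite -EFinD lee_fin exprS exprVn.
  have : 0 <= c / 2 ^+ n by rewrite divr_ge0// exprn_ge0.
  by rewrite (mulrCA c) -mulrA; move: (c / _) => y; lra.
have gk : Lp_norm p w (fun x => g x - k x)%R = 0%E.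
  apply/eqP; rewrite eq_le Lp_norm_ge0 andbT.
  apply: (@le_of_geometric_error _ _ 0 (5 * c)) => n; rewrite add0r.
  apply: le_trans (via _ (h_ n) _ _ _ _) _ => //.
  apply: le_trans (leeD (hg _) (hk _)) _.
  by rewrite -EFinD lee_fin exprVn -!mulrA; move: (c / _) => y; lra.
have := Lp_norm_eq0 mg mk gk.
move=> gke; apply: ae_imp (ae_and gcv gke) => x [h1 h2] wx.
by rewrite -h2//; exact: h1.
Qed.

End WeightedNorm.

(** * The multiplier on square integrable functions *)

Section SquareIntegrable.
Variable R : realType.
Local Notation mu := (@lebesgue_measure R).
Local Notation len := (@dyadic_length R).
Local Notation dset := (@dyadic_set R).
Implicit Types f g : R -> R.

Local Notation norm2 := (Lp_norm 2 (@cst R R 1)).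

Let two0 : (0 : R) < 2. Proof. by []. Qed.
Let m1 : measurable_fun setT (@cst R R 1). Proof. exact: measurable_cst. Qed.
Let c10 (x : R) : 0 <= @cst R R 1 x. Proof. exact: ler01. Qed.

Lemma Lnorm2E f : Lnorm mu 2%:E (EFin \o f) = norm2 f.
Proof.
rewrite (Lp_norm_Lnorm two0 c10); congr Lnorm; apply/funext => x /=.
by rewrite powR1 mulr1.
Qed.

Lemma in_L2P f : in_L2 f <-> in_Lp 2 (cst 1) f.
Proof.
rewrite /in_Lp -Lnorm2E; split=> [|[mf ff]].
  by move=> /andP[]; rewrite !inE.
by apply/andP; rewrite !inE.
Qed.

Lemma weighted_sqr f : nnint (fun x => `|f x| `^ 2 * @cst R R 1 x)%R = nnint (fun x => f x ^+ 2)%R.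
Proof. by apply: eq_nnint => x; rewrite mulr1 powR_mulrn// real_normK// num_real. Qed.

Lemma norm2_le f (c : R) : 0 <= c ->
  (norm2 f <= c%:E)%E <-> (nnint (fun x => f x ^+ 2)%R <= (c ^+ 2)%:E)%E.
Proof.
move=> c0; rewrite le_Lp_norm// weighted_sqr poweR_EFin.
by rewrite powR_mulrn.
Qed.

Lemma norm2_lty f : (norm2 f < +oo)%E -> (nnint (fun x => f x ^+ 2)%R < +oo)%E.
Proof.
move=> ff; have [c c0 fc] : exists2 c : R, 0 <= c & norm2 f = c%:E.
  exists (fine (norm2 f)); rewrite ?fine_ge0 ?Lp_norm_ge0// fineK//.
  by rewrite ge0_fin_numE// Lp_norm_ge0.
apply: (@le_lt_trans _ _ (c ^+ 2)%:E); last exact: ltry.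
by apply/norm2_le => //; rewrite fc.
Qed.

Lemma measurable_sqr f : measurable_fun setT f -> measurable_fun setT (fun x => f x ^+ 2).
Proof. by move=> mf; apply: measurable_funX. Qed.

Lemma sqr_dyadic_integrable f : in_L2 f -> dyadic_integrable (fun x => f x ^+ 2).
Proof.
move=> /in_L2P[mf /norm2_lty ff]; split=> [|I]; first exact: measurable_sqr.
apply: le_lt_trans ff; apply: le_trans (le_nnint_on_nnint _ _ _) _ => //.
- exact: measurable_dyadic_set.
- by apply: measurable_norm; exact: measurable_sqr.
by apply: le_nnint => //; [apply: measurable_norm; exact: measurable_sqr|exact: measurable_sqr|
  move=> x; rewrite ger0_norm// sqr_ge0].
Qed.

Lemma in_L2_dyadic_integrable f : in_L2 f -> dyadic_integrable f.
Proof.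
move=> f2; have [_ sI] := sqr_dyadic_integrable f2.
have /in_L2P[mf _] := f2; split=> // I.
have mI := @measurable_dyadic_set R I.
apply: (@le_lt_trans _ _ (nnint_on (dset I) (cst 1%R) + nnint_on (dset I) (fun x => `|f x ^+ 2|)%R)%E).
  rewrite -nnint_onD//; last by apply: measurable_norm; exact: measurable_sqr.
  apply: le_nnint_on => //.
  - exact: measurable_norm.
  - by apply: measurable_funD => //; apply: measurable_norm; exact: measurable_sqr.
  move=> x; rewrite normrX /=; have := sqr_ge0 (`|f x| - 1); have := normr_ge0 (f x).
  by move: `|f x| => y; nra.
by rewrite nnint_indic// lebesgue_dyadic_set lte_add_pinfty// ltry.
Qed.

(** The Cauchy-Schwarz inequality on I. *)
Lemma cell_integral_sqr_le f I : in_L2 f ->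
  cell_integral f I ^+ 2 / len I <= cell_mass (fun x => f x ^+ 2) I.
Proof.
move=> f2; have fi := in_L2_dyadic_integrable f2; have si := sqr_dyadic_integrable f2.
have [mf _] := fi.
have l0 : 0 < len I by exact: dyadic_length_gt0.
rewrite ler_pdivrMr//.
apply: (@le_trans _ _ (cell_mass f I ^+ 2)).
  rewrite -[leLHS]real_normK ?num_real// ler_sqr ?nnegrE//; last exact: fine_ge0 (nnint_on_ge0 _ _).
  exact: cell_integral_le_mass.
have mI := @measurable_dyadic_set R I.
have := @nnint_on_hoelder R (dset I) (fun x => `|f x ^+ 2|) (cst 1) 2 2 mI two0 two0.
have -> : (2^-1 : R) + 2^-1 = 1 by field.
move=> /(_ erefl (measurable_norm (measurable_sqr mf)) m1 (fun x => normr_ge0 _) c10).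
rewrite nnint_indic// lebesgue_dyadic_set -(cell_massE _ si).
have -> : nnint_on (dset I) (fun x => `|f x ^+ 2| `^ 2^-1 * cst 1 x `^ 2^-1)%R =
    nnint_on (dset I) (fun x => `|f x|)%R.
  apply: eq_nnint => x; congr (_ * _); rewrite /= powR1 mulr1 normrX -powR_mulrn//.
  by rewrite -powRrM mulfV// powRr1.
rewrite -(cell_massE _ fi) !poweR_EFin -EFinM lee_fin => h.
have cs0 : 0 <= cell_mass (fun x => f x ^+ 2) I.
  by apply: le_trans (cell_integral_le_mass I si).
have c0 : 0 <= cell_mass f I by apply: le_trans (cell_integral_le_mass I fi).
have h2 : cell_mass f I ^+ 2 <= (cell_mass (fun x => f x ^+ 2) I `^ 2^-1 * len I `^ 2^-1) ^+ 2.
  by rewrite ler_sqr ?nnegrE// mulr_ge0// powR_ge0.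
apply: le_trans h2 _; rewrite exprMn -!powR_mulrn ?powR_ge0// -!powRrM mulVf// !powRr1//.
exact: ltW.
Qed.

(** The energy F^2 / |I| of f is at most the integral of f^2 over I, so [tree_energy]
    applies to the two trees that hold the family. *)
Lemma haar_bessel f (F : {fset (int * int)}) : in_L2 f ->
  \sum_(I <- F) inner f (haar I) ^+ 2 <= fine (nnint (fun x => f x ^+ 2)%R).
Proof.
move=> f2; have fi := in_L2_dyadic_integrable f2; have si := sqr_dyadic_integrable f2.
have /in_L2P[mf /norm2_lty ff] := f2.
have [k [n FT]] := finite_sub_two_trees F.
have T m := tree_energy n (k, m) (cell_integral_additive fi)
  (fun I => cell_integral_sqr_le I f2) (cell_mass_additive si).
pose h I := haar_gap (cell_integral f) I ^+ 2 / len I.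
have h0 I : 0 <= h I by rewrite divr_ge0 ?sqr_ge0// dyadic_length_ge0.
rewrite (eq_bigr h); last by move=> I _; exact: inner_haar_sqr.
apply: le_trans (sum_uniq_sub_le (fset_uniq F) FT h0) _.
rewrite big_cat/=; apply: le_trans (lerD (T 0) (T (-1))) _.
rewrite -lee_fin EFinD !cell_massE// nnint_fin//; last by move=> x; exact: sqr_ge0.
have ma I : measurable_fun setT (fun x => \1_(dset I) x * `|f x ^+ 2|).
  apply: measurable_indicM; first exact: measurable_dyadic_set.
  by apply: measurable_norm; exact: measurable_sqr.
rewrite -nnintD//; try by move=> x; exact: indicM_ge0.
apply: le_nnint => [|||x].
- exact: measurable_funD.
- exact: measurable_sqr.
- by move=> x; rewrite addr_ge0// indicM_ge0.
rewrite -mulrDl ger0_norm ?sqr_ge0// ler_piMl ?sqr_ge0// !indicE.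
have [/set_mem x1|] := boolP (x \in dset (k, 0)); last by rewrite add0r lern1 leq_b1.
have [/set_mem x2|] := boolP (x \in dset (k, -1)); last by rewrite addr0.
exfalso; move: x1 x2; rewrite !mem_dyadic_set => /andP[x0 _] /andP[_ x1].
by move: (le_lt_trans x0 x1); rewrite /= !mul0r ltxx.
Qed.

Lemma in_LpB (p : R) (w f g : R -> R) : 1 <= p -> measurable_fun setT w ->
  (forall x, 0 <= w x) -> in_Lp p w f -> in_Lp p w g -> in_Lp p w (fun x => f x - g x).
Proof.
move=> p1 mw w0 [mf ff] [mg gf]; have p0 : 0 < p by exact: lt_le_trans p1.
split; first exact: measurable_funB.
apply: le_lt_trans (le_Lp_normD p0 mw w0 p1 mf (measurableT_comp (@oppr_measurable R setT) mg)) _.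
have -> : Lp_norm p w (-%R \o g) = Lp_norm p w g.
  by apply: eq_Lp_norm => x; rewrite /= normrN.
exact: lte_add_pinfty ff gf.
Qed.

Lemma L2_fast_cvg_ae (h_ : nat -> R -> R) (k : R -> R) :
  (forall n, measurable_fun setT (h_ n)) -> measurable_fun setT k ->
  (forall n, norm2 (fun x => h_ n x - k x)%R <= (2^-1 ^+ n)%:E)%E ->
  {ae mu, forall x, h_^~ x @ \oo --> k x}.
Proof.
move=> mh mk hk.
have hn n : (norm2 (fun x => h_ n x - k x)%R <= (1 * 2^-1 ^+ n)%:E)%E by rewrite mul1r.
have := fast_cvg_ae two0 m1 c10 (ler1n R 2) ler01 mh mk hn.
by apply: ae_imp => x; apply; exact: oner_neq0.
Qed.

Section Multiplier.
Variable alpha : dyadic -> R.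

Lemma haar_partial_sumB F f g x : in_L2 f -> in_L2 g ->
  haar_partial_sum alpha F (fun x => f x - g x) x =
  haar_partial_sum alpha F f x - haar_partial_sum alpha F g x.
Proof.
move=> /in_L2_dyadic_integrable fi /in_L2_dyadic_integrable gi.
rewrite /haar_partial_sum -sumrB; apply: eq_bigr => I _.
rewrite -mulrBl -mulrBr; congr (_ * _ * _).
have := integral_lin 1 (-1) (mul_haar_integrable I fi) (mul_haar_integrable I gi).
rewrite mul1r mulN1r => <-; apply: eq_Rintegral => y _.
by rewrite mulrBl mul1r mulN1r.
Qed.

Lemma haar_multiplierB f g f' g' : haar_multiplier alpha f g ->
  haar_multiplier alpha f' g' ->
  haar_multiplier alpha (fun x => f x - f' x) (fun x => g x - g' x).
Proof.
move=> [f2 g2 fg] [f2' g2' fg'].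
have B (h k : R -> R) : in_L2 h -> in_L2 k -> in_L2 (fun x => h x - k x).
  by move=> /in_L2P hh /in_L2P kk; apply/in_L2P; apply: in_LpB => //; rewrite ler1n.
split; [exact: B|exact: B|move=> e e0].
have [F1 h1] := fg _ (divr_gt0 e0 two0); have [F2 h2] := fg' _ (divr_gt0 e0 two0).
exists (F1 `|` F2)%fset => F FF.
have := h1 F (fsubset_trans (fsubsetUl _ _) FF).
have := h2 F (fsubset_trans (fsubsetUr _ _) FF).
have [mg _] := (proj1 (in_L2P _) g2); have [mg' _] := (proj1 (in_L2P _) g2').
set S := haar_partial_sum alpha F.
have mS h : measurable_fun setT (S h) by exact: measurable_haar_partial_sum.
rewrite (Lnorm2E (fun x => S f' x - g' x)) (Lnorm2E (fun x => S f x - g x)) => l2 l1.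
rewrite (Lnorm2E (fun x => S (fun x => f x - f' x) x - (g x - g' x))).
have -> : (fun x => S (fun x => f x - f' x) x - (g x - g' x)) =
    (fun x => (S f x - g x) + (g' x - S f' x)).
  by apply/funext => x; rewrite /S haar_partial_sumB//; ring.
apply: le_lt_trans (le_Lp_normD two0 m1 c10 _ _ _) _.
- by rewrite ler1n.
- exact: measurable_funB.
- exact: measurable_funB.
by rewrite (Lp_normC _ _ g') (splitr e) EFinD; exact: lteD l1 l2.
Qed.

Lemma haar_multiplier0 : haar_multiplier alpha (fun=> 0) (fun=> 0 : R).
Proof.
have z : in_L2 (fun=> 0 : R).
  apply/in_L2P; split=> //; rewrite Lp_normE weighted_sqr.
  by rewrite nnint0 ?poweR0r// => x; rewrite expr0n.
have i0 I : inner (fun=> 0) (haar I) = 0 :> R.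
  rewrite /inner; under eq_Rintegral do rewrite mul0r.
  by rewrite Rintegral_cst// mul0r.
split=> // e e0; exists fset0 => F _.
rewrite (Lnorm2E (fun x => haar_partial_sum alpha F (fun=> 0) x - 0)).
rewrite Lp_norm0 ?lte_fin// => x; rewrite subr0 /haar_partial_sum big1//.
by move=> I _; rewrite i0 mulr0 mul0r.
Qed.

Variable L : R.
Hypothesis aL : forall I, `|alpha I| <= L.

Let L0 : 0 <= L. Proof. exact: le_trans (normr_ge0 _) (aL (0, 0)). Qed.

(** Pair g = T_F f with itself: the integral X of g^2 is the sum of
    alpha <f, h> <g, h>, at most half the sum of L^2 <f, h>^2 plus half the sum of
    <g, h>^2, and by [haar_bessel] for g the latter is at most X. *)
Lemma haar_partial_sum_sqr_le f F : in_L2 f ->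
  (nnint (fun x => haar_partial_sum alpha F f x ^+ 2)%R <=
    (L ^+ 2 * \sum_(I <- F) inner f (haar I) ^+ 2)%:E)%E.
Proof.
move=> f2; have fi := in_L2_dyadic_integrable f2.
have one_i : dyadic_integrable (@cst R R 1).
  split=> // I; apply: (@le_lt_trans _ _ (nnint_on (dset I) (cst 1))).
    apply: le_of_eq; apply: eq_nnint => x.
    by rewrite /= normr1.
  by rewrite nnint_indic ?lebesgue_dyadic_set ?ltry//; exact: measurable_dyadic_set.
have [gfin _ _] := @pairing_bound R alpha F L 2 f (cst 1) (ltr1n R 2) aL fi c10 one_i.
set g := haar_partial_sum alpha F f in gfin *.
have mg : measurable_fun setT g by exact: measurable_haar_partial_sum.
rewrite weighted_sqr in gfin.
have g2 : in_L2 g.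
  apply/in_L2P; split=> //; rewrite Lp_normE weighted_sqr.
  by rewrite poweR_lty.
have gi := in_L2_dyadic_integrable g2.
have XE : fine (nnint (fun x => g x ^+ 2)%R) =
    \sum_(I <- F) (alpha I * inner f (haar I)) * inner g (haar I).
  rewrite -integral_lincomb => [|I]; last exact: mul_haar_integrable.
  apply: eq_Rintegral => x _; rewrite expr2 {2}/g /haar_partial_sum mulr_sumr.
  by apply: eq_bigr => I _; rewrite mulrCA.
rewrite -(nnint_fin _ gfin); last by move=> x; exact: sqr_ge0.
rewrite lee_fin; have B := haar_bessel F g2.
set X := fine _ in XE B *.
have : X <= 2^-1 * (L ^+ 2 * \sum_(I <- F) inner f (haar I) ^+ 2) + 2^-1 * X.
  rewrite {1}XE; apply: le_trans (lerD (lexx _) (ler_wpM2l _ B)) => //.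
  rewrite mulrA !mulr_sumr -big_split/=; apply: ler_sum => I _.
  have : alpha I ^+ 2 <= L ^+ 2.
    by rewrite -[leLHS]real_normK ?num_real// ler_sqr ?nnegrE.
  move: (alpha I) (inner f _) (inner g _) => a x y aLL.
  have := sqr_ge0 (a * x - y); have := sqr_ge0 x; nra.
by clear; move: X (L ^+ 2 * _) => X Y; lra.
Qed.

Lemma sum_fsetD (a : dyadic -> R) (F G : {fset (int * int)}) : (G `<=` F)%fset ->
  \sum_(I <- F) a I = \sum_(I <- G) a I + \sum_(I <- (F `\` G)%fset) a I.
Proof.
move=> GF; rewrite -big_cat; apply: perm_big; apply: uniq_perm.
- exact: fset_uniq.
- rewrite cat_uniq !fset_uniq andbT/=; apply/hasPn => I.
  by rewrite in_fsetD => /andP[].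
move=> I; rewrite mem_cat in_fsetD; have [IG|] //= := boolP (I \in G).
by rewrite (fsubsetP GF).
Qed.

(** Take G such that the sum of the squared coefficients over G is nearly the
    supremum over all finite families: little is left for a family disjoint
    from G. *)
Lemma haar_partial_sum_cauchy f (e : R) : in_L2 f -> 0 < e ->
  exists G : {fset (int * int)}, forall F : {fset (int * int)}, (G `<=` F)%fset ->
  (norm2 (fun x => haar_partial_sum alpha F f x - haar_partial_sum alpha G f x)%R <= e%:E)%E.
Proof.
move=> f2 e0.
pose S := [set \sum_(I <- F) inner f (haar I) ^+ 2 | F in [set: {fset (int * int)}]].
have Ssup : has_sup S.
  split; first by exists (\sum_(I <- fset0) inner f (haar I) ^+ 2), fset0.
  by exists (fine (nnint (fun x => f x ^+ 2)%R)) => _ [F _ <-]; exact: haar_bessel.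
have L1 : 0 < L ^+ 2 + 1 by rewrite ltr_wpDl// sqr_ge0.
have d0 : 0 < e ^+ 2 / (L ^+ 2 + 1) by rewrite divr_gt0// exprn_gt0.
have [_ [G _ <-] hG] := sup_adherent d0 Ssup; exists G => F GF.
apply/norm2_le; first exact: ltW.
under eq_nnint => x do rewrite /haar_partial_sum (sum_fsetD _ GF) addrC addKr.
apply: le_trans (haar_partial_sum_sqr_le _ f2) _; rewrite lee_fin.
have : \sum_(I <- F) inner f (haar I) ^+ 2 <= sup S by apply: sup_upper_bound => //; exists F.
rewrite (sum_fsetD _ GF); set a := \sum_(I <- G) _ in hG *; set b := \sum_(I <- (_ `\` _)%fset) _.
move=> h; have {h hG} : b <= e ^+ 2 / (L ^+ 2 + 1) by lra.
have b0 : 0 <= b by apply: sumr_ge0 => I _; exact: sqr_ge0.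
by rewrite ler_pdivlMr// mulrDr mulr1 mulrC => h; apply: le_trans h; rewrite lerDl.
Qed.

(** The families G n of [haar_partial_sum_cauchy] are not nested; two of them are
    compared through their union. *)
Lemma haar_multiplier_exists f : in_L2 f -> exists g, haar_multiplier alpha f g.
Proof.
move=> f2.
have e0 n : 0 < (2 ^+ n)^-1 :> R by rewrite invr_gt0 exprn_gt0.
have [G hG] := choice (fun n => haar_partial_sum_cauchy f2 (e0 n)).
pose T F := haar_partial_sum alpha F f.
have mT F : measurable_fun setT (T F) by exact: measurable_haar_partial_sum.
have via := le_Lp_norm_via two0 m1 c10 (ler1n R 2).
have [] := @riesz_fischer R 2 (cst 1) two0 m1 c10 (ler1n R 2) (fun n => T (G n)) 2 _.
- by [].
- by move=> n; exact: mT.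
- move=> n; apply: le_trans (via _ (T (G n `|` G n.+1)%fset) _ _ _ _) _ => //.
  have -> : 2 / 2 ^+ n = (2 ^+ n)^-1 + (2 ^+ n)^-1 :> R by rewrite -mulr2n mulr_natl.
  rewrite EFinD; apply: leeD; last by apply: hG; rewrite fsubsetUl.
  rewrite Lp_normC; apply: le_trans (hG n.+1 _ _) _; first by rewrite fsubsetUr.
  by rewrite lee_fin lef_pV2 ?posrE ?exprn_gt0// ler_eXn2l// ltr1n.
move=> g [mg _ hg]; exists g.
have lim (e : R) : 0 < e -> exists F0 : {fset (int * int)}, forall F : {fset (int * int)},
    (F0 `<=` F)%fset -> (norm2 (fun x => T F x - g x)%R < e%:E)%E.
  move=> e_gt0; have [n hn] := inv_pow2_small (divr_gt0 e_gt0 (ltr0n R 5)).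
  exists (G n) => F GF; apply: (@le_lt_trans _ _ ((2 ^+ n)^-1%:E + (2 * 2 / 2 ^+ n)%:E)%E).
    apply: le_trans (via _ (T (G n)) _ _ _ _) _ => //.
    by apply: leeD; [exact: hG|rewrite Lp_normC].
  by rewrite -EFinD lte_fin; move: hn; rewrite exprVn; move: (2 ^+ n)^-1 => y; lra.
split=> //; last first.
  move=> e /lim[F0 hF]; exists F0 => F /hF.
  by rewrite -Lnorm2E.
apply/in_L2P; split=> //.
have [F0 /(_ F0 (fsubset_refl _))h] := lim 1 ltr01.
have -> : g = (fun x => T F0 x + (g x - T F0 x)) by apply/funext => x; rewrite addrC subrK.
apply: le_lt_trans (le_Lp_normD two0 m1 c10 _ _ _) _ => //.
- by rewrite ler1n.
- exact: measurable_funB.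
apply: lte_add_pinfty; last by rewrite Lp_normC; apply: lt_trans h _; exact: ltry.
rewrite Lp_normE weighted_sqr poweR_lty//.
by apply: le_lt_trans (haar_partial_sum_sqr_le _ f2) _; exact: ltry.
Qed.

End Multiplier.

End SquareIntegrable.

(** * The continuous extension *)

Section Truncation.
Variable R : realType.
Local Notation mu := (@lebesgue_measure R).
Implicit Types f : R -> R.

Let box (n : nat) : set R := `[- n%:R, n%:R].

Definition truncation f (n : nat) (x : R) : R := \1_(box n) x * (\1_(box n) (f x) * f x).

Let m_indic_box n (h : R -> R) : measurable_fun setT h ->
  measurable_fun setT (fun x => \1_(box n) (h x) : R).
Proof.
move=> mh; have m : measurable_fun setT (\1_(box n) : R -> R).
  by apply: measurable_indic; exact: measurable_itv.
exact: (measurableT_comp m mh).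
Qed.

Lemma measurable_truncation f n : measurable_fun setT f ->
  measurable_fun setT (truncation f n).
Proof.
by move=> mf; apply: measurable_funM; [exact: m_indic_box|
  apply: measurable_funM => //; exact: m_indic_box].
Qed.

Lemma abs_truncation_sub_le f n x : `|truncation f n x - f x| <= `|f x|.
Proof.
rewrite /truncation !indicE; case: (x \in _); case: (f x \in _);
  by rewrite ?mul1r ?mul0r ?mulr0 ?subrr ?sub0r ?normrN ?normr0.
Qed.

Lemma truncation_eventually f x : \forall n \near \oo, truncation f n x = f x.
Proof.
exists (Num.truncn (`|x| + `|f x|)).+1 => // n /= hn.
have big (y : R) : `|y| <= `|x| + `|f x| -> y \in box n.
  move=> yle; apply/mem_set; rewrite /box /= in_itv/= -ler_norml.
  apply: le_trans yle _; apply: ltW; apply: lt_le_trans (truncnS_gt _) _.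
  by rewrite ler_nat.
by rewrite /truncation !indicE !big ?mul1r// ?lerDl ?lerDr.
Qed.

Lemma truncation_in_L2 f n : measurable_fun setT f -> in_L2 (truncation f n).
Proof.
move=> mf; have mt := measurable_truncation n mf.
apply/in_L2P; split => //; rewrite Lp_normE weighted_sqr poweR_lty//.
have mb : measurable (box n) by exact: measurable_itv.
apply: (@le_lt_trans _ _ (nnint_on (box n) (fun x => n%:R ^+ 2 * @cst R R 1 x)%R)).
  apply: le_nnint => [|||x].
  - exact: measurable_sqr.
  - by apply: measurable_indicM => //; exact: measurable_funM.
  - by move=> x; exact: sqr_ge0.
  rewrite /truncation mulr1 exprMn !indicE.
  have [xb|] := boolP (x \in box n); last by rewrite expr2 !mul0r.
  have [/set_mem|] := boolP (f x \in box n); last by rewrite mul0r expr0n mulr0 mul1r sqr_ge0.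
  rewrite /box/= in_itv/= -ler_norml => h.
  by rewrite expr1n !mul1r -[leLHS]real_normK ?num_real// ler_sqr ?nnegrE.
rewrite nnint_onZ ?sqr_ge0// nnint_indic// lebesgue_measure_itv/=.
by case: ifP => _; rewrite -?EFinB -?EFinM ?mule0 ltry.
Qed.

Lemma truncation_cvg (p : R) (v f : R -> R) : 0 < p -> measurable_fun setT v ->
  (forall x, 0 <= v x) -> in_Lp p v f -> forall e : R, 0 < e ->
  exists n, (Lp_norm p v (fun x => truncation f n x - f x)%R < e%:E)%E.
Proof.
move=> p0 mv v0 [mf ff] e e0.
have mt n := measurable_truncation n mf.
have md n : measurable_fun setT (fun x => truncation f n x - f x) by exact: measurable_funB.
have Ffin : (nnint (fun x => `|f x| `^ p * v x)%R < +oo)%E.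
  apply: (@le_lt_trans _ _ (Lp_norm p v f `^ p)%E); last by rewrite poweR_lty.
  exact/(le_Lp_norm p0 v0 f (Lp_norm_ge0 p v f)).
have mF := measurable_weighted_pow p mv mf.
have c : (fun n => nnint (fun x => `|truncation f n x - f x| `^ p * v x)%R) @ \oo --> 0%E.
  rewrite -(@integral0 _ _ R mu setT).
  apply: (@dominated_cvg _ _ R mu setT measurableT
    (fun n x => (`|truncation f n x - f x| `^ p * v x)%:E) _
    (fun x => (`|f x| `^ p * v x)%:E)).
  - by move=> n; apply: measurable_EFinT; exact: (measurable_weighted_pow p mv (md n)).
  - move=> x _; apply: cvg_near_cst; apply: filterS (truncation_eventually f x) => n ->.
    by rewrite subrr normr0 powR0 ?gt_eqF// mul0r.
  - by [].
  - apply/integrableP; split; first exact: measurable_EFinT.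
    under eq_integral do rewrite gee0_abs ?lee_fin ?mulr_ge0 ?powR_ge0//.
    exact: Ffin.
  move=> n x _; rewrite gee0_abs ?lee_fin ?mulr_ge0 ?powR_ge0// ler_wpM2r//.
  by apply: ge0_ler_powR; rewrite ?nnegrE ?(ltW p0)// abs_truncation_sub_le.
have d0 : 0 < (e / 2) `^ p by rewrite powR_gt0// divr_gt0.
have e20 : 0 < e / 2 by rewrite divr_gt0.
have : \forall n \near \oo, (nnint (fun x => `|truncation f n x - f x| `^ p * v x)%R <
    ((e / 2) `^ p)%:E)%E.
  by apply: (c [set y | y < ((e / 2) `^ p)%:E]%E); apply: open_ereal_lt'; rewrite lte_fin.
move=> [N _ /(_ N (leqnn N)) hN]; exists N.
apply: (@le_lt_trans _ _ (e / 2)%:E); last by rewrite lte_fin; lra.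
apply/(le_Lp_norm p0 v0); first by rewrite lee_fin ltW.
by rewrite poweR_EFin ltW.
Qed.

End Truncation.

Section Extension.
Variable R : realType.
Variables (alpha : dyadic -> R) (L p K : R) (u v : R -> R).
Hypotheses (aL : forall I, `|alpha I| <= L) (p1 : 1 < p) (K0 : 0 <= K).
Hypotheses (wu : weight u) (wv : weight v).
Hypothesis UB : forall F f, in_L2 f -> in_Lp p v f ->
  (Lp_norm p u (haar_partial_sum alpha F f) <= K%:E * Lp_norm p v f)%E.
Implicit Types f g h : R -> R.

Let p0 : 0 < p. Proof. exact: lt_trans p1. Qed.
Let p1' : 1 <= p. Proof. exact: ltW. Qed.
Let u0 x : 0 <= u x. Proof. by case: wu. Qed.
Let v0 x : 0 <= v x. Proof. by case: wv. Qed.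
Let m_u : measurable_fun setT u. Proof. by case: wu => _ []. Qed.
Let m_v : measurable_fun setT v. Proof. by case: wv => _ []. Qed.
Local Notation du h k := (Lp_norm p u (fun x => h x - k x)%R).
Local Notation dv h k := (Lp_norm p v (fun x => h x - k x)%R).

(** Finite sums that converge fast enough in L^2 converge almost everywhere, and
    Fatou's lemma in L^p(u) carries over the uniform bound. *)
Lemma haar_multiplier_bound f g : in_Lp p v f -> haar_multiplier alpha f g ->
  (Lp_norm p u g <= K%:E * Lp_norm p v f)%E.
Proof.
move=> fv [f2 /in_L2P[mg _] fg].
have e0 n : 0 < 2^-1 ^+ n :> R by rewrite exprn_gt0// invr_gt0.
have [F hF] := choice (fun n => fg _ (e0 n)).
pose h_ n := haar_partial_sum alpha (F n) f.
have mh n : measurable_fun setT (h_ n) by exact: measurable_haar_partial_sum.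
apply: (@Lp_fatou _ p u p0 m_u u0 h_) => //.
- by rewrite mule_ge0 ?lee_fin// Lp_norm_ge0.
- have hn n : (Lp_norm 2 (cst 1%R) (fun x => h_ n x - g x)%R <= (2^-1 ^+ n)%:E)%E.
    by rewrite -(Lnorm2E (fun x => h_ n x - g x)); apply/ltW/hF/fsubset_refl.
  by apply: ae_imp (L2_fast_cvg_ae mh mg hn) => x hx _.
by move=> n; exact: UB.
Qed.

Lemma haar_multiplier_contract f g f' g' : in_Lp p v f -> in_Lp p v f' ->
  haar_multiplier alpha f g -> haar_multiplier alpha f' g' ->
  (du g g' <= K%:E * dv f f')%E.
Proof.
move=> fv fv' fg fg'; apply: haar_multiplier_bound; first exact: in_LpB.
exact: haar_multiplierB.
Qed.

Lemma L2_dense f (e : R) : in_Lp p v f -> 0 < e ->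
  exists f' g', [/\ in_Lp p v f', haar_multiplier alpha f' g' & (dv f' f <= e%:E)%E].
Proof.
move=> fv e0; have [n hn] := truncation_cvg p0 m_v v0 fv e0; have [mf ff] := fv.
have [g fg] := haar_multiplier_exists aL (truncation_in_L2 n mf).
exists (truncation f n), g; split; [|exact: fg|exact: ltW hn].
split; first exact: measurable_truncation.
have -> : truncation f n = (fun x => (truncation f n x - f x) + f x).
  by apply/funext => x; rewrite subrK.
apply: le_lt_trans (le_Lp_normD p0 m_v v0 p1' _ mf) _.
  by apply: measurable_funB => //; exact: measurable_truncation.
exact: lte_add_pinfty (lt_trans hn (ltry _)) ff.
Qed.

(** The value at f of the extension, described without an approximating sequence:
    its distance to each T_alpha f' is what boundedness predicts.  Such an h is the
    limit along every approximating sequence. *)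
Definition extends_at f h := in_Lp p u h /\
  forall f' g', in_Lp p v f' -> haar_multiplier alpha f' g' ->
    (du g' h <= K%:E * dv f' f)%E.

Lemma in_Lp_of_multiplier f g : in_Lp p v f -> haar_multiplier alpha f g -> in_Lp p u g.
Proof.
move=> fv fg; split; first by case: fg => _ /in_L2P[].
apply: le_lt_trans (haar_multiplier_bound fv fg) _.
by apply: lte_mul_fin; [exact: Lp_norm_ge0|case: fv].
Qed.

Lemma dv_fin f f' : in_Lp p v f -> in_Lp p v f' -> exists2 d : R, 0 <= d & dv f f' = d%:E.
Proof.
move=> fv fv'; have [_ dfin] := in_LpB p1' m_v v0 fv fv'.
exists (fine (dv f f')); first by rewrite fine_ge0// Lp_norm_ge0.
by rewrite fineK// ge0_fin_numE// Lp_norm_ge0.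
Qed.

(** The images of approximants of f that converge fast form a Cauchy sequence that
    converges fast in L^p(u). *)
Lemma extends_at_exists f : in_Lp p v f -> exists h, extends_at f h.
Proof.
move=> fv; have e0 n : 0 < 2^-1 ^+ n :> R by rewrite exprn_gt0// invr_gt0.
have [fn hfn] := choice (fun n => L2_dense fv (e0 n)).
have [gn hgn] := choice hfn.
have viav := le_Lp_norm_via p0 m_v v0 p1'.
have viau := le_Lp_norm_via p0 m_u u0 p1'.
have mf : measurable_fun setT f by case: fv.
have fnv n : in_Lp p v (fn n) by case: (hgn n).
have fgn n : haar_multiplier alpha (fn n) (gn n) by case: (hgn n).
have dfn n : (dv (fn n) f <= (2^-1 ^+ n)%:E)%E by case: (hgn n).
have mfn n : measurable_fun setT (fn n) by case: (fnv n).
have mgn n : measurable_fun setT (gn n) by case: (in_Lp_of_multiplier (fnv n) (fgn n)).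
have [|||h [mh _ hh]] := @riesz_fischer R p u p0 m_u u0 p1' gn (2 * K).
- by rewrite mulr_ge0.
- exact: mgn.
- move=> n; apply: le_trans (haar_multiplier_contract (fnv n.+1) (fnv n) (fgn n.+1) (fgn n)) _.
  rewrite (mulrC 2) -mulrA EFinM lee_wpmul2l ?lee_fin//.
  apply: le_trans (viav _ f _ _ _ _) _ => //.
  rewrite (Lp_normC p v f); apply: le_trans (leeD (dfn _) (dfn _)) _.
  rewrite -EFinD lee_fin exprS -exprVn.
  by have := e0 n; move: (2^-1 ^+ n) => y; lra.
exists h; split.
  split=> //; have -> : h = (fun x => (h x - gn 0%N x) + gn 0%N x).
    by apply/funext => x; rewrite subrK.
  apply: le_lt_trans (le_Lp_normD p0 m_u u0 p1' _ (mgn 0%N)) _.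
    exact: measurable_funB.
  apply: lte_add_pinfty; first by apply: le_lt_trans (hh 0%N) _; exact: ltry.
  by case: (in_Lp_of_multiplier (fnv 0%N) (fgn 0%N)).
move=> f' g' fv' fg'.
have mf' : measurable_fun setT f' by case: fv'.
have mg' : measurable_fun setT g' by case: (in_Lp_of_multiplier fv' fg').
have [d d0 dE] := dv_fin fv' fv; rewrite dE -EFinM.
apply: (@le_of_geometric_error _ _ _ (5 * K)) => n.
apply: le_trans (viau _ (gn n) _ _ _ _) _ => //.
have b1 : (du g' (gn n) <= (K * (d + 2^-1 ^+ n))%:E)%E.
  apply: le_trans (haar_multiplier_contract fv' (fnv n) fg' (fgn n)) _.
  rewrite EFinM lee_wpmul2l ?lee_fin//.
  apply: le_trans (viav _ f _ _ _ _) _ => //.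
  by rewrite dE EFinD leeD2l// Lp_normC.
have b2 : (du (gn n) h <= (2 * (2 * K) / 2 ^+ n)%:E)%E by rewrite Lp_normC.
apply: le_trans (leeD b1 b2) _; rewrite -EFinD lee_fin -exprVn.
apply: le_of_eq; ring.
Qed.

Lemma extends_at_contract f f' h h' : in_Lp p v f -> in_Lp p v f' ->
  extends_at f h -> extends_at f' h' -> (du h' h <= K%:E * dv f' f)%E.
Proof.
move=> fv fv' [[mh _] fh] [[mh' _] fh'].
have mf : measurable_fun setT f by case: fv.
have mf' : measurable_fun setT f' by case: fv'.
have viav := le_Lp_norm_via p0 m_v v0 p1'.
have viau := le_Lp_norm_via p0 m_u u0 p1'.
have [d d0 dE] := dv_fin fv' fv; rewrite dE -EFinM.
apply: (@le_of_geometric_error _ _ _ (2 * K)) => n.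
have [|k [l [kv kl dk]]] := L2_dense (e := 2^-1 ^+ n) fv'.
  by rewrite exprn_gt0// invr_gt0.
have mk : measurable_fun setT k by case: kv.
have ml : measurable_fun setT l by case: (in_Lp_of_multiplier kv kl).
apply: le_trans (viau _ l _ _ _ _) _ => //.
have b1 : (du h' l <= (K * 2^-1 ^+ n)%:E)%E.
  rewrite Lp_normC; apply: le_trans (fh' _ _ kv kl) _.
  by rewrite EFinM lee_wpmul2l ?lee_fin.
have b2 : (du l h <= (K * (2^-1 ^+ n + d))%:E)%E.
  apply: le_trans (fh _ _ kv kl) _; rewrite EFinM lee_wpmul2l ?lee_fin//.
  by apply: le_trans (viav _ f' _ _ _ _) _ => //; rewrite EFinD dE leeD2r.
apply: le_trans (leeD b1 b2) _; rewrite -EFinD lee_fin.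
apply: le_of_eq; ring.
Qed.

Lemma extends_at_bound f h : in_Lp p v f -> extends_at f h ->
  (Lp_norm p u h <= K%:E * Lp_norm p v f)%E.
Proof.
move=> fv [_ fh].
have zv : in_Lp p v (fun=> 0).
  by split=> //; rewrite Lp_norm0 ?ltry.
have := fh _ _ zv (haar_multiplier0 alpha).
rewrite (@eq_Lp_norm _ p u (fun x => 0 - h x) h); last by move=> x; rewrite sub0r normrN.
by rewrite (@eq_Lp_norm _ p v (fun x => 0 - f x) f)// => x; rewrite sub0r normrN.
Qed.

(** By continuity T f is close to T k for k in L^2 close to f, and T k is determined
    almost everywhere for u dx. *)
Lemma extends_at_unique T f h : haar_extension alpha p u v T -> in_Lp p v f ->
  extends_at f h -> ae_eq_weight u (T f) h.
Proof.
move=> [T1 T2 T3] fv [[mh _] fh].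
have [mTf _] := T1 f fv.
have viau := le_Lp_norm_via p0 m_u u0 p1'.
apply: (@Lp_norm_eq0 _ p _ m_u u0) => //.
apply/eqP; rewrite eq_le Lp_norm_ge0 andbT.
apply: (@le_of_geometric_error _ _ 0 (1 + K)) => n; rewrite add0r.
have e0 : 0 < 2^-1 ^+ n :> R by rewrite exprn_gt0// invr_gt0.
have [d d0 hd] := T3 f fv _ e0.
pose r := Num.min (d / 2) (2^-1 ^+ n).
have r0 : 0 < r by rewrite lt_min e0 divr_gt0.
have [k [l [kv kl dk]]] := L2_dense fv r0.
have [k2 _ _] := kl.
have [mTk _] := T1 k kv.
have dk1 : (dv k f < d%:E)%E.
  apply: le_lt_trans dk _; rewrite lte_fin.
  apply: (@le_lt_trans _ _ (d / 2)); first by rewrite ge_min lexx.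
  by move: d0; lra.
have dk2 : (dv k f <= (2^-1 ^+ n)%:E)%E.
  by apply: le_trans dk _; rewrite lee_fin ge_min lexx orbT.
have [g kg Tkg] := T2 k k2 kv.
have mg : measurable_fun setT g by case: (in_Lp_of_multiplier kv kg).
apply: le_trans (viau _ (T k) _ _ _ _) _ => //.
rewrite mulrDl mul1r EFinD; apply: leeD.
  by rewrite Lp_normC; apply: ltW; exact: hd.
rewrite (@Lp_norm_ae_eq _ p u m_u (fun x => T k x - h x) (fun x => g x - h x)).
- apply: le_trans (fh _ _ kv kg) _.
  by rewrite EFinM lee_wpmul2l ?lee_fin.
- exact: measurable_funB.
- exact: measurable_funB.
by apply: ae_imp Tkg => x hx ux; rewrite hx.
Qed.

Lemma haar_norm_inequality_of_bound : haar_norm_inequality alpha p u v K%:E.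
Proof.
split=> [f g _ fv fg|]; first exact: haar_multiplier_bound.
have ex f : exists h, in_Lp p v f -> extends_at f h.
  have [fv|nfv] := pselect (in_Lp p v f); last by exists f.
  by have [h fh] := extends_at_exists fv; exists h.
have [T hT] := choice ex; exists T; split.
- split=> [f fv|f f2 fv|f fv e e0].
  + by case: (hT f fv).
  + have [g fg] := haar_multiplier_exists aL f2; exists g => //.
    have [[mT _] h] := hT f fv.
    have mg : measurable_fun setT g by case: (in_Lp_of_multiplier fv fg).
    apply: (@Lp_norm_eq0 _ p _ m_u u0) => //; rewrite Lp_normC.
    apply/eqP; rewrite eq_le Lp_norm_ge0 andbT; apply: le_trans (h _ _ fv fg) _.
    by rewrite Lp_norm0 ?mule0// => x; rewrite subrr.
  have K1 : 0 < K + 1 by rewrite ltr_wpDl.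
  exists (e / (K + 1)); first by rewrite divr_gt0.
  move=> f' fv' df.
  apply: le_lt_trans (extends_at_contract fv fv' (hT f fv) (hT f' fv')) _.
  have [d d0 dE] := dv_fin fv' fv; move: df; rewrite /= dE -EFinM !lte_fin.
  rewrite ltr_pdivlMr// mulrDr mulr1 mulrC => h; apply: le_lt_trans h.
  by rewrite lerDl.
- by move=> T' hT' f fv; exact: extends_at_unique hT' fv (hT f fv).
by move=> f fv; exact: extends_at_bound fv (hT f fv).
Qed.

End Extension.

(** * The norm inequalities *)

Section NormInequalities.
Variable R : realType.

Lemma linfty_norm_finite (alpha : dyadic -> R) : (linfty_norm alpha < +oo)%E ->
  exists2 L : R, linfty_norm alpha = L%:E & forall I, `|alpha I| <= L.
Proof.
move=> afin.
have le I : (`|alpha I|%:E <= linfty_norm alpha)%E.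
  by apply: ereal_sup_ubound; exists I.
have a0 : (0 <= linfty_norm alpha)%E by apply: le_trans (le (0, 0)); rewrite lee_fin.
have aE : linfty_norm alpha = (fine (linfty_norm alpha))%:E.
  by rewrite fineK// ge0_fin_numE.
by exists (fine (linfty_norm alpha)) => // I; rewrite -lee_fin -aE.
Qed.

Definition sparse_const (p A1 A2 : R) : R := 128 * (A1 * A2 `^ (p - 1)) `^ p^-1.

Lemma sparse_form_norm_inequality (p K A1 A2 : R) (u v : R -> R) (alpha : dyadic -> R) :
  1 < p -> 0 <= K -> 0 <= A1 -> 0 < A2 -> weight u -> weight v ->
  (forall f, dyadic_integrable f -> in_Lp p v f -> sparse_form_bound p u v f K A1 A2) ->
  (linfty_norm alpha < +oo)%E ->
  haar_norm_inequality alpha p u v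
    ((sparse_const p A1 A2 * K)%:E * linfty_norm alpha)%E.
Proof.
move=> p1 K0 A10 A20 wu wv SB /linfty_norm_finite[L -> aL]; rewrite -EFinM.
have L0 : 0 <= L by apply: le_trans (aL (0, 0)).
have -> : sparse_const p A1 A2 * K * L = L * (128 * K * (A1 * A2 `^ (p - 1)) `^ p^-1).
  by rewrite /sparse_const; ring.
apply: (haar_norm_inequality_of_bound aL) => //.
  by rewrite mulr_ge0// mulr_ge0 ?powR_ge0// mulr_ge0.
move=> F f f2 fv; have fi := in_L2_dyadic_integrable f2.
apply: finite_sum_bound => //.
- by case: wu.
- exact: weight_dyadic_integrable.
- by case: wv.
exact: SB.
Qed.

End NormInequalities.

Unset Implicit Arguments.
Set Strict Implicit.

Theorem theorem1p7 (R : realType) (p : R) (hp : 1 < p) :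
  (exists C : R,
    forall (alpha : dyadic -> R), (linfty_norm alpha < +oo)%E ->
    forall (w : R -> R), Ap_weight p w ->
      haar_norm_inequality alpha p w w
        (C%:E * linfty_norm alpha *
          (Ap_const p w `^ Num.max 1%R (p - 1)^-1%R))%E)
  /\
  (forall (A B : R -> R) (u v : R -> R),
    young_function A -> young_function B ->
    Bp (conj_exponent p) (associate A) -> Bp p (associate B) ->
    weight u -> weight v ->
    (bump_const p A B u v < +oo)%E ->
    exists C : R,
      forall (alpha : dyadic -> R), (linfty_norm alpha < +oo)%E ->
        haar_norm_inequality alpha p u v (C%:E * linfty_norm alpha)%E).
Proof.
split.
  set A1 := embedding_const p; set A2 := embedding_const (conj_exponent p).
  exists (sparse_const p A1 A2 * Ap_form_const p) => alpha afin w wA.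
  have [ww Aoo] := wA.
  have Afin : Ap_const p w = (fine (Ap_const p w))%:E.
    by rewrite fineK// ge0_fin_numE// Ap_const_ge0.
  rewrite Afin poweR_EFin muleAC -EFinM -mulrA.
  apply: sparse_form_norm_inequality => //.
  - by rewrite mulr_ge0 ?powR_ge0// addr_ge0 ?powR_ge0.
  - by apply: ltW; exact: embedding_const_gt0.
  - by apply: embedding_const_gt0; exact: conj_exponent_gt1.
  by move=> f fi fw; exact: Ap_sparse_form_bound.
move=> A B u v yA yB bA bB wu wv bump.
have [K [A1 [A2 [K0 A10 A20 SB]]]] := bump_sparse_form_bound hp yA yB bA bB wu wv bump.
by exists (sparse_const p A1 A2 * K) => alpha afin; exact: sparse_form_norm_inequality.
Qed.
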